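(* Let $b$ be a graph over $(X,m)$ with the normalizing measure $m=\deg$, equipped with the combinatorial graph distance $\rho$. Let $n>2$ be a constant, let $\tfrac{\operatorname{diam}(X)}{2}\ge R_2\ge 8R_1\ge 512$, and assume $$\mu:=\sup_{x\in X}\frac{m(B_x(R_1))}{\deg_x}<\infty .$$ (i) If there is a constant $\phi>0$ such that the Sobolev inequality $S_\phi(n,R_1,R_2)$ holds in $B\subset X$, then there are constants $\Phi=\Phi(\phi,n,R_1)>0$ and $\Psi=\Psi(\phi,n,R_1)>0$ (depending only on $\phi,n,R_1$) such that the Gaussian upper bounds $G_\Psi(n,4R_1,R_2)$ and the volume doubling property $V_\Phi(n,R_1,R_2)$ hold in $B$. (ii) Let $o\in X$. If there are constants $\Phi,\Psi>0$ such that $G_\Psi(n,R_1,R_2)$ and $V_\Phi(n,R_1,R_2)$ hold in $B_o(R_2)$, then there is a constant $\phi=\phi(n,R_1,\Phi,\Psi,\mu)>0$ (depending only on $n,R_1,\Phi,\Psi,\mu$) such that $S_\phi(n,4R_1,R_2)$ holds in $o$.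
   Context: Setting. $X$ is an at most countable set, $m:X\to(0,\infty)$ is extended to a measure by $m(A)=\sum_{x\in A}m(x)$. A graph over $(X,m)$ is a symmetric $b:X\times X\to[0,\infty)$ with $b(x,x)=0$ and $\deg_x=\sum_{y}b(x,y)<\infty$ for all $x$; $x\sim y$ means $b(x,y)>0$. Here $m(x)=\deg_x$ and $\rho$ is the combinatorial graph distance (minimal number of edges of a path $x=x_0\sim\dots\sim x_k=y$), which is an intrinsic metric in this case. Standing assumption: the graph is connected and all balls $B_x(r)=\{y\in X:\rho(x,y)\le r\}$ are finite (so the graph is locally finite). The jump size is $S=1$. $\operatorname{diam}(X)=\sup_{x,y}\rho(x,y)$. $\mathcal C(A)$ is the set of real functions on $X$ supported in $A\subset X$, $\mathcal C_c(X)$ the finitely supported ones, $\|\cdot\|_p$ is the norm of $\ell^p(X,m)$, and $|\nabla f|(x)=\big(\frac1{m(x)}\sum_y b(x,y)(f(x)-f(y))^2\big)^{1/2}$. $\Delta\ge 0$ is the Friedrichs extension in $\ell^2(X,m)$ of $\Delta f(x)=\frac1{m(x)}\sum_y b(x,y)(f(x)-f(y))$ on $\mathcal C_c(X)$, $\Lambda=\inf\operatorname{spec}(\Delta)$, and $p_t(x,y)$ is the heat kernel, i.e. the minimal positive fundamental solution of $\frac{d}{dt}u=-\Delta u$; it is the kernel of $P_t=e^{-t\Delta}$: $P_tf(x)=\sum_y p_t(x,y)f(y)m(y)$. Properties, for $B\subset X$, $R_2\ge R_1\ge 0$ (a property ''holds in $o$'' means it holds in $B=\{o\}$), and positive constants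 $n>2,\phi,\Phi,\Psi$: $S_\phi(n,R_1,R_2)$ in $B$: for all $x\in B$, $r\in[R_1,R_2]$, $u\in\mathcal C(B_x(r))$, $$\frac{m(B_x(r))^{2/n}}{\phi r^2}\|u\|_{\frac{2n}{n-2}}^2\le \||\nabla u|\|_2^2+\frac1{r^2}\|u\|_2^2 .$$ $V_\Phi(n,R_1,R_2)$ in $B$: for all $x\in B$ and $R_1\le r_1\le r_2\le R_2$, $m(B_x(r_2))\le \Phi\,(r_2/r_1)^n\,m(B_x(r_1))$. $G_\Psi(n,R_1,R_2)$ in $B$: for all $t\ge R_1^2$ and $x,y\in B$, with $\rho_{xy}=\rho(x,y)$, $\tau=\sqrt t\wedge R_2$, $$p_t(x,y)\le \Psi^2\,\frac{\big(1\vee S^{-2}(\sqrt{t^2+\rho_{xy}^2S^2}-t)\big)^{n/2}}{\sqrt{m(B_x(\tau))m(B_y(\tau))}}\;e^{-\Lambda(t-t\wedge R_2^2)-\zeta(\rho_{xy},t)},$$ where $\zeta(r,t)=\frac1{S^2}\big(rS\operatorname{arsinh}(\tfrac{rS}{t})+t-\sqrt{t^2+r^2S^2}\big)$ and $S=1$. *)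

(* Defs.v *)
From HB Require Import structures.
From mathcomp Require Import all_boot all_order all_algebra.
From mathcomp Require Import all_classical all_reals all_analysis.

Set Implicit Arguments.
Unset Strict Implicit.
Unset Printing Implicit Defensive.

Import Order.TTheory GRing.Theory Num.Theory.
Import numFieldNormedType.Exports.

Local Open Scope classical_set_scope.
Local Open Scope ring_scope.

(** Sum of an absolutely summable real family over a countable set; a junk
    value if the family is not summable. *)
Definition rsum (R : realType) (X : countType) (f : X -> R) : R :=
  fine (esum [set: X] (EFin \o f)^\+ - esum [set: X] (EFin \o f)^\-)%E.

Definition arsinh (R : realType) (x : R) : R := ln (x + Num.sqrt (x ^+ 2 + 1)).

Definition edeg (R : realType) (X : countType) (b : X -> X -> R) (x : X) :
  \bar R := \esum_(y in [set: X]) (b x y)%:E.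

Definition deg (R : realType) (X : countType) (b : X -> X -> R) (x : X) : R :=
  fine (edeg b x).

Record is_graph (R : realType) (X : countType) (b : X -> X -> R) : Prop :=
  IsGraph {
    graph_ge0 : forall x y, 0 <= b x y ;
    graph_sym : forall x y, b x y = b y x ;
    graph_irr : forall x, b x x = 0 ;
    graph_deg : forall x, (edeg b x < +oo)%E }.

Definition adj (R : realType) (X : countType) (b : X -> X -> R) : rel X :=
  fun x y => 0 < b x y.

Definition is_walk (R : realType) (X : countType) (b : X -> X -> R)
  (x y : X) (p : seq X) : Prop := path (adj b) x p /\ last x p = y.

Definition graph_connected (R : realType) (X : countType) (b : X -> X -> R) :
  Prop := forall x y, exists p, is_walk b x y p.

Definition walk_length (R : realType) (X : countType) (b : X -> X -> R)
  (x y : X) : pred nat :=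
  fun k => `[< exists p, is_walk b x y p /\ size p = k >].

Definition gdist (R : realType) (X : countType) (b : X -> X -> R) (x y : X) :
  nat :=
  match pselect (exists k, walk_length b x y k) with
  | left ex => ex_minn ex
  | right _ => 0%N
  end.

Definition gball (R : realType) (X : countType) (b : X -> X -> R) (x : X)
  (r : R) : set X := [set y | (gdist b x y)%:R <= r].

Definition gdiam (R : realType) (X : countType) (b : X -> X -> R) : \bar R :=
  ereal_sup [set ((gdist b xy.1 xy.2)%:R)%:E | xy in [set: X * X]].

Definition mass (R : realType) (X : countType) (m : X -> R) (A : set X) :
  \bar R := \esum_(x in A) (m x)%:E.

Definition vol (R : realType) (X : countType) (b : X -> X -> R) (m : X -> R)
  (x : X) (r : R) : R := fine (mass m (gball b x r)).

Definition supported_in (R : realType) (X : countType) (A : set X)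
  (f : X -> R) : Prop := forall x, f x != 0 -> A x.

Definition finitely_supported (R : realType) (X : countType) (f : X -> R) :
  Prop := finite_set [set x | f x != 0].

Definition lpnorm (R : realType) (X : countType) (m : X -> R) (p : R)
  (f : X -> R) : \bar R :=
  ((\esum_(x in [set: X]) (`|f x| `^ p * m x)%:E) `^ p^-1)%E.

Definition l2 (R : realType) (X : countType) (m : X -> R) (f : X -> R) :
  Prop := (lpnorm m 2 f < +oo)%E.

Definition l2dot (R : realType) (X : countType) (m : X -> R) (f g : X -> R) :
  R := rsum (fun x => f x * g x * m x).

Definition grad (R : realType) (X : countType) (b : X -> X -> R) (m : X -> R)
  (f : X -> R) (x : X) : R :=
  Num.sqrt ((m x)^-1 * rsum (fun y => b x y * (f x - f y) ^+ 2)).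

Definition lap (R : realType) (X : countType) (b : X -> X -> R) (m : X -> R)
  (f : X -> R) (x : X) : R :=
  (m x)^-1 * rsum (fun y => b x y * (f x - f y)).

(** Domain of the closure in [l2] of the form [f, g |-> <lap f, g>] on finitely
    supported functions. *)
Definition form_domain (R : realType) (X : countType) (b : X -> X -> R)
  (m : X -> R) (u : X -> R) : Prop :=
  l2 m u /\
  exists v : nat -> X -> R,
    [/\ forall k, finitely_supported (v k),
        lpnorm m 2 (v k \- u) @[k --> \oo] --> 0%E
      & forall e : R, 0 < e -> exists N : nat, forall k l : nat,
          (N <= k)%N -> (N <= l)%N ->
          l2dot m (lap b m (v k \- v l)) (v k \- v l) < e].

(** Graph of the Friedrichs extension of [lap] on finitely supported functions:
    the restriction of the adjoint to the domain of the closed form. *)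
Definition friedrichs (R : realType) (X : countType) (b : X -> X -> R)
  (m : X -> R) (u h : X -> R) : Prop :=
  [/\ form_domain b m u, l2 m h
    & forall v : X -> R, finitely_supported v ->
        l2dot m (lap b m v) u = l2dot m v h].

(** The real [l] such that (Friedrichs extension - l) is a bijection from its
    domain onto [l2] with bounded inverse; injectivity is part of the bound. *)
Definition resolvent_set (R : realType) (X : countType) (b : X -> X -> R)
  (m : X -> R) : set R :=
  [set l | (exists C : R, forall u h : X -> R, friedrichs b m u h ->
              (lpnorm m 2 u <= C%:E * lpnorm m 2 (fun x => h x - l * u x)%R)%E)
        /\ (forall f : X -> R, l2 m f ->
              exists u h : X -> R, friedrichs b m u h /\
                forall x, h x - l * u x = f x)].

(** The operator being self-adjoint, its spectrum is real. *)
Definition spectrum (R : realType) (X : countType) (b : X -> X -> R)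
  (m : X -> R) : set R := ~` resolvent_set b m.

Definition Lambda (R : realType) (X : countType) (b : X -> X -> R)
  (m : X -> R) : R := inf (spectrum b m).

(** Only positive times matter. *)
Definition fundamental_solution (R : realType) (X : countType)
  (b : X -> X -> R) (m : X -> R) (p : R -> X -> X -> R) : Prop :=
  [/\ forall (t : R) x y, 0 < t -> 0 <= p t x y,
      forall (t : R) x y, 0 < t ->
        is_derive t 1 (fun s => p s x y) (- lap b m (fun z => p t z y) x)
    & forall x y, p t x y @[t --> 0^'+] --> (x == y)%:R / m y].

Definition minimal_fundamental_solution (R : realType) (X : countType)
  (b : X -> X -> R) (m : X -> R) (p : R -> X -> X -> R) : Prop :=
  fundamental_solution b m p /\
  forall q, fundamental_solution b m q ->
    forall (t : R) x y, 0 < t -> p t x y <= q t x y.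

(** The default 0 is never used on a locally finite graph. For positive times
    the minimal fundamental solution is unique. *)
Definition heat_kernel (R : realType) (X : countType) (b : X -> X -> R)
  (m : X -> R) : R -> X -> X -> R :=
  xget (fun _ _ _ => 0) [set p | minimal_fundamental_solution b m p].

Definition sobolev (R : realType) (X : countType) (b : X -> X -> R)
  (m : X -> R) (phi n R1 R2 : R) (B : set X) : Prop :=
  forall x, B x -> forall r, R1 <= r -> r <= R2 ->
  forall u, supported_in (gball b x r) u ->
    ((vol b m x r `^ (2 / n) / (phi * r ^+ 2))%:E
        * lpnorm m (2 * n / (n - 2)) u ^+ 2
     <= lpnorm m 2 (grad b m u) ^+ 2
        + ((r ^+ 2)^-1)%:E * lpnorm m 2 u ^+ 2)%E.

Definition doubling (R : realType) (X : countType) (b : X -> X -> R)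
  (m : X -> R) (Phi n R1 R2 : R) (B : set X) : Prop :=
  forall x, B x -> forall r1 r2, R1 <= r1 -> r1 <= r2 -> r2 <= R2 ->
    vol b m x r2 <= Phi * (r2 / r1) `^ n * vol b m x r1.

(** [S] is the jump size. *)
Definition zeta (R : realType) (S r t : R) : R :=
  (S ^+ 2)^-1 *
  (r * S * arsinh (r * S / t) + t - Num.sqrt (t ^+ 2 + r ^+ 2 * S ^+ 2)).

Definition gaussian (R : realType) (X : countType) (b : X -> X -> R)
  (m : X -> R) (S Psi n R1 R2 : R) (B : set X) : Prop :=
  forall t, R1 ^+ 2 <= t -> forall x y, B x -> B y ->
    let rho : R := (gdist b x y)%:R in
    let tau := Num.min (Num.sqrt t) R2 in
    heat_kernel b m t x y <=
      Psi ^+ 2 *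
      (Num.max 1 ((S ^+ 2)^-1 * (Num.sqrt (t ^+ 2 + rho ^+ 2 * S ^+ 2) - t))
         `^ (n / 2)
       / Num.sqrt (vol b m x tau * vol b m y tau)) *
      expR (- Lambda b m * (t - Num.min t (R2 ^+ 2)) - zeta S rho t).

Record normalized_graph (R : realType) (X : countType) (b : X -> X -> R)
  (m : X -> R) : Prop := NormalizedGraph {
    ngraph_graph : is_graph b ;
    ngraph_connected : graph_connected b ;
    ngraph_ball : forall x r, finite_set (gball b x r) ;
    ngraph_gt0 : forall x, 0 < m x ;
    ngraph_deg : forall x, m x = deg b x }.

Definition volume_ratio (R : realType) (X : countType) (b : X -> X -> R)
  (m : X -> R) (R1 : R) : \bar R :=
  ereal_sup [set (vol b m x R1 / deg b x)%:E | x in [set: X]].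

(* Main.v *)
Require Import Defs.
From mathcomp Require Import all_boot all_order all_algebra.
From mathcomp Require Import all_classical all_reals all_analysis.
From mathcomp Require Import ring lra zify.
Import Order.TTheory GRing.Theory Num.Theory.
Import numFieldNormedType.Exports.
Local Open Scope classical_set_scope.
Local Open Scope ring_scope.
Set Implicit Arguments.
Unset Strict Implicit.
Unset Printing Implicit Defensive.

(* Here [lap = 1 - P] with [P f x = (m x)^-1 sum_y b x y f y], so the minimal heat kernel is
   [e^(-t) sum_k t^k/k! P^k(x,y) / m y]; it is the supremum of the kernels of the semigroups
   killed outside finite sets, where all estimates take place.

   (i) The Sobolev inequality tested on point masses and on cutoffs of the distance gives a
   volume lower bound, hence doubling.  Moser iteration gives an [l2] mean value inequality for
   subsolutions; as the jumps have size one, radii can only be halved down to unit scale, where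
   the volume lower bound ends the iteration.  Davies' perturbation by [e^omega] with
   [omega] a multiple of the distance controls weighted norms of [p_(t/2)] with growth rate
   [cosh lambda - 1 - Lambda], the Rayleigh quotient being bounded below by [Lambda]; the choice
   [lambda = arsinh (rho / t)] produces [zeta], and
   [p_t(x,y) <= ||e^(-omega) p_(t/2)(x,.)|| ||e^omega p_(t/2)(y,.)||].

   (ii) Since [zeta >= sqrt (t^2 + rho^2) - t], the polynomial correction is absorbed and the
   kernel is at most [C r^n t^(-n/2) / V(r)] on the ball for [t <= r^2].  Together with
   [||f||^2 - <P_t f, f> <= t Q(f)] this is a Nash inequality, and truncation at dyadic levels
   turns it into the Sobolev inequality. *)

(** * Derivatives and exponential series *)

(** Every estimate is proved on a finite list [D] with constants free of [D]. Killing leaves only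
    row sums at most [m], so the inequalities are arranged to give the lost mass a favourable sign.
    Discreteness is the main obstacle. A cutoff needs a transition layer wider than one jump, so
    from radius [r] only about [log_2 r] halvings are possible. They raise the exponent to
    [(1 + 2/n)^K] with [K] near [log_2 (r/8)]; what remains is a polynomial loss in [r], harmless
    because [(1 + 2/n)^K] outgrows [K]. The radius in the Gaussian bound is dictated by the weight:
    [lambda r] must stay bounded for [e^omega] to be comparable to a constant on the ball. This
    forces [r] well below [sqrt t] when [rho] is large, and the resulting ratio of volumes produces
    the polynomial correction in the Gaussian bound. Integrals over time appear only as increments
    of primitives, and each integrated inequality is the monotonicity of a function whose derivative
    has a sign. *)

Section Calculus.
Variable R : realType.
Implicit Types (f g : R -> R) (t : R).

Lemma is_derive_ext f g t (d : R) : f =1 g -> is_derive t 1 f d -> is_derive t 1 g d.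
Proof. by move=> /funext ->. Qed.

Lemma is_deriveMr f g t (df dg : R) : is_derive t 1 f df -> is_derive t 1 g dg ->
  is_derive t 1 (fun s => f s * g s) (f t * dg + df * g t).
Proof.
by move=> Hf Hg; apply: is_derive_eq; rewrite /GRing.scale /= [g t * _]mulrC.
Qed.

Lemma is_deriveMl f (c : R) t (df : R) : is_derive t 1 f df ->
  is_derive t 1 (fun s => c * f s) (c * df).
Proof. by move=> Hf; apply: is_deriveZ. Qed.

Lemma is_derive_expRl (c : R) t :
  is_derive t 1 (fun s => expR (c * s)) (c * expR (c * t)).
Proof.
have H : is_derive t 1 (fun s : R => c * s) (c * 1) by apply: is_deriveMl.
have H2 := is_derive_expR (c * t).
by have := @is_derive1_comp R expR (fun s => c * s) t _ _ H2 H; rewrite mulr1 mulrC.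
Qed.

Lemma is_derive_sumr (I : Type) (s : seq I) (h : I -> R -> R) (dh : I -> R) t :
  (forall i, is_derive t 1 (h i) (dh i)) ->
  is_derive t 1 (fun u => \sum_(i <- s) h i u) (\sum_(i <- s) dh i).
Proof.
move=> H; elim: s => [|i s IH].
  by rewrite big_nil; apply: is_derive_ext (is_derive_cst (0 : R) t 1) => u; rewrite big_nil.
rewrite big_cons; apply: is_derive_ext (is_deriveD (H i) IH) => u.
by rewrite big_cons.
Qed.

Lemma nonincr_of_derive f (df : R -> R) (a b : R) : a <= b ->
  (forall t, a <= t <= b -> is_derive t 1 f (df t)) ->
  (forall t, a <= t <= b -> df t <= 0) -> f b <= f a.
Proof.
move=> ab Hd H0.
have [| |c] := @MVT_segment R f df a b ab.
- by move=> x; rewrite in_itv /= => /andP[h1 h2]; apply: Hd; rewrite !ltW.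
- apply: derivable_within_continuous => x; rewrite in_itv /= => hx.
  by have := Hd _ hx => -[].
rewrite in_itv /= => hc E.
by rewrite -subr_le0 E mulr_le0_ge0 ?H0// subr_ge0.
Qed.

Lemma nondecr_of_derive f (df : R -> R) (a b : R) : a <= b ->
  (forall t, a <= t <= b -> is_derive t 1 f (df t)) ->
  (forall t, a <= t <= b -> 0 <= df t) -> f a <= f b.
Proof.
move=> ab Hd H0; rewrite -lerN2.
apply: (@nonincr_of_derive (fun x => - f x) (fun x => - df x)) => // t ht.
  by have := Hd _ ht => ?; apply: is_deriveN.
by rewrite oppr_le0 H0.
Qed.

(* Composing with [t |-> max t (a / 2)] makes [S] continuous on the whole line. *)
Lemma primitive_pos (S : R -> R) : (forall t, 0 < t -> {for t, continuous S}) ->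
  forall a, 0 < a -> exists J : R -> R, forall t, a <= t -> is_derive t 1 J (S t).
Proof.
move=> cS a a0; pose S' := fun t => S (Num.max t (a / 2)).
have cS' : continuous S'.
  move=> t; apply: (@continuous_comp _ _ _ (fun t : R => Num.max t (a / 2)) S).
    by apply: continuous_max; [exact: cvg_id|exact: cvg_cst].
  by apply: cS; rewrite lt_max divr_gt0 ?orbT.
pose J := fun x => (\int[lebesgue_measure]_(t in [set` `[a / 2, x]]) (S' t))%R.
exists J => t ta.
have [||||d e] := @continuous_FTC1_closed R S' (a / 2) t (t + 1).
- by rewrite ltrDl.
- apply: continuous_compact_integrable; first exact: segment_compact.
  exact: continuous_subspaceT.
- by apply: lt_le_trans ta; rewrite ltr_pdivrMr// ltr_pMr// ltr1n.
- exact: cS'.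
apply: DeriveDef; first exact: d.
rewrite -derive1E e /S' max_l//.
by apply: le_trans ta; rewrite ler_pdivrMr// ler_pMr// ler1n.
Qed.

(** With the factorials split off, differentiation in [t] is the shift of [a]. For [a k = P^k h(x)]
    the shift is one more application of [P], which is how the heat equation arises. *)
Definition expseries (a : nat -> R) (t : R) : R :=
  limn (pseries (fun k => a k / k`!%:R) t).

Definition bounded_by (M : R) (a : nat -> R) := forall k, `|a k| <= M.

Lemma pseries_diffs_fact (a : nat -> R) :
  pseries_diffs (fun k => a k / k`!%:R) = (fun k => a k.+1 / k`!%:R).
Proof.
apply/funext => k; rewrite /pseries_diffs factS natrM invfM mulrCA.
by rewrite [X in _ * X]mulrA mulfV ?mul1r ?pnatr_eq0.
Qed.

Lemma cvg_expseries M (a : nat -> R) t : bounded_by M a ->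
  cvgn (pseries (fun k => a k / k`!%:R) t).
Proof.
move=> Ha; apply: normed_cvg.
have M0 : 0 <= M by apply: le_trans (normr_ge0 _) (Ha 0%N).
apply: (series_le_cvg (v_ := fun k => M * exp_coeff `|t| k)) => [k|k|k|].
- exact: normr_ge0.
- by rewrite mulr_ge0// exp_coeff_ge0.
- rewrite /= normrM normrM normfV normrX normr_nat /exp_coeff/= mulrAC -mulrA.
  by apply: ler_wpM2r => //; rewrite divr_ge0 ?exprn_ge0.
- by apply: is_cvg_seriesZ; exact: is_cvg_series_exp_coeff.
Qed.

Lemma is_derive_expseries M (a : nat -> R) t : bounded_by M a ->
  is_derive t 1 (expseries a) (expseries (fun k => a k.+1) t).
Proof.
move=> Ha; rewrite /expseries -pseries_diffs_fact.
apply: (@pseries_snd_diffs _ _ (`|t| + 1)).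
- exact: cvg_expseries Ha.
- by rewrite pseries_diffs_fact; apply: (@cvg_expseries M) => k; apply: Ha.
- rewrite pseries_diffs_fact (pseries_diffs_fact (fun k => a k.+1)).
  by apply: (@cvg_expseries M) => k; apply: Ha.
by rewrite [ltRHS]ger0_norm ?ltrDl// addr_ge0.
Qed.

Lemma expseries0 (a : nat -> R) : expseries a 0 = a 0%N.
Proof.
apply/cvg_lim => //; rewrite -cvg_shiftS /=.
have -> : (fun n => pseries (fun k => a k / k`!%:R) 0 n.+1) = (fun=> a 0%N).
  apply/funext => n; rewrite /pseries /series /= big_nat_recl//= expr0 mulr1 divr1.
  by rewrite big1 ?addr0// => i _; rewrite expr0n mulr0.
exact: cvg_cst.
Qed.

Lemma partial_le_expseries M (a : nat -> R) t N : bounded_by M a -> (forall k, 0 <= a k) ->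
  0 <= t -> \sum_(0 <= k < N) a k / k`!%:R * t ^+ k <= expseries a t.
Proof.
move=> Ha a0 t0; rewrite -/(pseries (fun k => a k / k`!%:R) t N).
apply: nondecreasing_cvgn_le; last exact: cvg_expseries Ha.
apply: nondecreasing_series => k _ _; by rewrite mulr_ge0 ?exprn_ge0// divr_ge0.
Qed.

Lemma expseries_le_partial M (a : nat -> R) t (C : R) : bounded_by M a ->
  (forall N, \sum_(0 <= k < N) a k / k`!%:R * t ^+ k <= C) -> expseries a t <= C.
Proof.
move=> Ha H; apply: limr_le; first exact: cvg_expseries Ha.
by near=> N; apply: H.
Unshelve. all: by end_near. Qed.

Lemma expseries_sum (I : Type) (s : seq I) (c : I -> R) (a : I -> nat -> R) t :
  (forall i, exists M, bounded_by M (a i)) ->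
  expseries (fun k => \sum_(i <- s) c i * a i k) t
  = \sum_(i <- s) c i * expseries (a i) t.
Proof.
move=> Ha.
elim: s => [|i s IH].
  rewrite big_nil /expseries; apply/cvg_lim => //.
  rewrite (_ : pseries _ _ = cst 0); first exact: cvg_cst.
  by apply/funext => n; rewrite /pseries /series /= big1// => k _; rewrite big_nil !mul0r.
rewrite big_cons -IH; apply/cvg_lim => //.
have [M HM] := Ha i.
have [M' HM'] : exists M', bounded_by M' (fun k => \sum_(i <- s) c i * a i k).
  elim: s {IH} => [|j s [M2 H2]]; first by exists 0 => k; rewrite big_nil normr0.
  have [M1 H1] := Ha j; exists (`|c j| * M1 + M2) => k; rewrite big_cons.
  by rewrite (le_trans (ler_normD _ _))// lerD// normrM ler_wpM2l.
have -> : pseries (fun k => (\sum_(j <- i :: s) c j * a j k) / k`!%:R) t =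
   (fun n => c i * pseries (fun k => a i k / k`!%:R) t n
       + pseries (fun k => (\sum_(j <- s) c j * a j k) / k`!%:R) t n).
  apply/funext => n; rewrite /pseries /series /= mulr_sumr -big_split /=.
  by apply: eq_bigr => k _; rewrite big_cons mulrDl mulrDl !mulrA.
apply: cvgD; last exact: (cvg_expseries HM').
by apply: cvgMr; exact: cvg_expseries HM.
Qed.

(** * Convexity inequalities *)

(** The graph of [exp] lies above its tangent at [c], the weighted mean of the logarithms; averaging
    this at [ln a] and [ln b] cancels the linear terms. *)
Lemma wAMGM (th a b : R) : 0 <= th <= 1 -> 0 < a -> 0 < b ->
  a `^ th * b `^ (1 - th) <= th * a + (1 - th) * b.
Proof.
move=> /andP[t0 t1] a0 b0.
rewrite /powR !gt_eqF// -expRD; set c := th * ln a + (1 - th) * ln b.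
have e x : expR c * (1 + (x - c)) <= expR x.
  rewrite (_ : expR x = expR c * expR (x - c)); last by rewrite -expRD addrC subrK.
  by rewrite ler_pM2l ?expR_gt0// expR_ge1Dx.
have := e (ln a); have := e (ln b); rewrite !lnK ?posrE// => eb ea.
have t1' : 0 <= 1 - th by rewrite subr_ge0.
have := lerD (ler_wpM2l t0 ea) (ler_wpM2l t1' eb); apply: le_trans.
rewrite le_eqVlt; apply/orP; left; apply/eqP.
by rewrite {-1}/c; ring.
Qed.

(** Weighted AM-GM with weight [1/p] for [y^p] and [x^p]. It is the convexity of [s^p]: the graph at
    [y] lies above the tangent at [x]. *)
Lemma young_power (p x y : R) : 1 <= p -> 0 < x -> 0 < y ->
  p * x `^ (p - 1) * y <= y `^ p + (p - 1) * x `^ p.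
Proof.
move=> p1 x0 y0; have p0 : 0 < p by apply: lt_le_trans p1.
have h : 0 <= p^-1 <= 1 by rewrite invr_ge0 ltW//= invf_le1.
have := wAMGM h (powR_gt0 p y0) (powR_gt0 p x0).
rewrite -!powRrM mulfV ?gt_eqF// powRr1 ?(ltW y0)//.
rewrite mulrBr mulr1 mulfV ?gt_eqF//.
move=> /(ler_wpM2l (ltW p0)); rewrite mulrDr !mulrA mulfV ?gt_eqF// mul1r mulrBr mulr1.
by rewrite mulfV ?gt_eqF// [_ * y * _]mulrAC.
Qed.

(** Dividing by the two sums normalizes them to one, and weighted AM-GM applies term by term.
    Vanishing terms are set apart because it needs positive arguments. *)
Lemma hoelder_sum (I : Type) (s : seq I) (m a b : I -> R) (th : R) :
  0 < th < 1 -> (forall i, 0 <= m i) -> (forall i, 0 <= a i) -> (forall i, 0 <= b i) ->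
  0 < \sum_(i <- s) m i * a i -> 0 < \sum_(i <- s) m i * b i ->
  \sum_(i <- s) m i * (a i `^ th * b i `^ (1 - th)) <=
  (\sum_(i <- s) m i * a i) `^ th * (\sum_(i <- s) m i * b i) `^ (1 - th).
Proof.
move=> /andP[t0 t1] m0 a0 b0.
set A := \sum_(i <- s) m i * a i; set B := \sum_(i <- s) m i * b i.
have t1' : 0 < 1 - th by rewrite subr_gt0.
move=> A0 B0.
have H i : m i * (a i `^ th * b i `^ (1 - th)) <=
   A `^ th * B `^ (1 - th) * (th * (m i * a i / A) + (1 - th) * (m i * b i / B)).
  have pp : 0 <= A `^ th * B `^ (1 - th) * (th * (m i * a i / A) + (1 - th) * (m i * b i / B)).
    apply: mulr_ge0; first by rewrite mulr_ge0 ?powR_ge0.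
    by rewrite addr_ge0// mulr_ge0 ?(ltW t0) ?(ltW t1')// divr_ge0 ?mulr_ge0// ltW.
  have [ai|ai] := eqVneq (a i) 0.
    by apply: le_trans pp; rewrite ai powR0 ?gt_eqF// mul0r mulr0.
  have [bi|bi] := eqVneq (b i) 0.
    by apply: le_trans pp; rewrite bi (powR0 (x := 1 - th)) ?gt_eqF// mulr0 mulr0.
  have ai0 : 0 < a i by rewrite lt_neqAle eq_sym ai a0.
  have bi0 : 0 < b i by rewrite lt_neqAle eq_sym bi b0.
  have h : 0 <= th <= 1 by rewrite !ltW.
  have := wAMGM h (divr_gt0 ai0 A0) (divr_gt0 bi0 B0).
  rewrite !powRM ?invr_ge0 ?(ltW ai0) ?(ltW bi0) ?(ltW A0) ?(ltW B0)//.
  have e1 : A `^ th * A^-1 `^ th = 1.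
    by rewrite -powRM ?invr_ge0 ?(ltW A0)// mulfV ?gt_eqF// powR1.
  have e2 : B `^ (1 - th) * B^-1 `^ (1 - th) = 1.
    by rewrite -powRM ?invr_ge0 ?(ltW B0)// mulfV ?gt_eqF// powR1.
  move=> /(ler_wpM2l (mulr_ge0 (m0 i) (mulr_ge0 (powR_ge0 A th) (powR_ge0 B (1 - th))))).
  move=> le; apply: le_trans (le_trans le _); rewrite le_eqVlt; apply/orP; left; apply/eqP.
    transitivity (m i * (a i `^ th * b i `^ (1 - th)) * (A `^ th * A^-1 `^ th) *
     (B `^ (1 - th) * B^-1 `^ (1 - th))); last by ring.
    by rewrite e1 e2 !mulr1.
  by ring.
apply: le_trans (ler_sum _ (fun i _ => H i)) _.
rewrite -mulr_sumr big_split /= -!mulr_sumr -!mulr_suml -/A -/B.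
by rewrite !mulfV ?gt_eqF// !mulr1 addrC subrK mulr1.
Qed.

End Calculus.

(** * Heat semigroups *)

Section HeatSeries.
Variables (R : realType) (X : eqType) (b : X -> X -> R) (m : X -> R) (nb : X -> seq X).
Hypothesis b_ge0 : forall x y, 0 <= b x y.
Hypothesis m_gt0 : forall x, 0 < m x.
Hypothesis b_le : forall x, \sum_(y <- nb x) b x y <= m x.
Implicit Types (M t s C : R) (f g h : X -> R).

Definition Pop (f : X -> R) (x : X) : R := (m x)^-1 * \sum_(y <- nb x) b x y * f y.

(* [e^(-t(1-P)) h]; with [nb] constantly equal to a finite set [D] this is the semigroup killed
   outside [D]. *)
Definition heat (h : X -> R) (t : R) (x : X) : R :=
  expR (- t) * expseries (fun k => iter k Pop h x) t.

Lemma Pop_ge0 f : (forall x, 0 <= f x) -> forall x, 0 <= Pop f x.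
Proof.
by move=> f0 x; rewrite mulr_ge0 ?invr_ge0 ?(ltW (m_gt0 x))// sumr_ge0// => y _; rewrite mulr_ge0.
Qed.

Lemma iter_Pop_ge0 k f : (forall x, 0 <= f x) -> forall x, 0 <= iter k Pop f x.
Proof. by move=> f0; elim: k => //= k IH; apply: Pop_ge0. Qed.

Lemma iter_Pop_bounded M h : (forall x, `|h x| <= M) ->
  forall x, bounded_by M (fun k => iter k Pop h x).
Proof.
move=> hM x k; have M0 : 0 <= M by apply: le_trans (hM x).
elim: k x => [|k IH] x //=.
rewrite /Pop normrM ger0_norm ?invr_ge0 ?(ltW (m_gt0 x))//.
rewrite ler_pdivrMl//.
apply: le_trans (ler_norm_sum _ _ _) _.
apply: le_trans (_ : \sum_(y <- nb x) b x y * M <= _).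
  by apply: ler_sum => y _; rewrite normrM ger0_norm// ler_wpM2l.
by rewrite -mulr_suml ler_wpM2r.
Qed.

Lemma is_derive_heat M h : (forall x, `|h x| <= M) -> forall (t : R) x,
  is_derive t 1 (fun s => heat h s x) (Pop (heat h t) x - heat h t x).
Proof.
move=> hM t x.
have H1 := is_derive_expRl (-1) t.
have H2 := is_derive_expseries t (iter_Pop_bounded hM x).
have := is_deriveMr H1 H2.
set d := (X in is_derive _ _ _ X -> _) => H.
have -> : Pop (heat h t) x - heat h t x = d.
  rewrite /d mulN1r /heat mulN1r mulNr; congr (_ - _).
  rewrite /Pop /= (_ : (fun k => _) = fun k => \sum_(y <- nb x) ((m x)^-1 * b x y) * iter k Pop h y); last first.
    by apply/funext => k; rewrite /Pop mulr_sumr; apply: eq_bigr => y _; rewrite mulrA.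
  rewrite expseries_sum; last by move=> y; exists M; apply: iter_Pop_bounded.
  by rewrite !mulr_sumr; apply: eq_bigr => y _; ring.
by apply: is_derive_ext H => s; rewrite mulN1r.
Qed.

Lemma heat0 h x : heat h 0 x = h x.
Proof. by rewrite /heat oppr0 expR0 mul1r expseries0. Qed.

Lemma heat_ge M h t x : (forall x, `|h x| <= M) -> (forall x, 0 <= h x) -> 0 <= t ->
  expR (- t) * h x <= heat h t x.
Proof.
move=> hM h0 t0; rewrite ler_pM2l ?expR_gt0//.
have := @partial_le_expseries R M (fun k => iter k Pop h x) t 1 (iter_Pop_bounded hM x).
rewrite big_nat1 /= divr1 expr0 mulr1; apply => // k; exact: iter_Pop_ge0.
Qed.

Lemma heat_ge0 M h t x : (forall x, `|h x| <= M) -> (forall x, 0 <= h x) -> 0 <= t ->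
  0 <= heat h t x.
Proof.
by move=> hM h0 t0; apply: le_trans (heat_ge _ hM _ _); rewrite ?mulr_ge0 ?expR_ge0.
Qed.

Lemma heat_ge_partial M h t x N : (forall x, `|h x| <= M) -> (forall x, 0 <= h x) -> 0 <= t ->
  expR (- t) * \sum_(0 <= k < N) iter k Pop h x / k`!%:R * t ^+ k <= heat h t x.
Proof.
move=> hM h0 t0; rewrite ler_pM2l ?expR_gt0//.
apply: (partial_le_expseries _ (iter_Pop_bounded hM x)) => // k; exact: iter_Pop_ge0.
Qed.

Lemma heat_le_partial M h t x C : (forall x, `|h x| <= M) ->
  (forall N, expR (- t) * \sum_(0 <= k < N) iter k Pop h x / k`!%:R * t ^+ k <= C) ->
  heat h t x <= C.
Proof.
move=> hM H; rewrite /heat -ler_pdivlMl ?expR_gt0//.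
by apply: (expseries_le_partial (iter_Pop_bounded hM x)) => N; rewrite ler_pdivlMl ?expR_gt0.
Qed.

(* [s |-> e^s u(s)] is nondecreasing. *)
Lemma heat_growth M h s t x : (forall x, `|h x| <= M) -> (forall x, 0 <= h x) ->
  0 <= s -> s <= t -> expR (s - t) * heat h s x <= heat h t x.
Proof.
move=> hM h0 s0 st.
have := @nondecr_of_derive R (fun r => expR (1 * r) * heat h r x)
  (fun r => expR (1 * r) * (Pop (heat h r) x - heat h r x) + 1 * expR (1 * r) * heat h r x) s t st.
rewrite !mul1r => H.
rewrite -(@ler_pM2l _ (expR t)) ?expR_gt0// mulrA -expRD addrC subrK.
apply: H => r /andP[sr _].
  by apply: is_deriveMr; [exact: is_derive_expRl|exact: is_derive_heat hM _ _].
rewrite !mul1r -mulrDr subrK mulr_ge0 ?expR_ge0//.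
by apply: Pop_ge0 => y; apply: heat_ge0 hM _ _ => //; apply: le_trans sr.
Qed.

End HeatSeries.

(** * Quadratic forms and Davies' weighted estimate on a finite list *)

Section FiniteHeat.
Variables (R : realType) (X : eqType) (b : X -> X -> R) (m : X -> R) (D : seq X).
Hypothesis b_ge0 : forall x y, 0 <= b x y.
Hypothesis b_sym : forall x y, b x y = b y x.
Hypothesis m_gt0 : forall x, 0 < m x.
Hypothesis b_le : forall x, \sum_(y <- D) b x y <= m x.
Implicit Types (M t s : R) (f g h w : X -> R).

Let P := Pop b m (fun _ => D).
Let U := heat b m (fun _ => D).

Definition ip (f g : X -> R) : R := \sum_(x <- D) m x * (f x * g x).
Definition bf (f g : X -> R) : R := \sum_(x <- D) \sum_(y <- D) b x y * (f x * g y).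
(** The form of [1 - P] on [D]. The mass [m x - sum_(y in D) b x y] lost outside [D] still counts in
    it, so on a graph, for functions supported in [D], [2 * Qf] is the full squared norm of the
    gradient. *)
Definition Qf (f : X -> R) : R := ip f f - bf f f.

Lemma ipC f g : ip f g = ip g f.
Proof. by apply: eq_bigr => x _; rewrite [f x * _]mulrC. Qed.

Lemma ip_ge0 f : 0 <= ip f f.
Proof. by apply: sumr_ge0 => x _; rewrite mulr_ge0 ?(ltW (m_gt0 x))// -expr2 sqr_ge0. Qed.

Lemma ip_P f g : ip f (P g) = bf f g.
Proof.
apply: eq_bigr => x _; rewrite /P /Pop !mulr_sumr; apply: eq_bigr => y _.
by field; rewrite gt_eqF.
Qed.

Lemma bfC f g : bf f g = bf g f.
Proof.
rewrite /bf exchange_big /=; apply: eq_bigr => x _; apply: eq_bigr => y _.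
by rewrite b_sym [f y * _]mulrC.
Qed.

Lemma bf_le_ip f : bf f f <= ip f f.
Proof.
rewrite -(@ler_pM2l _ 2)//.
have -> : 2 * ip f f = \sum_(x <- D) m x * f x ^+ 2 + \sum_(x <- D) m x * f x ^+ 2.
  by rewrite -mulr2n mulr_natl; congr (_ *+ 2); apply: eq_bigr => x _; rewrite expr2.
apply: le_trans (_ : \sum_(x <- D) \sum_(y <- D) b x y * f x ^+ 2 +
   \sum_(x <- D) \sum_(y <- D) b y x * f x ^+ 2 <= _).
  rewrite [X in _ <= _ + X]exchange_big /= /bf mulr_sumr -big_split /=; apply: ler_sum => x _.
  rewrite mulr_sumr -big_split /=; apply: ler_sum => y _.
  rewrite -mulrDr mulrCA ler_wpM2l// -subr_ge0.
  have -> : f x ^+ 2 + f y ^+ 2 - 2 * (f x * f y) = (f x - f y) ^+ 2 by ring.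
  exact: sqr_ge0.
have H x : \sum_(y <- D) b x y * f x ^+ 2 <= m x * f x ^+ 2.
  by rewrite -mulr_suml ler_wpM2r ?sqr_ge0.
apply: lerD; apply: ler_sum => x _; first exact: H.
by under eq_bigr do rewrite b_sym; exact: H.
Qed.

Lemma Qf_ge0 f : 0 <= Qf f.
Proof. by rewrite subr_ge0 bf_le_ip. Qed.

Lemma is_derive_ip (u v : R -> X -> R) (du dv : X -> R) (t : R) :
  (forall x, is_derive t 1 (fun s => u s x) (du x)) ->
  (forall x, is_derive t 1 (fun s => v s x) (dv x)) ->
  is_derive t 1 (fun s => ip (u s) (v s)) (ip (u t) dv + ip du (v t)).
Proof.
move=> Hu Hv; rewrite /ip -big_split /=; apply: is_derive_sumr => x.
by rewrite -mulrDr; apply: is_deriveMl; apply: is_deriveMr.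
Qed.

Lemma ipBl f g h : ip (fun x => f x - g x) h = ip f h - ip g h.
Proof.
rewrite /ip -sumrB; apply: eq_bigr => x _; ring.
Qed.

(** Semigroup law and self-adjointness at once: moving time from one factor to the other leaves the
    pairing constant, since [bf] is symmetric. *)
Lemma ip_heat M h M' g s t : (forall x, `|h x| <= M) -> (forall x, `|g x| <= M') ->
  0 <= t -> ip (U h s) (U g t) = ip (U h (s + t)) g.
Proof.
move=> hM gM t0.
pose F r := ip (U h (s + r)) (U g (t - r)).
have dF (r : R) : is_derive r 1 F 0.
  have := @is_derive_ip (fun r => U h (s + r)) (fun r => U g (t - r))
    (fun x => P (U h (s + r)) x - U h (s + r) x)
    (fun x => - (P (U g (t - r)) x - U g (t - r) x)) r.
  set d := (X in is_derive _ _ _ X).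
  have -> : d = 0.
    rewrite /d (_ : (fun x => - _) = fun x => U g (t - r) x - P (U g (t - r)) x); last first.
      by apply/funext => x; rewrite opprB.
    rewrite ipC !ipBl [ip (P _) _]ipC ip_P [ip (P _) _]ipC ip_P bfC [ip (U g _) _]ipC.
    by rewrite addrC subrKA subrr.
  apply => x.
    have H1 : is_derive r 1 (fun r : R => s + r) (0 + 1).
      by apply: is_deriveD.
    rewrite add0r in H1.
    have H2 := is_derive_heat b_ge0 m_gt0 b_le hM (s + r) x.
    by have := @is_derive1_comp R (fun r => U h r x) (fun r => s + r) r _ _ H2 H1; rewrite mulr1.
  have H1 : is_derive r 1 (fun r : R => t - r) (0 - 1).
    by apply: is_deriveB.
  rewrite sub0r in H1.
  have H2 := is_derive_heat b_ge0 m_gt0 b_le gM (t - r) x.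
  by have := @is_derive1_comp R (fun r => U g r x) (fun r => t - r) r _ _ H2 H1; rewrite mulrN1.
have e : F 0 = F t.
  apply/le_anti/andP; split.
    by apply: (nondecr_of_derive (df := fun=> 0)).
  by apply: (nonincr_of_derive (df := fun=> 0)).
move: e; rewrite /F addr0 subr0 subrr => ->; congr ip.
by apply/funext => x; rewrite /U heat0.
Qed.

Lemma cosh_mono (a c : R) : `|a| <= c -> expR a + expR (- a) <= expR c + expR (- c).
Proof.
move=> ac.
wlog a0 : a ac / 0 <= a.
  move=> H; have [|/ltW a0] := leP 0 a; first exact: H.
  by rewrite addrC -{2}(opprK a); apply: H; rewrite ?normrN// oppr_ge0.
rewrite ger0_norm// in ac.
have H1 : 1 <= expR a by rewrite -expR0 ler_expR.
have H2 : expR a <= expR c by rewrite ler_expR.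
rewrite !expRN; set A := expR a in H1 H2 *; set C := expR c in H2 *.
have A0 : 0 < A by apply: expR_gt0.
have C0 : 0 < C by apply: expR_gt0.
rewrite -subr_ge0.
have -> : C + C^-1 - (A + A^-1) = (C - A) * (1 - (A * C)^-1).
  by field; rewrite !gt_eqF.
rewrite mulr_ge0 ?subr_ge0// invf_le1 ?mulr_gt0//.
by apply: mulr_ege1 => //; apply: le_trans H2.
Qed.

Definition cosh1 (l : R) : R := (expR l + expR (- l)) / 2.

(** For [w = e^(-om) u] the derivative of the weighted norm, symmetrized in [x] and [y], carries
    [2 cosh (om y - om x)] on each edge. Hence it is at most [2 cosh(lam) bf w w - 2 ip w w], which
    equals [2 (cosh lam - 1) ip w w - 2 cosh(lam) Qf w]. As [cosh lam >= 1] and [Qf w >= 0], the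
    last term is at most [- 2 l0 ip w w], and Gronwall's argument concludes. *)
Lemma davies (om : X -> R) (lam l0 M : R) h t :
  0 <= lam -> (forall x y, 0 < b x y -> `|om x - om y| <= lam) ->
  (forall w, l0 * ip w w <= Qf w) ->
  (forall x, `|h x| <= M) -> (forall x, 0 <= h x) -> 0 <= t ->
  \sum_(x <- D) m x * (expR (- 2 * om x) * U h t x ^+ 2) <=
  expR (2 * (cosh1 lam - 1 - l0) * t) * \sum_(x <- D) m x * (expR (- 2 * om x) * h x ^+ 2).
Proof.
move=> lam0 hom hQ hM h0 t0.
set c := 2 * (cosh1 lam - 1 - l0).
pose W s := \sum_(x <- D) m x * (expR (- 2 * om x) * (U h s x * U h s x)).
pose dW s := \sum_(x <- D) m x * (expR (- 2 * om x) *
  (U h s x * (P (U h s) x - U h s x) + (P (U h s) x - U h s x) * U h s x)).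
have dWE (s : R) : is_derive s 1 W (dW s).
  apply: is_derive_sumr => x; do 2 apply: is_deriveMl.
  by apply: is_deriveMr; apply: (is_derive_heat b_ge0 m_gt0 b_le hM).
have main (s : R) : 0 <= s -> dW s <= c * W s.
  move=> s0; pose w x := expR (- om x) * U h s x.
  have w0 x : 0 <= w x by rewrite mulr_ge0 ?expR_ge0// (heat_ge0 b_ge0 m_gt0 b_le _ hM).
  have ee (a1 a2 u v : R) : expR (- 2 * a1) * (u * v) =
      expR (a2 - a1) * (expR (- a1) * u * (expR (- a2) * v)).
    have -> : - 2 * a1 = a2 - a1 + (- a1) + (- a2) by ring.
    by rewrite !expRD; ring.
  have eW : W s = ip w w.
    by apply: eq_bigr => x _; rewrite (ee _ (om x)) subrr expR0 mul1r.
  have ew x y : expR (- 2 * om x) * (U h s x * U h s y) = expR (om y - om x) * (w x * w y).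
    exact: ee.
  have edW : dW s = 2 * \sum_(x <- D) \sum_(y <- D) b x y * (expR (om y - om x) * (w x * w y)) - 2 * W s.
    rewrite /dW /W !mulr_sumr -sumrB; apply: eq_bigr => x _.
    have -> : \sum_(y <- D) b x y * (expR (om y - om x) * (w x * w y)) =
        m x * (expR (- 2 * om x) * (U h s x * P (U h s) x)).
      rewrite /P /Pop !mulr_sumr; apply: eq_bigr => y _.
      by rewrite -ew; field; rewrite gt_eqF.
    ring.
  have sym : 2 * \sum_(x <- D) \sum_(y <- D) b x y * (expR (om y - om x) * (w x * w y)) =
     \sum_(x <- D) \sum_(y <- D) b x y * ((expR (om y - om x) + expR (- (om y - om x))) * (w x * w y)).
    rewrite mulr_natl mulr2n {2}exchange_big /= -big_split /=.
    apply: eq_bigr => x _; rewrite -big_split /=; apply: eq_bigr => y _.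
    rewrite (b_sym y x) opprB; ring.
  have le1 : 2 * \sum_(x <- D) \sum_(y <- D) b x y * (expR (om y - om x) * (w x * w y)) <=
     2 * cosh1 lam * bf w w.
    rewrite sym /bf mulr_sumr; apply: ler_sum => x _; rewrite mulr_sumr; apply: ler_sum => y _.
    have [b0|b0] := eqVneq (b x y) 0; first by rewrite b0 !mul0r mulr0.
    have -> : 2 * cosh1 lam = expR lam + expR (- lam) by rewrite /cosh1 mulrC divfK.
    rewrite [leRHS]mulrCA ler_wpM2l//.
    apply: ler_wpM2r; first by rewrite mulr_ge0 ?w0.
    apply: cosh_mono.
    by rewrite distrC; apply: hom; rewrite lt_neqAle eq_sym b0/=.
  rewrite edW eW.
  have lam1 : 1 <= cosh1 lam.
    have := @cosh_mono 0 lam; rewrite normr0 oppr0 expR0 /cosh1 ler_pdivlMr// mul1r.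
    by rewrite -natr1; apply.
  have bf_le := bf_le_ip w.
  have := hQ w; rewrite /Qf => hw.
  rewrite /c; nra.
pose Z s := expR (- c * s) * W s.
have := @nonincr_of_derive R Z (fun s => expR (- c * s) * dW s + (- c) * expR (- c * s) * W s) 0 t t0.
rewrite /Z mulr0 expR0 mul1r => H.
have {}H : expR (- c * t) * W t <= W 0.
  apply: H => s /andP[s0 _].
    by apply: is_deriveMr => //; exact: is_derive_expRl.
  have := main _ s0; have := expR_gt0 (- c * s); nra.
have eW s : \sum_(x <- D) m x * (expR (- 2 * om x) * U h s x ^+ 2) = W s.
  by apply: eq_bigr => x _; rewrite expr2.
rewrite eW (_ : \sum_(x <- D) _ = W 0); last first.
  by rewrite -eW; apply: eq_bigr => x _; rewrite /U heat0.
by move: H; rewrite mulNr expRN mulrC ler_pdivrMr ?expR_gt0// [leRHS]mulrC.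
Qed.

End FiniteHeat.

(** * Moser iteration *)

Section Subsolutions.
Variables (R : realType) (X : eqType) (b : X -> X -> R) (m : X -> R) (D : seq X).
Hypothesis b_ge0 : forall x y, 0 <= b x y.
Hypothesis b_sym : forall x y, b x y = b y x.
Hypothesis m_gt0 : forall x, 0 < m x.
Hypothesis b_le : forall x, \sum_(y <- D) b x y <= m x.
Let P := Pop b m (fun _ => D).

(** Strict positivity makes all real powers of [v] differentiable in time; the derivative is carried
    as the explicit function [dv]. *)
Definition subsol (v dv : R -> X -> R) : Prop :=
  forall (t : R) x, 0 < t ->
    [/\ 0 < v t x, is_derive t 1 (v^~ x) (dv t x) & dv t x <= P (v t) x - v t x].

Lemma subsol_heat M h : (forall x, `|h x| <= M) -> (forall x, 0 < h x) ->
  subsol (heat b m (fun _ => D) h) (fun t x => P (heat b m (fun _ => D) h t) x - heat b m (fun _ => D) h t x).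
Proof.
move=> hM h0 t x t0; split => //; last exact: is_derive_heat hM _ _.
apply: lt_le_trans (heat_ge b_ge0 m_gt0 b_le x hM _ (ltW t0)); last by move=> y; apply: ltW.
by rewrite mulr_gt0 ?expR_gt0.
Qed.

(** Convexity of [s^p], used at every neighbour through [young_power]. Since row sums are at most
    [m x], the terms [(p - 1) v^p] collected there are no larger than needed. *)
Lemma subsol_pow (p : R) v dv : 1 <= p -> subsol v dv ->
  subsol (fun t x => v t x `^ p) (fun t x => p * v t x `^ (p - 1) * dv t x).
Proof.
move=> p1 Hv t x t0; have [vp dvE le] := Hv t x t0; split; first exact: powR_gt0.
  have H := @is_derive1_powR _ p _ vp.
  exact: (@is_derive1_comp R (fun z => z `^ p) (v^~ x) t _ _ H dvE).
have p0 : 0 <= p by apply: le_trans p1.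
apply: le_trans (ler_wpM2l _ le) _; first by rewrite mulr_ge0 ?powR_ge0.
rewrite mulrBr -[p * _ * v t x]mulrA [_ `^ _ * v t x]mulrC mulr_powRB1 ?(ltW vp) ?(lt_le_trans _ p1)//.
have H : p * v t x `^ (p - 1) * P (v t) x <=
   P (fun y => v t y `^ p) x + (p - 1) * v t x `^ p.
  rewrite /P /Pop mulrCA -[X in _ <= _ + X](mulKf (lt0r_neq0 (m_gt0 x))) -mulrDr.
  rewrite ler_wpM2l ?invr_ge0 ?(ltW (m_gt0 x))//.
  apply: le_trans (_ : \sum_(y <- D) b x y * (v t y `^ p + (p - 1) * v t x `^ p) <= _).
    rewrite mulr_sumr; apply: ler_sum => y _.
    rewrite mulrCA ler_wpM2l//; apply: young_power => //.
    by have [] := Hv t y t0.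
  under eq_bigr do rewrite mulrDr.
  rewrite big_split /= lerD2l -mulr_suml.
  by rewrite ler_wpM2r// mulr_ge0 ?powR_ge0// subr_ge0.
move: H; lra.
Qed.

(** Testing with [eta^2 v]. After the subsolution inequality all is an identity, from [eta x^2 + eta
    y^2 = 2 eta x eta y + (eta x - eta y)^2] on each edge. The error carries the product [v x v y],
    so nothing has to be absorbed into the energy. *)
Lemma caccioppoli v dv (eta : X -> R) (t : R) : subsol v dv -> 0 < t -> (forall x, 0 <= eta x) ->
  \sum_(x <- D) m x * (2 * eta x ^+ 2 * v t x * dv t x) <=
  - 2 * Qf b m D (fun x => eta x * v t x) +
  \sum_(x <- D) \sum_(y <- D) b x y * ((eta x - eta y) ^+ 2 * (v t x * v t y)).
Proof.
move=> Hv t0 eta0.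
apply: le_trans (_ : \sum_(x <- D) m x * (2 * eta x ^+ 2 * v t x * (P (v t) x - v t x)) <= _).
  apply: ler_sum => x _; rewrite ler_wpM2l ?(ltW (m_gt0 x))//.
  have [vp _ le] := Hv t x t0.
  by rewrite ler_wpM2l// !mulr_ge0 ?exprn_ge0 ?(ltW vp).
rewrite le_eqVlt; apply/orP; left; apply/eqP.
pose u := v t.
have e1 x : m x * (2 * eta x ^+ 2 * u x * (P u x - u x)) =
   2 * \sum_(y <- D) b x y * (eta x ^+ 2 * (u x * u y)) - 2 * (m x * ((eta x * u x) * (eta x * u x))).
  have -> : \sum_(y <- D) b x y * (eta x ^+ 2 * (u x * u y)) = m x * (eta x ^+ 2 * u x * P u x).
    rewrite /P /Pop !mulr_sumr; apply: eq_bigr => y _.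
    by field; rewrite gt_eqF.
  ring.
rewrite (eq_bigr _ (fun x _ => e1 x)) sumrB -!mulr_sumr.
rewrite /Qf /ip.
have -> : 2 * \sum_(x <- D) \sum_(y <- D) b x y * (eta x ^+ 2 * (u x * u y)) =
   \sum_(x <- D) \sum_(y <- D) b x y * ((eta x ^+ 2 + eta y ^+ 2) * (u x * u y)).
  rewrite mulr_natl mulr2n {2}exchange_big /= -big_split /=.
  apply: eq_bigr => x _; rewrite -big_split /=; apply: eq_bigr => y _.
  rewrite (b_sym y x); ring.
have -> : \sum_(x <- D) \sum_(y <- D) b x y * ((eta x ^+ 2 + eta y ^+ 2) * (u x * u y)) =
   2 * bf b D (fun x => eta x * u x) (fun x => eta x * u x) +
   \sum_(x <- D) \sum_(y <- D) b x y * ((eta x - eta y) ^+ 2 * (u x * u y)).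
  rewrite /bf mulr_sumr -big_split /=; apply: eq_bigr => x _.
  rewrite mulr_sumr -big_split /=; apply: eq_bigr => y _; ring.
rewrite -/u; ring.
Qed.

(** The local Sobolev inequality for nonnegative functions on the list [D]: [rho] is the distance to
    the centre, [A] stands for [phi r^2 / V^(2/n)], and [1 - 2/n] is two over the exponent
    [2n/(n-2)]. *)
Definition sobolev_on (rho : X -> R) (A r n : R) : Prop :=
  forall w : X -> R, (forall x, 0 <= w x) -> (forall x, w x != 0 -> rho x <= r) ->
  (\sum_(x <- D) m x * w x `^ (2 * n / (n - 2))) `^ (1 - 2 / n) <=
  A * (2 * Qf b m D w + ip m D w w / r ^+ 2).

(** It vanishes from [ra - 1] on, not only from [ra], so that an edge on which it varies has both
    ends in the ball of radius [ra]. The price is the slope [1/(ra - rb - 1)]. *)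
Definition cutoff (ra rb s : R) : R := Num.min 1 (Num.max 0 ((ra - 1 - s) / (ra - rb - 1))).

Lemma cutoff_ge0 (ra rb s : R) : 0 <= cutoff ra rb s.
Proof. by rewrite /cutoff le_min ler01 le_max lexx. Qed.

Lemma cutoff_le1 (ra rb s : R) : cutoff ra rb s <= 1.
Proof. by rewrite /cutoff ge_min lexx. Qed.

Lemma cutoff1 (ra rb s : R) : 1 < ra - rb -> s <= rb -> cutoff ra rb s = 1.
Proof.
move=> h hs; rewrite /cutoff min_l// le_max ler_pdivlMr ?subr_gt0// mul1r orbC.
by apply/orP; left; lra.
Qed.

Lemma cutoff_neq0 (ra rb s : R) : 1 < ra - rb -> cutoff ra rb s != 0 -> s < ra - 1.
Proof.
move=> h; apply: contraR; rewrite -leNgt => hs; apply/eqP.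
rewrite /cutoff (@max_l _ _ 0) ?min_r ?ler01//.
by rewrite ler_pdivrMr ?mul0r ?subr_gt0//; lra.
Qed.

Lemma cutoff_lip (ra rb s s' : R) : 1 < ra - rb ->
  `|cutoff ra rb s - cutoff ra rb s'| <= `|s - s'| / (ra - rb - 1).
Proof.
move=> h; have g0 : 0 < ra - rb - 1 by lra.
have clip (a c : R) : `|Num.min 1 (Num.max 0 a) - Num.min 1 (Num.max 0 c)| <= `|a - c|.
  rewrite /Order.min /Order.max.
  have := ler_norm (a - c); have := ler_norm (c - a); rewrite distrC.
  set N := `|a - c| => h1 h2; rewrite ler_norml.
  case: (ltP 0 a) => ?; case: (ltP 0 c) => ?; case: (ltP 1 a) => ?; case: (ltP 1 c) => ?;
    rewrite ?ltr10; lra.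
apply: le_trans (clip _ _) _.
rewrite -mulrBl normrM [`|_^-1|]ger0_norm ?invr_ge0 ?(ltW g0)// ler_wpM2r ?invr_ge0 ?(ltW g0)//.
rewrite distrC; by have -> : ra - 1 - s' - (ra - 1 - s) = s - s' by ring.
Qed.

(** Only edges inside the ball of radius [ra] contribute; there [v] may be replaced by its
    restriction to the ball, to which [bf_le_ip] applies. *)
Lemma cutoff_energy (rho : X -> R) (ra rb : R) (v : X -> R) :
  (forall x y, 0 < b x y -> `|rho x - rho y| <= 1) -> 1 < ra - rb -> (forall x, 0 <= v x) ->
  \sum_(x <- D) \sum_(y <- D) b x y *
     ((cutoff ra rb (rho x) - cutoff ra rb (rho y)) ^+ 2 * (v x * v y)) <=
  ((ra - rb - 1)^-1) ^+ 2 * \sum_(x <- D | rho x <= ra) m x * v x ^+ 2.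
Proof.
move=> hrho h v0; set L := (ra - rb - 1)^-1.
have L0 : 0 <= L by rewrite invr_ge0; lra.
pose w x := if rho x <= ra then v x else 0.
have -> : \sum_(x <- D | rho x <= ra) m x * v x ^+ 2 = ip m D w w.
  rewrite /ip big_mkcond /=; apply: eq_bigr => x _; rewrite /w; case: ifP => _; last by rewrite !mulr0.
  by rewrite expr2.
apply: le_trans (_ : L ^+ 2 * bf b D w w <= _); last first.
  by rewrite ler_wpM2l ?exprn_ge0//; apply: bf_le_ip.
rewrite /bf mulr_sumr; apply: ler_sum => x _; rewrite mulr_sumr; apply: ler_sum => y _.
have [->|bn0] := eqVneq (b x y) 0; first by rewrite !mul0r mulr0.
have bp : 0 < b x y by rewrite lt_neqAle eq_sym bn0/=.
rewrite [leRHS]mulrCA ler_wpM2l//.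
have w0 z : 0 <= w z by rewrite /w; case: ifP.
set e := cutoff _ _ _ - _.
have [->|en0] := eqVneq e 0; first by rewrite expr0n mul0r !mulr_ge0 ?exprn_ge0.
have hxy := hrho _ _ bp.
have [hx hy] : rho x <= ra /\ rho y <= ra.
  have [cx|cx] := eqVneq (cutoff ra rb (rho x)) 0; last first.
    have := cutoff_neq0 h cx; move: hxy; rewrite ler_norml => /andP[? ?]; split; lra.
  have [cy|cy] := eqVneq (cutoff ra rb (rho y)) 0; last first.
    have := cutoff_neq0 h cy; move: hxy; rewrite ler_norml => /andP[? ?]; split; lra.
  by move: en0; rewrite /e cx cy subrr eqxx.
rewrite /w hx hy ler_wpM2r ?mulr_ge0//.
rewrite -[e ^+ 2]real_normK ?num_real// lerXn2r ?nnegrE//.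
apply: le_trans (cutoff_lip _ _ h) _.
by rewrite -[leRHS]mul1r ler_wpM2r.
Qed.

(** Hölder with weights [2/n] and [1 - 2/n]; the exponents match because [2 (2/n) + (2n/(n-2)) (1 -
    2/n) = 2 (1 + 2/n)]. *)
Lemma interpolation (n : R) (w : X -> R) : 2 < n -> (forall x, 0 <= w x) -> 0 < ip m D w w ->
  0 < \sum_(x <- D) m x * w x `^ (2 * n / (n - 2)) ->
  \sum_(x <- D) m x * (w x `^ (1 + 2 / n)) ^+ 2 <=
  ip m D w w `^ (2 / n) * (\sum_(x <- D) m x * w x `^ (2 * n / (n - 2))) `^ (1 - 2 / n).
Proof.
move=> hn w0 hF hq; have n0 : 0 < n by lra.
have th : 0 < 2 / n < 1 by rewrite divr_gt0//= ltr_pdivrMr// mul1r.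
have eF : ip m D w w = \sum_(x <- D) m x * w x `^ 2.
  by apply: eq_bigr => x _; rewrite powR_mulrn// expr2.
rewrite eF in hF *.
apply: le_trans (hoelder_sum th _ _ _ hF hq); last 3 first.
- by move=> x; apply: ltW.
- by move=> x; apply: powR_ge0.
- by move=> x; apply: powR_ge0.
rewrite le_eqVlt; apply/orP; left; apply/eqP; apply: eq_bigr => x _; congr (_ * _).
rewrite -powR_mulrn ?powR_ge0// -!powRrM -powRD; last first.
  apply/implyP => /eqP h; exfalso.
  suff : 0 < 2 * (2 / n) + 2 * n / (n - 2) * (1 - 2 / n) by rewrite h ltxx.
  have -> : 2 * n / (n - 2) * (1 - 2 / n) = 2 by field; apply/andP; split; apply: lt0r_neq0; lra.
  by rewrite addr_gt0// mulr_gt0// divr_gt0.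
congr (_ `^ _); field; apply/andP; split; apply: lt0r_neq0; lra.
Qed.

(* [lra] is slow in large contexts, and refuses to run once section variables are cleared. *)
Ltac goal_lra := clear -b_ge0 b_sym m_gt0 b_le; lra.

(* [J] and [H] are primitives in time, standing for space-time integrals. *)
Lemma moser_step (rho : X -> R) (A r n : R) v dv (ra rb T1 T2 T3 : R) (J H : R -> R) (y : X) :
  2 < n -> 0 < A -> 0 < r ->
  (forall x y, 0 < b x y -> `|rho x - rho y| <= 1) ->
  sobolev_on rho A r n -> subsol v dv -> 1 < ra - rb -> ra <= r ->
  0 < T1 -> T1 < T2 -> T2 <= T3 -> y \in D -> rho y <= rb ->
  (forall t, T1 <= t -> is_derive t 1 J (\sum_(x <- D | rho x <= ra) m x * v t x ^+ 2)) ->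
  (forall t, T1 <= t -> is_derive t 1 H
     (\sum_(x <- D | rho x <= rb) m x * (v t x `^ (1 + 2 / n)) ^+ 2)) ->
  H T3 - H T2 <=
  A * (((T2 - T1)^-1 + 2 * ((ra - rb - 1)^-1) ^+ 2 + (r ^+ 2)^-1) * (J T3 - J T1)) `^ (1 + 2 / n).
Proof.
move=> hn A0 r0 hrho hsob Hv hg har T10 T12 T23 yD hy dJ dH.
set L := (ra - rb - 1)^-1; set d := T2 - T1; have d0 : 0 < d by rewrite subr_gt0.
have n0 : 0 < n by lra.
pose Sa t := \sum_(x <- D | rho x <= ra) m x * v t x ^+ 2.
pose eta x := cutoff ra rb (rho x).
pose w t x := eta x * v t x.
pose F t := \sum_(x <- D) m x * (eta x ^+ 2 * (v t x * v t x)).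
pose dF t := \sum_(x <- D) m x * (eta x ^+ 2 * (v t x * dv t x + dv t x * v t x)).
have pos t : T1 <= t -> 0 < t by apply: lt_le_trans.
have v0 t x : T1 <= t -> 0 < v t x by move=> /pos t0; have [] := Hv t x t0.
have FE t : F t = ip m D (w t) (w t).
  by apply: eq_bigr => x _; rewrite /w; ring.
have F0 t : 0 <= F t by rewrite FE; apply: ip_ge0.
have Sa0 t : 0 <= Sa t by apply: sumr_ge0 => x _; rewrite mulr_ge0 ?sqr_ge0 ?(ltW (m_gt0 x)).
have FSa t : F t <= Sa t.
  rewrite /F /Sa [leRHS]big_mkcond /=; apply: ler_sum => x _.
  case: ifP => hx.
    rewrite ler_wpM2l ?(ltW (m_gt0 x))// -expr2 -[leRHS]mul1r ler_wpM2r ?sqr_ge0//.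
    by rewrite expr_le1 ?cutoff_ge0 ?cutoff_le1.
  have [->|/(cutoff_neq0 hg) h] := eqVneq (eta x) 0; first by rewrite expr0n mul0r mulr0.
  by move/negP: hx; case; lra.
have dFE t : T1 <= t -> is_derive t 1 F (dF t).
  move=> /pos t0; apply: is_derive_sumr => x; do 2 apply: is_deriveMl.
  by have [_ ? _] := Hv t x t0; apply: is_deriveMr.
have dFle t : T1 <= t -> dF t <= - 2 * Qf b m D (w t) + L ^+ 2 * Sa t.
  move=> ht; have t0 := pos _ ht.
  have := caccioppoli Hv t0 (fun x => cutoff_ge0 ra rb (rho x)).
  have <- : dF t = \sum_(x <- D) m x * (2 * cutoff ra rb (rho x) ^+ 2 * v t x * dv t x).
    by apply: eq_bigr => x _; rewrite /eta; ring.
  move=> h; apply: le_trans h _; rewrite lerD2l.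
  by apply: cutoff_energy => // x; apply: ltW; apply: v0.
have Q0 t : 0 <= Qf b m D (w t) by apply: Qf_ge0.
pose c1 := 1 + d * L ^+ 2.
have L2 : 0 <= L ^+ 2 by rewrite sqr_ge0.
have JT a e : T1 <= a -> a <= e -> J a <= J e.
  move=> ha hae; apply: (nondecr_of_derive (df := Sa)) => // t /andP[h1 _].
  by apply: dJ; apply: le_trans h1.
(* The factor [t - T1] is a linear cutoff in time: it removes the unknown value [F T1], and its
   derivative only adds [F <= Sa]. *)
have step2 : d * F T2 <= c1 * (J T2 - J T1).
  have id_der (t : R) : is_derive t 1 (fun t : R => t - T1) 1.
    rewrite -[X in is_derive _ _ _ X]subr0; exact: is_deriveB.
  have := @nonincr_of_derive R (fun t => (t - T1) * F t - c1 * J t)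
    (fun t => (t - T1) * dF t + 1 * F t - c1 * Sa t) T1 T2 (ltW T12).
  rewrite subrr mul0r sub0r -/d => h.
  suff : d * F T2 - c1 * J T2 <= - (c1 * J T1) by lra.
  apply: h => t /andP[h1 h2].
    apply: is_deriveB; last by apply: is_deriveMl; apply: dJ.
    by apply: is_deriveMr => //; apply: dFE.
  have e1 : (t - T1) * dF t <= d * (L ^+ 2 * Sa t).
    apply: le_trans (_ : (t - T1) * (L ^+ 2 * Sa t) <= _).
      rewrite ler_wpM2l ?subr_ge0//; apply: le_trans (dFle _ h1) _.
      by have := Q0 t; lra.
    apply: ler_wpM2r; first by rewrite mulr_ge0.
    by rewrite lerD2r.
  have := FSa t; rewrite /c1; move: e1; lra.
have step2' : F T2 <= (d^-1 + L ^+ 2) * (J T2 - J T1).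
  rewrite -(ler_pM2l d0); apply: le_trans step2 _.
  by rewrite [leRHS]mulrA [d * (_ + _)]mulrDr mulfV ?gt_eqF.
set I := J T3 - J T1.
have J12 := JT T1 T2 (lexx _) (ltW T12); have J23 := JT T2 T3 (ltW T12) T23.
have I0 : 0 <= I by rewrite subr_ge0; lra.
set M := (d^-1 + 2 * L ^+ 2 + (r ^+ 2)^-1) * I.
have di0 : 0 < d^-1 by rewrite invr_gt0.
have ri0 : 0 < (r ^+ 2)^-1 by rewrite invr_gt0 exprn_gt0.
(* From [T2] on no time cutoff is needed, and [F] stays below a multiple of the same space-time
   integral: the sup bound required by the interpolation. *)
have FM t : T2 <= t -> t <= T3 -> F t <= M.
  move=> h1 h2; have h3 : T1 <= t by apply: le_trans (ltW T12) h1.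
  have := @nonincr_of_derive R (fun t => F t - L ^+ 2 * J t) (fun t => dF t - L ^+ 2 * Sa t) T2 t h1.
  move=> h; have {}h : F t - L ^+ 2 * J t <= F T2 - L ^+ 2 * J T2.
    apply: h => s /andP[s1 s2]; have hs : T1 <= s by apply: le_trans (ltW T12) s1.
      by apply: is_deriveB; [exact: dFE|apply: is_deriveMl; exact: dJ].
    by have := dFle _ hs; have := Q0 s; goal_lra.
  have j1 := JT t T3 h3 h2; have j2 := JT T2 t (ltW T12) h1.
  have e1 : L ^+ 2 * (J t - J T2) <= L ^+ 2 * I by rewrite ler_wpM2l// /I; move: j1 J12; goal_lra.
  have e2 : (d^-1 + L ^+ 2) * (J T2 - J T1) <= (d^-1 + L ^+ 2) * I.
    by rewrite ler_wpM2l ?addr_ge0 ?(ltW di0)// /I; move: J23; goal_lra.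
  have e3 : 0 <= (r ^+ 2)^-1 * I by rewrite mulr_ge0 ?(ltW ri0).
  move: step2' h e1 e2 e3; rewrite /M; goal_lra.
have M0 : 0 <= M by apply: mulr_ge0 => //; apply: addr_ge0; last exact: ltW; lra.
pose c := A * M `^ (2 / n).
have c0 : 0 <= c by rewrite mulr_ge0 ?powR_ge0 ?(ltW A0).
pose c2 := L ^+ 2 + (r ^+ 2)^-1.
(* At a fixed time: interpolation, then [M] for the [l2] factor and Sobolev for the other. Its
   energy [2 Qf] is traded by [dFle] for [- dF + L^2 Sa], and [- dF] integrates to boundary
   values. *)
have main t : T2 <= t -> t <= T3 ->
   \sum_(x <- D | rho x <= rb) m x * (v t x `^ (1 + 2 / n)) ^+ 2 <= c * (- dF t + c2 * Sa t).
  move=> h1 h2; have h3 : T1 <= t by apply: le_trans (ltW T12) h1.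
  have w0 x : 0 <= w t x by rewrite mulr_ge0 ?cutoff_ge0 ?(ltW (v0 _ _ h3)).
  have wy : 0 < w t y by rewrite /w /eta cutoff1// mul1r v0.
  apply: le_trans (_ : \sum_(x <- D) m x * (w t x `^ (1 + 2 / n)) ^+ 2 <= _).
    rewrite big_mkcond /=; apply: ler_sum => x _; case: ifP => hx.
      by rewrite /w /eta cutoff1// mul1r.
    by rewrite mulr_ge0 ?sqr_ge0 ?(ltW (m_gt0 x)).
  have pF : 0 < ip m D (w t) (w t).
    rewrite /ip (big_rem y)//=; apply: ltr_pwDl; first by apply: mulr_gt0 => //; apply: mulr_gt0.
    by apply: sumr_ge0 => x _; apply: mulr_ge0; [exact: ltW|exact: mulr_ge0].
  have pq : 0 < \sum_(x <- D) m x * w t x `^ (2 * n / (n - 2)).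
    rewrite (big_rem y)//=; apply: ltr_pwDl; first by apply: mulr_gt0 => //; apply: powR_gt0.
    by apply: sumr_ge0 => x _; apply: mulr_ge0; [exact: ltW|exact: powR_ge0].
  apply: le_trans (interpolation hn w0 pF pq) _.
  have hs : forall x, w t x != 0 -> rho x <= r.
    move=> x wx; have [e|/(cutoff_neq0 hg)] := eqVneq (eta x) 0; last by lra.
    by move: wx; rewrite /w e mul0r eqxx.
  have e1 := hsob _ w0 hs.
  have e2 : ip m D (w t) (w t) `^ (2 / n) <= M `^ (2 / n).
    apply: ge0_ler_powR; rewrite ?divr_ge0 ?nnegrE ?(ltW n0)//; first exact: ltW.
    by rewrite -FE; apply: FM.
  apply: le_trans (ler_pM (powR_ge0 _ _) (powR_ge0 _ _) e2 e1) _.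
  rewrite /c -mulrA [leLHS]mulrCA ler_wpM2l ?(ltW A0)// ler_wpM2l ?powR_ge0//.
  have := dFle _ h3; rewrite -FE.
  have : F t / r ^+ 2 <= (r ^+ 2)^-1 * Sa t by rewrite mulrC ler_wpM2l ?(ltW ri0).
  rewrite /c2; goal_lra.
have step4 : H T3 - H T2 <= c * (F T2 + c2 * (J T3 - J T2)).
  have := @nonincr_of_derive R (fun t => H t - c * (- F t + c2 * J t))
    (fun t => (\sum_(x <- D | rho x <= rb) m x * (v t x `^ (1 + 2 / n)) ^+ 2)
        - c * (- dF t + c2 * Sa t)) T2 T3 T23.
  move=> h; have {}h : H T3 - c * (- F T3 + c2 * J T3) <= H T2 - c * (- F T2 + c2 * J T2).
    apply: h => t /andP[h1 h2]; have h3 : T1 <= t by apply: le_trans (ltW T12) h1.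
      apply: is_deriveB; first exact: dH.
      apply: is_deriveMl; apply: is_deriveD; last by apply: is_deriveMl; exact: dJ.
      by have ? := dFE t h3; apply: is_deriveN.
    by rewrite subr_le0; apply: main.
  have e : 0 <= c * F T3 by rewrite mulr_ge0.
  move: h e; goal_lra.
apply: le_trans step4 _.
have -> : A * M `^ (1 + 2 / n) = c * M.
  rewrite /c -mulrA [_ `^ _ * M]mulrC -{2}(addrK 1 (2 / n)) [2 / n + 1]addrC mulr_powRB1//.
  by rewrite addr_gt0// divr_gt0.
rewrite ler_wpM2l//.
have e2 : (d^-1 + L ^+ 2) * (J T2 - J T1) <= (d^-1 + L ^+ 2) * I.
  by rewrite ler_wpM2l ?addr_ge0 ?(ltW di0)// /I; move: J23; goal_lra.
have e1 : c2 * (J T3 - J T2) <= c2 * I by rewrite ler_wpM2l ?addr_ge0 ?(ltW ri0)// /I; move: J12; goal_lra.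
move: step2' e1 e2; rewrite /M /c2; goal_lra.
Qed.

(** * The full iteration and the mean value inequality *)

Lemma dyadic_scale (r : R) : 1 <= r -> exists K : nat, 2 ^+ K <= r < 2 ^+ K.+1.
Proof.
move=> r1; have [N hN] : exists N : nat, r < 2 ^+ N.
  exists (Num.Def.archi_bound r).
  apply: lt_trans (archi_boundP (le_trans ler01 r1)) _.
  by rewrite -natrX ltr_nat ltn_expl.
elim: N hN => [|N IH] hN; first by move: hN; rewrite expr0 ltNge r1.
by have [/IH//|h] := ltP r (2 ^+ N); exists N; rewrite h hN.
Qed.

Lemma bernoulli_ge (a : R) k : 0 <= a -> 1 + k%:R * a <= (1 + a) ^+ k.
Proof.
move=> a0; elim: k => [|k IH]; first by rewrite mul0r addr0 expr0.
rewrite exprS; apply: le_trans (ler_wpM2l _ IH); last by rewrite addr_ge0.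
have : 0 <= k%:R * (a * a) by rewrite !mulr_ge0.
rewrite -natr1; lra.
Qed.

(** [133 = 4 + 2 * 64 + 1] collects the time gap, the cutoff slope and [1/r^2] of one step. [moserG]
    is the factor that the whole recursion puts on its initial value, [moserH] pays for passing to a
    single vertex at the end, and [expR 2] for a factor [e^(-1)] lost over the last unit of time. *)
Definition moserD (n phi : R) : R := 1 + phi * 133 `^ (1 + 2 / n).
Definition moserG (n phi : R) : R := moserD n phi `^ (n / 2) * 16 `^ ((n / 2) ^+ 2).
Definition moserH (n c : R) : R := 2 `^ ((n + 2) * (n + 4)) * (1 + c^-1).
Definition mvC (n phi c : R) : R := expR 2 * (moserH n c * moserG n phi).

(* The exponents solve [E (k+1) D 16^k = (E k)^(1+2/n)]. *)
Lemma moser_iteration (n Dc G : R) (Y : nat -> R) K : 2 < n -> 1 <= Dc ->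
  (forall k, (k <= K)%N -> 0 <= Y k) -> 0 <= G ->
  Dc `^ (n / 2) * 16 `^ ((n / 2) ^+ 2) * Y 0 <= G ->
  (forall k, (k < K)%N -> Y k.+1 <= Dc * 16 `^ k%:R * Y k `^ (1 + 2 / n)) ->
  Y K <= G `^ ((1 + 2 / n) ^+ K).
Proof.
move=> hn D1 Y0 G0 hG hY; have n0 : 0 < n by lra.
have D0 : 0 < Dc by lra.
pose E (k : nat) := Dc `^ (n / 2) * 16 `^ (n / 2 * k%:R + (n / 2) ^+ 2).
have E0 k : 0 < E k by rewrite mulr_gt0 ?powR_gt0.
have kap0 : 0 <= 1 + 2 / n by rewrite addr_ge0 ?divr_ge0 ?(ltW n0).
have claim k : (k <= K)%N -> E k * Y k <= G `^ ((1 + 2 / n) ^+ k).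
  elim: k => [|k IH] hk.
    by rewrite expr0 powRr1// /E mulr0 add0r.
  apply: le_trans (_ : E k.+1 * (Dc * 16 `^ k%:R * Y k `^ (1 + 2 / n)) <= _).
    by rewrite ler_wpM2l ?(ltW (E0 _))// hY.
  have -> : E k.+1 * (Dc * 16 `^ k%:R * Y k `^ (1 + 2 / n)) = (E k * Y k) `^ (1 + 2 / n).
    rewrite powRM ?(ltW (E0 _)) ?Y0 ?(ltnW hk)// mulrA; congr (_ * _).
    rewrite /E powRM ?powR_ge0// -!powRrM mulrACA; congr (_ * _).
      rewrite -{2}[Dc]powRr1 ?(ltW D0)// -powRD; last by rewrite (gt_eqF D0) implybT.
      by congr (_ `^ _); field; rewrite gt_eqF.
    rewrite -powRD; last by rewrite pnatr_eq0 implybT.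
    by congr (_ `^ _); rewrite -natr1; field; rewrite gt_eqF.
  rewrite exprSr powRrM; apply: ge0_ler_powR => //.
  - by rewrite nnegrE mulr_ge0 ?(ltW (E0 _)) ?Y0 ?(ltnW hk).
  - by rewrite nnegrE powR_ge0.
  - by apply: IH; apply: ltnW.
apply: le_trans (claim K (leqnn _)).
rewrite -[leLHS]mul1r ler_wpM2r ?Y0//.
have e1 : 1 <= Dc `^ (n / 2).
  by rewrite -[X in X <= _](powRr0 Dc) ler_powR// divr_ge0// ltW.
have e2 : 1 <= 16 `^ (n / 2 * K%:R + (n / 2) ^+ 2) :> R.
  rewrite -[X in X <= _](powRr0 16) ler_powR ?ler1n// addr_ge0 ?sqr_ge0// mulr_ge0// divr_ge0// ltW//.
by rewrite /E; apply: mulr_ege1.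
Qed.

(** [2^(K+4)] will bound the radius. By Bernoulli [(1 + 2/n)^K >= 1 + 2K/n], and
    [(n+4)(1 + 2K/n) >= K + 4]; so the polynomial loss becomes a constant in the root of order
    [(1 + 2/n)^K]. *)
Lemma moserH_ge (n c : R) (K : nat) : 2 < n -> 0 < c ->
  (2 ^+ (K + 4)) `^ (n + 2) / c <= moserH n c `^ ((1 + 2 / n) ^+ K).
Proof.
move=> hn c0; have n0 : 0 < n by lra.
have ci : 0 < c^-1 by rewrite invr_gt0.
have H0 : 0 <= 2 `^ ((n + 2) * (n + 4)) :> R by apply: powR_ge0.
rewrite /moserH powRM//; last by rewrite addr_ge0// ltW.
have an0 : 0 <= 2 / n by rewrite divr_ge0 ?(ltW n0).
have hk := bernoulli_ge K an0.
have k1 : 1 <= (1 + 2 / n) ^+ K.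
  by apply: le_trans hk; rewrite lerDl mulr_ge0.
apply: ler_pM; rewrite ?powR_ge0 ?(ltW ci)//; last first.
  apply: le_trans (_ : 1 + c^-1 <= _); first by rewrite lerDr.
  by apply: le1r_powR => //; rewrite lerDl ltW.
rewrite -(powR_mulrn (K + 4) (ler0n _ 2)) -!powRrM; apply: ler_powR; first exact: ler1n.
apply: le_trans (ler_wpM2l _ hk); last by rewrite mulr_ge0// addr_ge0 ?(ltW n0).
rewrite mulrC -[leRHS]mulrA ler_wpM2l ?addr_ge0 ?(ltW n0)//.
have -> : (n + 4) * (1 + K%:R * (2 / n)) = n + 4 + K%:R * 2 + 8 * K%:R / n.
  by field; rewrite gt_eqF.
have : 0 <= 8 * K%:R / n by rewrite divr_ge0 ?mulr_ge0 ?(ltW n0).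
have : 0 <= K%:R :> R by [].
rewrite natrD; lra.
Qed.

(** After [K] steps only the vertex [y] and the times in [[T - 1, T]] are kept of the last integral.
    Against the average this costs [V r^2 / m y <= r^(n+2) / c], which [moserH_ge] absorbs. Hence
    the point value enters as a number [u0] that bounds [u] from below, up to [e^(-1)], on that
    whole unit of time. *)
Lemma mean_value (rho : X -> R) (n phi c r V T B u0 : R) u du (y : X) :
  2 < n -> 0 < phi -> 0 < c -> 8 <= r -> 0 < V ->
  (forall x y, 0 < b x y -> `|rho x - rho y| <= 1) ->
  sobolev_on rho (phi * r ^+ 2 / V `^ (2 / n)) r n ->
  subsol u du -> y \in D -> rho y <= 0 -> c * V <= m y * r `^ n -> r ^+ 2 < T ->
  (forall t : R, T - r ^+ 2 <= t <= T -> \sum_(x <- D | rho x <= r) m x * u t x ^+ 2 <= B) ->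
  0 <= u0 -> (forall t : R, T - 1 <= t <= T -> expR (-1) * u0 <= u t y) ->
  u0 ^+ 2 <= mvC n phi c * (B / V).
Proof.
move=> hn phi0 c0 r8 V0 hrho hsob Hu yD hy hm hT hB u00 hu0.
have r0 : 0 < r by lra.
have n0 : 0 < n by lra.
set kap := 1 + 2 / n.
have kap1 : 1 <= kap by rewrite lerDl divr_ge0 ?(ltW n0).
have kap0 : 0 < kap by lra.
set A := phi * r ^+ 2 / V `^ (2 / n).
have r20 : 0 < r ^+ 2 by rewrite exprn_gt0.
have A0 : 0 < A by rewrite divr_gt0 ?powR_gt0// mulr_gt0.
pose v (k : nat) t x := u t x `^ (kap ^+ k).
have Hv k : exists dv, subsol (v k) dv.
  eexists; apply: subsol_pow Hu.
  by apply: exprn_ege1.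
have vS k t x : v k.+1 t x = v k t x `^ kap by rewrite /v exprSr powRrM.
pose T0 := T - r ^+ 2; have T00 : 0 < T0 by rewrite subr_gt0.
pose ra (k : nat) := r * (2^-1 + 2^-1 * 2^-1 ^+ k).
pose S k t := \sum_(x <- D | rho x <= ra k) m x * v k t x ^+ 2.
have [J hJ] : exists J : nat -> R -> R, forall k (t : R), T0 <= t -> is_derive t 1 (J k) (S k t).
  suff H (k : nat) : exists Jk : R -> R, forall t : R, T0 <= t -> is_derive t 1 Jk (S k t).
    by exists (fun k => projT1 (cid (H k))) => k; exact: projT2 (cid (H k)).
  have [dv hdv] := Hv k.
  apply: (primitive_pos (S := S k)) => // t t0.
  have : is_derive t 1 (S k)
     (\sum_(x <- D) (if rho x <= ra k then m x * (v k t x * dv t x + dv t x * v k t x) else 0)).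
    have : is_derive t 1 (fun t => \sum_(x <- D) (if rho x <= ra k then m x * (v k t x * v k t x) else 0))
      (\sum_(x <- D) (if rho x <= ra k then m x * (v k t x * dv t x + dv t x * v k t x) else 0)).
      apply: is_derive_sumr => x; case: ifP => _; last exact: is_derive_cst.
      by apply: is_deriveMl; have [_ ? _] := hdv t x t0; apply: is_deriveMr.
    apply: is_derive_ext => s; rewrite /S [RHS]big_mkcond /=; apply: eq_bigr => x _.
    by rewrite expr2.
  by case=> + _ => /derivable1_diffP/differentiable_continuous.
pose q (k : nat) : R := 4^-1 ^+ k.
(* Time steps are proportional to the squares of the radius gaps, and all of them stay below
   [T - 1], as [T0 + r^2/3 <= T - 1] for [r >= 8]. *)
pose Tk (k : nat) := T0 + r ^+ 2 * (1 - q k) / 3.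
have q0 k : 0 < q k by rewrite exprn_gt0 ?invr_gt0.
have q1 k : q k <= 1 by rewrite exprn_ile1 ?invr_ge0 ?invf_le1 ?ler1n.
have qS k : q k.+1 = q k / 4 by rewrite /q exprSr.
have Tk0 k : T0 <= Tk k.
  by rewrite lerDl divr_ge0// mulr_ge0 ?(ltW r20)// subr_ge0.
have TkS k : Tk k.+1 - Tk k = r ^+ 2 * q k / 4 by rewrite /Tk qS; field.
have r64 : 64 <= r ^+ 2 by rewrite -[64]/(8 * 8)%:R natrM -expr2 lerXn2r ?nnegrE ?(ltW r0).
have TkT k : Tk k <= T - 1.
  have : r ^+ 2 * (1 - q k) / 3 <= r ^+ 2 / 3.
    by rewrite ler_wpM2r ?invr_ge0// ler_piMr ?(ltW r20)//; have := q0 k; lra.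
  rewrite /Tk /T0; move: r64; lra.
have S0 k t : 0 <= S k t by apply: sumr_ge0 => x _; rewrite mulr_ge0 ?sqr_ge0 ?(ltW (m_gt0 x)).
have JT k a e : T0 <= a -> a <= e -> J k a <= J k e.
  move=> ha hae; apply: (nondecr_of_derive (df := S k)) => // t /andP[h1 _].
  by apply: hJ; apply: le_trans h1.
pose I k := J k T - J k (Tk k).
have T0T k : Tk k <= T by have := TkT k; lra.
have I0 k : 0 <= I k by rewrite subr_ge0 JT.
have Vr : 0 < V * r ^+ 2 by rewrite mulr_gt0.
pose Y k := I k / (V * r ^+ 2).
have Y0 k : 0 <= Y k by rewrite divr_ge0 ?(ltW Vr).
(* For [k < K] this gives [ra k - ra k.+1 >= 4], so subtracting the jump size costs at most a factor
   two; the other half gives [r <= 2^(K+4)]. *)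
have [K /andP[K1 K2]] : exists K : nat, 2 ^+ K <= r / 8 < 2 ^+ K.+1.
  by apply: dyadic_scale; rewrite ler_pdivlMr// mul1r.
have step k : (k < K)%N -> Y k.+1 <= moserD n phi * 16 `^ k%:R * Y k `^ kap.
  move=> hk.
  have h2 : 2^-1 ^+ k = (2 ^+ k)^-1 :> R by rewrite exprVn.
  have p2 : 0 < 2 ^+ k :> R by rewrite exprn_gt0.
  have gapE : ra k - ra k.+1 = r / 4 / 2 ^+ k.
    by rewrite /ra exprSr h2; field; rewrite gt_eqF.
  have gap4 : 4 <= ra k - ra k.+1.
    rewrite gapE ler_pdivlMr// ler_pdivlMr//.
    have : 2 ^+ k.+1 <= r / 8.
      by apply: le_trans K1; rewrite ler_weXn2l ?ler1n.
    rewrite ler_pdivlMr// exprS; goal_lra.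
  have hra : ra k <= r.
    rewrite /ra -[leRHS]mulr1 ler_wpM2l ?(ltW r0)//.
    have : 2^-1 ^+ k <= 1 :> R by rewrite exprn_ile1 ?invr_ge0 ?invf_le1 ?ler1n.
    goal_lra.
  have [dv hdv] := Hv k.
  have ray : rho y <= ra k.+1.
    by apply: le_trans hy _; rewrite mulr_ge0 ?(ltW r0)// addr_ge0// ?mulr_ge0 ?exprn_ge0 ?invr_ge0.
  have TT : Tk k < Tk k.+1.
    by rewrite -subr_gt0 TkS divr_gt0// mulr_gt0.
  have := @moser_step rho A r n (v k) dv (ra k) (ra k.+1) (Tk k) (Tk k.+1) T (J k) (J k.+1) y
     hn A0 r0 hrho hsob hdv.
  have g1 : 1 < ra k - ra k.+1 by move: gap4; goal_lra.
  move=> /(_ g1 hra (lt_le_trans T00 (Tk0 k)) TT (T0T k.+1) yD ray).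
  have d1 t : Tk k <= t -> is_derive t 1 (J k) (\sum_(x <- D | rho x <= ra k) m x * v k t x ^+ 2).
    by move=> ht; apply: hJ; apply: le_trans ht.
  have d2 t : Tk k <= t -> is_derive t 1 (J k.+1)
      (\sum_(x <- D | rho x <= ra k.+1) m x * (v k t x `^ (1 + 2 / n)) ^+ 2).
    move=> ht; have := hJ k.+1 t (le_trans (Tk0 k) ht).
    rewrite /S (eq_bigr (fun x => m x * (v k t x `^ (1 + 2 / n)) ^+ 2))//.
    by move=> x _; rewrite vS.
  move=> /(_ d1 d2); rewrite -/(I k.+1) -/(I k) TkS => st.
  have coef : (r ^+ 2 * q k / 4)^-1 + 2 * (ra k - ra k.+1 - 1)^-1 ^+ 2 + (r ^+ 2)^-1 <=
     133 * 4 ^+ k / r ^+ 2.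
    have qE : (q k)^-1 = 4 ^+ k by rewrite /q exprVn invrK.
    have -> : (r ^+ 2 * q k / 4)^-1 = 4 * 4 ^+ k / r ^+ 2.
      by rewrite -qE; field; rewrite !gt_eqF.
    have e1 : (ra k - ra k.+1 - 1)^-1 ^+ 2 <= 64 * 4 ^+ k / r ^+ 2.
      have -> : 64 * 4 ^+ k / r ^+ 2 = (8 * 2 ^+ k / r) ^+ 2.
        rewrite [(_ / r) ^+ 2]exprMn exprVn exprMn -exprM mulnC exprM.
        by congr (_ * _ ^+ k / _); rewrite -natrX.
      rewrite lerXn2r ?nnegrE ?invr_ge0 ?divr_ge0 ?mulr_ge0 ?(ltW p2) ?(ltW r0)//; first by move: gap4; goal_lra.
      have -> : 8 * 2 ^+ k / r = (r / 8 / 2 ^+ k)^-1.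
        by field; rewrite !gt_eqF.
      have e : r / 8 / 2 ^+ k = (ra k - ra k.+1) / 2 by rewrite gapE; field; rewrite gt_eqF.
      rewrite e lef_pV2 ?posrE; move: gap4; goal_lra.
    have e2 : (r ^+ 2)^-1 <= 4 ^+ k / r ^+ 2.
      by rewrite ler_pdivlMr// mulVf ?gt_eqF// exprn_ege1// ler1n.
    move: e1 e2; rewrite -!mulrA; goal_lra.
  have p4 : 0 < 4 ^+ k :> R by rewrite exprn_gt0.
  have p4' : 0 <= 133 * 4 ^+ k :> R by rewrite mulr_ge0// ltW.
  have VY : 0 <= V * Y k by apply: mulr_ge0 => //; exact: ltW.
  have {}st : I k.+1 <= A * (133 * 4 ^+ k * (V * Y k)) `^ kap.
    apply: le_trans st _; rewrite ler_wpM2l ?(ltW A0)//; apply: ge0_ler_powR; rewrite ?(ltW kap0)//.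
    - rewrite nnegrE; apply: mulr_ge0 => //; apply: addr_ge0; first apply: addr_ge0.
      + by rewrite invr_ge0 ltW// divr_gt0// mulr_gt0.
      + by rewrite mulr_ge0// sqr_ge0.
      + by rewrite invr_ge0 ltW.
    - by rewrite nnegrE; apply: mulr_ge0.
    have -> : 133 * 4 ^+ k * (V * Y k) = 133 * 4 ^+ k / r ^+ 2 * I k.
      by rewrite /Y; field; rewrite !gt_eqF.
    by rewrite ler_wpM2r.
  rewrite /Y ler_pdivrMr//; apply: le_trans st _.
  have -> : A * (133 * 4 ^+ k * (V * Y k)) `^ kap =
     phi * 133 `^ kap * (4 ^+ k) `^ kap * Y k `^ kap * (V * r ^+ 2).
    rewrite (powRM _ p4' VY) (powRM _ (ltW V0) (Y0 k)) powRM ?(ltW p4)//.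
    have -> : V `^ kap = V * V `^ (2 / n).
      by rewrite /kap powRD ?powRr1 ?(ltW V0)// (gt_eqF V0) implybT.
    by rewrite /A; field; rewrite gt_eqF ?powR_gt0.
  rewrite ler_wpM2r ?(ltW Vr)// ler_wpM2r ?powR_ge0//.
  apply: ler_pM; rewrite ?mulr_ge0 ?powR_ge0 ?(ltW phi0)//.
    by rewrite /moserD lerDr.
  rewrite -powR_mulrn// -!powRrM.
  have -> : 16 = 4 `^ 2 :> R by rewrite powR_mulrn// -natrX.
  rewrite -powRrM ler_powR ?ler1n// mulrC ler_wpM2r//.
  by rewrite /kap -[2]/(1 + 1) lerD2l ler_pdivrMr// mul1r ltW.
have YB : Y 0 <= B / V.
  rewrite /Y invfM mulrA ler_pdivrMr// mulrAC ler_wpM2r ?invr_ge0 ?(ltW V0)//.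
  have := @nonincr_of_derive R (fun t => J 0 t - B * t) (fun t => S 0 t - B * 1) T0 T.
  have Tk00 : Tk 0 = T0 by rewrite /Tk /q expr0 subrr mulr0 mul0r addr0.
  have T0T' : T0 <= T by rewrite -Tk00.
  move=> /(_ T0T') h; have {}h : J 0 T - B * T <= J 0 T0 - B * T0.
    apply: h => t /andP[h1 h2].
      by apply: is_deriveB; exact: hJ.
    rewrite mulr1 subr_le0; apply: le_trans (hB t _); last by rewrite h1 h2.
    rewrite /S /ra expr0 mulr1 le_eqVlt; apply/orP; left; apply/eqP.
    have -> : r * (2^-1 + 2^-1) = r by field.
    by apply: eq_bigr => x _; rewrite /v expr0 powRr1// ltW//; have [] := Hu t x (lt_le_trans T00 h1).
  rewrite /I Tk00; move: h; rewrite /T0; goal_lra.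
have D1 : 1 <= moserD n phi by rewrite lerDl mulr_ge0 ?powR_ge0// ltW.
have G0 : 0 < moserG n phi by rewrite mulr_gt0 ?powR_gt0// (lt_le_trans _ D1).
have BV0 : 0 <= B / V by apply: le_trans YB.
have YK := @moser_iteration n (moserD n phi) (moserG n phi * (B / V)) Y K hn D1 (fun k _ => Y0 k)
  (mulr_ge0 (ltW G0) BV0) (ler_wpM2l (ltW G0) YB) step.
set w := (expR (-1) * u0) ^+ 2.
have w0 : 0 <= w by rewrite sqr_ge0.
have low : m y * w `^ (kap ^+ K) <= I K.
  apply: le_trans (_ : J K T - J K (T - 1) <= _); last first.
    by rewrite /I lerD2l lerN2 JT.
  set z := m y * _.
  have T1 : T - 1 <= T by rewrite gerBl.
  have := @nondecr_of_derive R (fun t => J K t - z * t) (fun t => S K t - z * 1) (T - 1) T T1.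
  move=> h; have {}h : J K (T - 1) - z * (T - 1) <= J K T - z * T.
    apply: h => t /andP[h1 h2].
      by apply: is_deriveB; apply: hJ; apply: le_trans (Tk0 K) (le_trans (TkT K) h1).
    rewrite mulr1 subr_ge0 /S (big_rem y)//= ifT; last first.
      by apply: le_trans hy _; rewrite mulr_ge0 ?(ltW r0)// addr_ge0// ?mulr_ge0 ?exprn_ge0 ?invr_ge0.
    apply: ler_wpDr; first by apply: sumr_ge0 => x _; rewrite mulr_ge0 ?sqr_ge0 ?(ltW (m_gt0 x)).
    rewrite /z ler_wpM2l ?(ltW (m_gt0 y))//.
    have le1 : expR (-1) * u0 <= u t y by apply: hu0; rewrite h1 h2.
    have e0 : 0 <= expR (-1) * u0 by rewrite mulr_ge0 ?expR_ge0.
    have uy0 : 0 <= u t y by apply: le_trans le1.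
    rewrite /v [leRHS]expr2 -powRM// -expr2.
    apply: ge0_ler_powR; rewrite ?nnegrE ?sqr_ge0//; first by rewrite exprn_ge0 ?(ltW kap0).
    by rewrite /w lerXn2r.
  move: h; goal_lra.
have HH := moserH_ge K hn c0.
have rn0 : 0 < r `^ n by rewrite powR_gt0.
have r2K : r <= 2 ^+ (K + 4).
  rewrite ltr_pdivrMr// in K2; apply: le_trans (ltW K2) _.
  rewrite exprS exprD (_ : 2 ^+ 4 = 16 :> R); last by rewrite -natrX.
  have : 0 <= 2 ^+ K :> R by rewrite exprn_ge0.
  goal_lra.
have H0 : 0 <= moserH n c by rewrite mulr_ge0 ?powR_ge0// addr_ge0// invr_ge0 ltW.
have GB0 : 0 <= moserG n phi * (B / V) by apply: mulr_ge0 => //; exact: ltW.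
have fin : w `^ (kap ^+ K) <= (moserH n c * (moserG n phi * (B / V))) `^ (kap ^+ K).
  rewrite (powRM _ H0 GB0).
  apply: le_trans (_ : (2 ^+ (K + 4)) `^ (n + 2) / c * Y K <= _); last first.
    by apply: ler_pM => //; rewrite divr_ge0 ?powR_ge0// ltW.
  have -> : (2 ^+ (K + 4)) `^ (n + 2) / c * Y K =
     ((2 ^+ (K + 4)) `^ (n + 2) / (c * V * r ^+ 2)) * I K.
    by rewrite /Y; field; rewrite !gt_eqF ?powR_gt0.
  have cvr : 0 < c * V * r ^+ 2 by rewrite !mulr_gt0.
  apply: le_trans (ler_wpM2l _ low); last by rewrite divr_ge0 ?powR_ge0// ltW.
  rewrite [leRHS]mulrA ler_peMl ?powR_ge0// mulrAC ler_pdivlMr// mul1r.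
  apply: le_trans (_ : m y * r `^ n * r ^+ 2 <= _); first by rewrite ler_wpM2r ?(ltW r20).
  rewrite -mulrA mulrC ler_wpM2r ?(ltW (m_gt0 y))//.
  rewrite -(powR_mulrn 2 (ltW r0)) -powRD; last by rewrite (gt_eqF r0) implybT.
  by apply: ge0_ler_powR; rewrite ?nnegrE ?exprn_ge0 ?(ltW r0)// addr_ge0// ltW.
have : w <= moserH n c * (moserG n phi * (B / V)).
  rewrite leNgt; apply/negP => lt.
  have : (moserH n c * (moserG n phi * (B / V))) `^ (kap ^+ K) < w `^ (kap ^+ K).
    by apply: gt0_ltr_powR; rewrite ?exprn_gt0 ?nnegrE//; apply: mulr_ge0.
  by rewrite ltNge fin.
rewrite /w exprMn -expRM_natr => hw.
have {}hw := ler_wpM2l (expR_ge0 2) hw.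
have e : expR 2 * (expR (-1 * 2) * u0 ^+ 2) = u0 ^+ 2.
  by rewrite mulrA -expRD mulN1r subrr expR0 mul1r.
by move: hw; rewrite e /mvC !mulrA.
Qed.

End Subsolutions.

(** * Weighted norms of the heat kernel *)

Lemma mvC_ge0 (R : realType) (n phi c : R) : 0 < c -> 0 <= mvC n phi c.
Proof.
move=> c0; rewrite mulr_ge0 ?expR_ge0// mulr_ge0//; last by rewrite mulr_ge0 ?powR_ge0.
by rewrite mulr_ge0 ?powR_ge0// addr_ge0// invr_ge0 ltW.
Qed.

Section WeightedKernel.
Variables (R : realType) (X : eqType) (b : X -> X -> R) (m : X -> R) (D : seq X).
Hypothesis b_ge0 : forall x y, 0 <= b x y.
Hypothesis b_sym : forall x y, b x y = b y x.
Hypothesis m_gt0 : forall x, 0 < m x.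
Hypothesis b_le : forall x, \sum_(y <- D) b x y <= m x.
Hypothesis D_uniq : uniq D.
Let U := heat b m (fun _ => D).

Definition dirac_at (y x : X) : R := (x == y)%:R / m y.

Lemma dirac_bounded y x : `|dirac_at y x| <= (m y)^-1.
Proof.
rewrite /dirac_at; case: (x == y); rewrite ?mul0r ?mul1r ?normr0 ?invr_ge0 ?(ltW (m_gt0 y))//.
by rewrite ger0_norm// invr_ge0 ltW.
Qed.

Lemma dirac_ge0 y x : 0 <= dirac_at y x.
Proof. by rewrite divr_ge0// ltW. Qed.

Lemma sum_dirac y (f : X -> R) : y \in D -> \sum_(x <- D) m x * (dirac_at y x * f x) = f y.
Proof.
move=> yD; rewrite (bigD1_seq y)//= big1_seq ?addr0; last first.
  by move=> x /andP[/negPf xy _]; rewrite /dirac_at xy !mul0r mulr0.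
by rewrite /dirac_at eqxx mul1r mulrA mulfV ?mul1r// gt_eqF.
Qed.

Implicit Types (M t : R).

Lemma heat_dirac M h y t : (forall x, `|h x| <= M) -> 0 <= t -> y \in D ->
  U h t y = \sum_(x <- D) m x * (U (dirac_at y) t x * h x).
Proof.
move=> hM t0 yD; rewrite -(sum_dirac (U h t) yD).
have := ip_heat b_ge0 b_sym m_gt0 b_le 0 hM (dirac_bounded y) t0.
rewrite /ip add0r => e.
transitivity (\sum_(x <- D) m x * (U h t x * dirac_at y x)).
  by apply: eq_bigr => x _; rewrite [dirac_at _ _ * _]mulrC.
rewrite -/U in e; rewrite -e; apply: eq_bigr => x _.
by rewrite [_ * h x]mulrC /U heat0.
Qed.

Lemma heat_dirac_sym x y t : 0 <= t -> x \in D -> y \in D ->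
  U (dirac_at x) t y = \sum_(z <- D) m z * (U (dirac_at x) (t / 2) z * U (dirac_at y) (t / 2) z).
Proof.
move=> t0 xD yD.
have t20 : 0 <= t / 2 by rewrite divr_ge0.
have := ip_heat b_ge0 b_sym m_gt0 b_le (t / 2) (dirac_bounded x) (dirac_bounded y) t20.
have -> : t / 2 + t / 2 = t by field.
rewrite /ip -/U => ->; rewrite -(sum_dirac (U (dirac_at x) t) yD).
by apply: eq_bigr => z _; rewrite [dirac_at _ _ * _]mulrC.
Qed.

(** Lagrange's identity: twice the difference is the double sum of
    [m x m y (f x g y - f y g x)^2]. *)
Lemma cauchy_schwarz (f g : X -> R) :
  (\sum_(x <- D) m x * (f x * g x)) ^+ 2 <=
  (\sum_(x <- D) m x * f x ^+ 2) * (\sum_(x <- D) m x * g x ^+ 2).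
Proof.
rewrite -subr_ge0 -(@pmulr_rge0 _ 2)//.
set F := \sum_(x <- D) m x * f x ^+ 2; set G := \sum_(x <- D) m x * g x ^+ 2.
set H := \sum_(x <- D) _.
have -> : 2 * (F * G - H ^+ 2) =
   \sum_(x <- D) \sum_(y <- D) m x * m y * (f x * g y - f y * g x) ^+ 2.
  have e1 : \sum_(x <- D) \sum_(y <- D) (m x * f x ^+ 2) * (m y * g y ^+ 2) = F * G.
    by rewrite mulr_suml; apply: eq_bigr => x _; rewrite mulr_sumr.
  have e2 : \sum_(x <- D) \sum_(y <- D) (m x * g x ^+ 2) * (m y * f y ^+ 2) = G * F.
    by rewrite mulr_suml; apply: eq_bigr => x _; rewrite mulr_sumr.
  have e3 : \sum_(x <- D) \sum_(y <- D) (m x * (f x * g x)) * (m y * (f y * g y)) = H * H.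
    by rewrite mulr_suml; apply: eq_bigr => x _; rewrite mulr_sumr.
  transitivity (F * G + G * F - 2 * (H * H)); first by ring.
  rewrite -e1 -e2 -e3 mulr_sumr -big_split -sumrB /=; apply: eq_bigr => x _.
  rewrite mulr_sumr -big_split -sumrB /=; apply: eq_bigr => y _; ring.
apply: sumr_ge0 => x _; apply: sumr_ge0 => y _.
by rewrite mulr_ge0 ?sqr_ge0// mulr_ge0// ltW.
Qed.

Variables (om : X -> R) (lam l0 : R).
Hypothesis lam0 : 0 <= lam.
Hypothesis om_lip : forall x y, 0 < b x y -> `|om x - om y| <= lam.
Hypothesis hQ : forall w, l0 * ip m D w w <= Qf b m D w.

Definition wnorm (y : X) (s : R) : R :=
  \sum_(x <- D) m x * (expR (2 * om x) * U (dirac_at y) s x ^+ 2).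

(** Davies' estimate with weight [- om], started at a point mass. It serves the regime where the
    radius for the mean value inequality would fall below [R1]. *)
Lemma wnorm_le (y : X) (s : R) : 0 <= s -> y \in D ->
  wnorm y s <= (m y)^-1 * expR (2 * (cosh1 lam - 1 - l0) * s) * expR (2 * om y).
Proof.
move=> s0 yD.
have lipN x z : 0 < b x z -> `|(- om x) - (- om z)| <= lam.
  by move=> /om_lip; rewrite -opprD normrN.
have := davies b_ge0 b_sym m_gt0 b_le (om := fun x => - om x) lam0 lipN hQ (dirac_bounded y) (dirac_ge0 y) s0.
have -> : \sum_(x <- D) m x * (expR (-2 * - om x) * dirac_at y x ^+ 2) = (m y)^-1 * expR (2 * om y).
  have -> : (m y)^-1 = dirac_at y y by rewrite /dirac_at eqxx mul1r.
  rewrite [RHS]mulrC -(sum_dirac (fun x => expR (2 * om x) * dirac_at y x) yD).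
  by apply: eq_bigr => x _; rewrite mulrNN; ring.
move=> h; apply: le_trans (le_trans _ h) _.
  by rewrite le_eqVlt; apply/orP; left; apply/eqP; apply: eq_bigr => x _; rewrite mulrNN.
by rewrite mulrA [X in _ <= X * _]mulrC.
Qed.

(** Duality: with [h = e^(2 om) p_s(y, .)] on [D], symmetry gives [U h s y = N] for [N = wnorm y s],
    while Davies' estimate controls [U h] by the sum of [m e^(-2 om) h^2], which is again [N]. The
    mean value inequality thus reads [N^2 <= C N]. *)
Lemma wnorm_moser (rho : X -> R) (n phi c r V s : R) (y : X) :
  2 < n -> 0 < phi -> 0 < c -> 8 <= r -> 0 < V -> 0 <= l0 -> 
  (forall x y, 0 < b x y -> `|rho x - rho y| <= 1) ->
  sobolev_on b m D rho (phi * r ^+ 2 / V `^ (2 / n)) r n ->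
  y \in D -> rho y <= 0 -> c * V <= m y * r `^ n -> r ^+ 2 < s + 1 -> 0 <= s ->
  (forall x, om x <= om y + lam * rho x) ->
  wnorm y s <= mvC n phi c / V *
    expR (2 * (lam * r) + 2 * ((cosh1 lam - 1) * (s + 1)) - 2 * (l0 * (s + 1 - r ^+ 2))) * expR (2 * om y).
Proof.
move=> hn phi0 c0 r8 V0 l00 hrho hsob yD hy hm hs s0 hom.
have r0 : 0 < r by lra.
set E := expR (_ + _ - _).
have cosh1_ge1 : 1 <= cosh1 lam.
  have := @cosh_mono R 0 lam; rewrite normr0 oppr0 expR0 /cosh1 ler_pdivlMr// mul1r.
  by rewrite -natr1; apply.
pose k := U (dirac_at y) s.
have k0 x : 0 <= k x by apply: (heat_ge0 b_ge0 m_gt0 b_le x (dirac_bounded y) (dirac_ge0 y) s0).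
pose h x := if x \in D then expR (2 * om x) * k x else 0.
have h0 x : 0 <= h x by rewrite /h; case: ifP => // _; rewrite mulr_ge0 ?expR_ge0.
pose M := \sum_(x <- D) h x.
have hM x : `|h x| <= M.
  rewrite ger0_norm//; have [xD|xD] := boolP (x \in D); last first.
    by rewrite /h (negPf xD) sumr_ge0.
  by rewrite /M (big_rem x)//= lerDl sumr_ge0.
(* Subsolutions must be strictly positive, hence [h + e]; the shift [e] is sent to [0] in [lim]. *)
have key e : 0 < e -> U h s y ^+ 2 <=
   mvC n phi c / V * E * expR (2 * om y) * \sum_(x <- D) m x * (expR (- 2 * om x) * (h x + e) ^+ 2).
  move=> e0; pose g x := h x + e.
  have g0 x : 0 < g x by rewrite ltr_wpDl.
  have gM x : `|g x| <= M + e.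
    by rewrite (le_trans (ler_normD _ _))// lerD// ger0_norm// ltW.
  have hg : U h s y <= U g s y.
    rewrite (heat_dirac hM)// (heat_dirac gM)//; apply: ler_sum => x _.
    by rewrite ler_wpM2l ?(ltW (m_gt0 x))// ler_wpM2l// lerDl ltW.
  have Uh0 : 0 <= U h s y by apply: (heat_ge0 b_ge0 m_gt0 b_le y hM h0 s0).
  apply: le_trans (_ : U g s y ^+ 2 <= _); first by rewrite lerXn2r ?nnegrE//; apply: le_trans hg.
  set W := \sum_(x <- D) _.
  have W0 : 0 <= W.
    by apply: sumr_ge0 => x _; rewrite mulr_ge0 ?(ltW (m_gt0 x))// mulr_ge0 ?expR_ge0 ?sqr_ge0.
  (* Applied at time [s + 1]: on [[s, s + 1]] the growth of [e^t u] gives [u t >= e^(-1) u s]. *)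
  have := @mean_value R X b m D b_ge0 b_sym m_gt0 b_le rho n phi c r V (s + 1)
     (E * expR (2 * om y) * W) (U g s y) _ _ y hn phi0 c0 r8 V0 hrho hsob (subsol_heat b_ge0 m_gt0 b_le gM g0)
     yD hy hm hs.
  have -> : mvC n phi c * (E * expR (2 * om y) * W / V) = mvC n phi c / V * E * expR (2 * om y) * W by ring.
  apply.
  - move=> t /andP[t1 t2]; have t0 : 0 <= t by lra.
    have dv := davies b_ge0 b_sym m_gt0 b_le lam0 om_lip hQ gM (fun x => ltW (g0 x)) t0.
    rewrite -/W -/U in dv.
    apply: le_trans (_ : expR (2 * om y + 2 * (lam * r)) * \sum_(x <- D) m x * (expR (- 2 * om x) * U g t x ^+ 2) <= _).
      rewrite big_mkcond mulr_sumr /=; apply: ler_sum => x _.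
      case: ifP => hx; last by rewrite mulr_ge0 ?expR_ge0// mulr_ge0 ?(ltW (m_gt0 x))// mulr_ge0 ?expR_ge0 ?sqr_ge0.
      rewrite [leRHS]mulrCA ler_wpM2l ?(ltW (m_gt0 x))// [leRHS]mulrA -expRD ler_peMl ?sqr_ge0//.
      rewrite -[X in X <= _]expR0 ler_expR.
      have : lam * rho x <= lam * r by rewrite ler_wpM2l.
      have := hom x; lra.
    apply: le_trans (ler_wpM2l (expR_ge0 _) dv) _.
    rewrite [leLHS]mulrA ler_wpM2r// /E -!expRD ler_expR.
    have e1 : (cosh1 lam - 1) * t <= (cosh1 lam - 1) * (s + 1) by rewrite ler_wpM2l// subr_ge0.
    have e2 : l0 * (s + 1 - r ^+ 2) <= l0 * t by rewrite ler_wpM2l//.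
    move: e1 e2; lra.
  - by apply: (heat_ge0 b_ge0 m_gt0 b_le y gM (fun x => ltW (g0 x)) s0).
  - move=> t /andP[]; rewrite addrK => t1 t2.
    apply: le_trans (heat_growth b_ge0 m_gt0 b_le y gM (fun x => ltW (g0 x)) s0 t1).
    rewrite ler_wpM2r ?ler_expR//; last by lra.
    by apply: (heat_ge0 b_ge0 m_gt0 b_le y gM (fun x => ltW (g0 x)) s0).
have eN : U h s y = wnorm y s.
  rewrite (heat_dirac hM)// /wnorm !big_seq; apply: eq_bigr => x xD.
  by rewrite /h xD -/U -/k; ring.
set C := mvC n phi c / V * E * expR (2 * om y) in key *.
have C0 : 0 <= C.
  do 2! (apply: mulr_ge0; last exact: expR_ge0).
  by apply: divr_ge0; [exact: mvC_ge0|exact: ltW].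
set a1 := \sum_(x <- D) m x * (expR (- 2 * om x) * (2 * h x)).
set a2 := \sum_(x <- D) m x * expR (- 2 * om x).
have eW e : \sum_(x <- D) m x * (expR (- 2 * om x) * (h x + e) ^+ 2) = wnorm y s + e * a1 + e ^+ 2 * a2.
  rewrite /wnorm /a1 /a2 !mulr_sumr -!big_split /= !big_seq; apply: eq_bigr => x xD.
  have -> : expR (2 * om x) * U (dirac_at y) s x ^+ 2 = expR (- 2 * om x) * h x ^+ 2.
    rewrite /h xD -/(k x); move: (k x) => z; rewrite exprMn -expRM_natl !mulrA -expRD.
    by congr (expR _ * _ * _); ring.
  ring.
have N0 : 0 <= wnorm y s by rewrite -eN; apply: (heat_ge0 b_ge0 m_gt0 b_le y hM h0 s0).
have lim : wnorm y s ^+ 2 <= C * wnorm y s.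
  apply/ler_addgt0Pr => e e0.
  have a10 : 0 <= a1 by apply: sumr_ge0 => x _; rewrite mulr_ge0 ?(ltW (m_gt0 x))// mulr_ge0 ?expR_ge0// mulr_ge0.
  have a20 : 0 <= a2 by apply: sumr_ge0 => x _; rewrite mulr_ge0 ?(ltW (m_gt0 x))// expR_ge0.
  pose q := C * (a1 + a2) + 1; have q1 : 1 <= q by rewrite lerDr mulr_ge0// addr_ge0.
  have q0 : 0 < q by lra.
  pose d := Num.min 1 (e / q).
  have d0 : 0 < d by rewrite lt_min ltr01 divr_gt0.
  have d1 : d <= 1 by rewrite ge_min lexx.
  have d2 : d * q <= e by rewrite -ler_pdivlMr// ge_min lexx orbT.
  have := key d d0; rewrite eN eW => h1; apply: le_trans h1 _.
  have : d ^+ 2 * a2 <= d * a2 by rewrite ler_wpM2r// expr2 ler_piMr// ltW.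
  move=> /(ler_wpM2l C0); have := d2; rewrite /q; have := ltW d0; lra.
have [->|nN] := eqVneq (wnorm y s) 0; first exact: C0.
by rewrite -(@ler_pM2r _ (wnorm y s)) -?expr2// lt_neqAle eq_sym nN.
Qed.

End WeightedKernel.

Lemma heat_dirac_le (R : realType) (X : eqType) (b : X -> X -> R) (m : X -> R) (D : seq X)
   (om : X -> R) (Kx Ky t : R) (x y : X) :
  (forall x y, 0 <= b x y) -> (forall x y, b x y = b y x) -> (forall x, 0 < m x) ->
  (forall x, \sum_(y <- D) b x y <= m x) -> uniq D -> 0 <= t -> x \in D -> y \in D ->
  0 <= Kx -> 0 <= Ky ->
  wnorm b m D om x (t / 2) <= Kx * expR (2 * om x) ->
  wnorm b m D (fun z => - om z) y (t / 2) <= Ky * expR (2 * - om y) ->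
  heat b m (fun _ => D) (dirac_at m x) t y <= Num.sqrt (Kx * Ky) * expR (om x - om y).
Proof.
move=> b0 bs m0 bl Du t0 xD yD K1 K2 h1 h2.
rewrite (heat_dirac_sym b0 bs m0 bl Du t0 xD yD).
set U := heat _ _ _.
have := cauchy_schwarz D m0 (fun z => expR (om z) * U (dirac_at m x) (t / 2) z)
   (fun z => expR (- om z) * U (dirac_at m y) (t / 2) z).
set S := (X in _ -> X <= _).
have -> : \sum_(z <- D) m z * (expR (om z) * U (dirac_at m x) (t / 2) z * (expR (- om z) * U (dirac_at m y) (t / 2) z)) = S.
  by apply: eq_bigr => z _; rewrite mulrACA -expRD subrr expR0 mul1r.
have -> : \sum_(z <- D) m z * (expR (om z) * U (dirac_at m x) (t / 2) z) ^+ 2 = wnorm b m D om x (t / 2).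
  by apply: eq_bigr => z _; rewrite exprMn -expRM_natl.
have -> : \sum_(z <- D) m z * (expR (- om z) * U (dirac_at m y) (t / 2) z) ^+ 2 = wnorm b m D (fun z => - om z) y (t / 2).
  by apply: eq_bigr => z _; rewrite exprMn -expRM_natl.
move=> h.
have wn0 o z : 0 <= wnorm b m D o z (t / 2).
  by apply: sumr_ge0 => u _; rewrite mulr_ge0 ?(ltW (m0 u))// mulr_ge0 ?expR_ge0 ?sqr_ge0.
have {}h := le_trans h (ler_pM (wn0 _ _) (wn0 _ _) h1 h2).
apply: le_trans (ler_norm _) _.
rewrite -sqrtr_sqr -[leRHS]ger0_norm ?mulr_ge0 ?sqrtr_ge0 ?expR_ge0// -sqrtr_sqr.
apply: ler_wsqrtr; apply: le_trans h _.
rewrite exprMn sqr_sqrtr ?mulr_ge0// -expRM_natl mulrACA -expRD.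
by rewrite le_eqVlt; apply/orP; left; apply/eqP; congr (_ * expR _); ring.
Qed.

(** * From Nash to Sobolev inequalities *)

Section NashSobolev.
Variables (R : realType) (X : eqType) (b : X -> X -> R) (m : X -> R) (D : seq X).
Hypothesis b_ge0 : forall x y, 0 <= b x y.
Hypothesis b_sym : forall x y, b x y = b y x.
Hypothesis m_gt0 : forall x, 0 < m x.
Hypothesis b_le : forall x, \sum_(y <- D) b x y <= m x.
Variables (n r K : R).
Hypothesis hn : 2 < n.
Hypothesis r0 : 0 < r.
Hypothesis K0 : 0 < K.

Definition energy (f : X -> R) : R := 2 * Qf b m D f + ip m D f f / r ^+ 2.

Hypothesis nash : forall (f : X -> R) (t : R), (forall x, 0 <= f x) -> 0 < t ->
  ip m D f f <= t * energy f + K * t `^ (- (n / 2)) * (\sum_(x <- D) m x * f x) ^+ 2.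

Let q := 2 * n / (n - 2).

(** Zero-order part of the energy: mass leaving [D] plus the [1/r^2] term. With it [energyE] is a
    nonnegative combination of squared differences and squared values, the form in which cutting [f]
    into slices can be controlled. *)
Definition kill (x : X) : R := 2 * (m x - \sum_(y <- D) b x y) + m x / r ^+ 2.

Lemma kill_ge0 x : 0 <= kill x.
Proof.
by rewrite addr_ge0 ?mulr_ge0 ?subr_ge0// ?invr_ge0 ?sqr_ge0// ltW.
Qed.

Lemma energyE f : energy f =
  \sum_(x <- D) \sum_(y <- D) b x y * (f x - f y) ^+ 2 + \sum_(x <- D) kill x * f x ^+ 2.
Proof.
have e1 : \sum_(x <- D) \sum_(y <- D) b x y * (f x - f y) ^+ 2 =
   2 * \sum_(x <- D) (\sum_(y <- D) b x y) * f x ^+ 2 - 2 * bf b D f f.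
  have -> : 2 * \sum_(x <- D) (\sum_(y <- D) b x y) * f x ^+ 2 =
      \sum_(x <- D) \sum_(y <- D) b x y * (f x ^+ 2 + f y ^+ 2).
    have e x : (\sum_(y <- D) b x y) * f x ^+ 2 = \sum_(y <- D) b x y * f x ^+ 2 by rewrite mulr_suml.
    rewrite (eq_bigr _ (fun x _ => e x)) mulr_natl mulr2n {2}exchange_big /= -big_split /=.
    apply: eq_bigr => x _; rewrite -big_split /=; apply: eq_bigr => y _.
    by rewrite (b_sym y x) mulrDr.
  rewrite /bf mulr_sumr -sumrB; apply: eq_bigr => x _.
  rewrite mulr_sumr -sumrB; apply: eq_bigr => y _; ring.
rewrite e1 /energy /Qf /ip.
have -> : \sum_(x <- D) kill x * f x ^+ 2 =
   2 * \sum_(x <- D) m x * (f x * f x) - 2 * \sum_(x <- D) (\sum_(y <- D) b x y) * f x ^+ 2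
   + (\sum_(x <- D) m x * (f x * f x)) / r ^+ 2.
  rewrite !mulr_sumr mulr_suml -sumrB -big_split /=; apply: eq_bigr => x _.
  rewrite /kill; ring.
ring.
Qed.

Lemma energy_ge0 f : 0 <= energy f.
Proof.
rewrite energyE addr_ge0//; first by do 2! (apply: sumr_ge0 => ? _); rewrite mulr_ge0 ?sqr_ge0.
by apply: sumr_ge0 => x _; rewrite mulr_ge0 ?kill_ge0 ?sqr_ge0.
Qed.

Lemma sumsqr_le (I : Type) (s : seq I) (d : I -> R) : (forall i, 0 <= d i) ->
  \sum_(i <- s) d i ^+ 2 <= (\sum_(i <- s) d i) ^+ 2.
Proof.
move=> d0; elim: s => [|i s IH]; first by rewrite !big_nil expr0n.
rewrite !big_cons; have : 0 <= \sum_(j <- s) d j by apply: sumr_ge0.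
have := d0 i; move: IH; set S2 := \sum_(j <- s) d j ^+ 2; set S := \sum_(j <- s) d j.
move=> IH di S0; have : 0 <= d i * S by rewrite mulr_ge0.
have -> : (d i + S) ^+ 2 = d i ^+ 2 + 2 * (d i * S) + S ^+ 2 by ring.
lra.
Qed.

Definition slice (l : nat -> R) (k : nat) (s : R) : R := Num.min s (l k.+1) - Num.min s (l k).

(** All slice increments have the same sign and telescope to at most [s - s'] in size, so the sum of
    their squares is at most the square of their sum. *)
Lemma slice_sqr (l : nat -> R) (N : nat) (s s' : R) : (forall k, l k <= l k.+1) ->
  \sum_(0 <= k < N) (slice l k s - slice l k s') ^+ 2 <= (s - s') ^+ 2.
Proof.
move=> hl; wlog ss : s s' / s' <= s.
  move=> H; have [h|/ltW h] := leP s' s; first exact: H.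
  rewrite -sqrrN opprB; apply: le_trans (H _ _ h).
  by apply: ler_sum => k _; rewrite -sqrrN opprB.
have d0 k : 0 <= slice l k s - slice l k s'.
  rewrite /slice; have := hl k.
  by case: (lerP s (l k.+1)) => ?; case: (lerP s (l k)) => ?; case: (lerP s' (l k.+1)) => ?;
   case: (lerP s' (l k)) => ?; lra.
apply: le_trans (sumsqr_le _ d0) _.
rewrite lerXn2r ?nnegrE ?subr_ge0// ?sumr_ge0//.
rewrite sumrB /slice telescope_sumr// telescope_sumr//.
have h1 : Num.min s (l N) - Num.min s' (l N) <= s - s'.
  by case: (lerP s (l N)) => ?; case: (lerP s' (l N)) => ?; lra.
have h2 : Num.min s' (l 0%N) <= Num.min s (l 0%N).
  by case: (lerP s (l 0%N)) => ?; case: (lerP s' (l 0%N)) => ?; lra.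
lra.
Qed.

Lemma energy_slices (l : nat -> R) N f : (forall x, 0 <= f x) -> (forall k, 0 <= l k) ->
  (forall k, l k <= l k.+1) ->
  \sum_(0 <= k < N) energy (fun x => slice l k (f x)) <= energy f.
Proof.
move=> f0 l0 hl; under eq_bigr do rewrite energyE.
rewrite big_split energyE /=; apply: lerD.
  rewrite exchange_big /=; apply: ler_sum => x _; rewrite exchange_big /=; apply: ler_sum => y _.
  by rewrite -mulr_sumr ler_wpM2l// slice_sqr.
rewrite exchange_big /=; apply: ler_sum => x _; rewrite -mulr_sumr ler_wpM2l ?kill_ge0//.
rewrite -[X in _ <= X ^+ 2]subr0; apply: le_trans (slice_sqr _ _ _ hl).
by apply: ler_sum => k _; rewrite /slice !(@min_l _ _ 0)// subrr subr0.
Qed.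

(** [4 = 2^(q (1 - 2/n))] comes from comparing the sum of [f^q] with its dyadic levels, [2^(q+2)]
    from absorbing the small term, and its power [2/n] from the choice of [t] in [nash_level]. *)
Definition nashC : R := 4 * 2 `^ (q + 2) * (2 `^ (q + 2)) `^ (2 / n).

(** [t] is chosen so that [K t^(-n/2) = 2^(-(q+2)) / a], which makes the [l1] term a small multiple
    of [l^2 a]. Multiplying by [l^(q-2)] turns [t] into a multiple of a power of [l^q a], because
    [q - 2 = 2q/n]. For [a = 0] this [t] would be [0], hence the separate case. *)
Lemma nash_level (f : X -> R) (l a a' : R) : (forall x, 0 <= f x) -> 0 < l -> 0 <= a -> 0 <= a' ->
  (a = 0 -> a' = 0) ->
  l ^+ 2 * a' <= ip m D f f -> \sum_(x <- D) m x * f x <= l * a ->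
  2 `^ (- q) * ((2 * l) `^ q * a') <=
  (K * 2 `^ (q + 2)) `^ (2 / n) * (l `^ q * a) `^ (2 / n) * energy f + 2 `^ (- (q + 2)) * (l `^ q * a).
Proof.
move=> f0 l0 a0 a'0 aa h1 h2.
have n0 : 0 < n by apply: lt_trans hn.
have q0 : 0 < q by rewrite divr_gt0 ?mulr_gt0// subr_gt0.
have lq : 0 < l `^ q by rewrite powR_gt0.
have th0 : 0 < 2 `^ (q + 2) :> R by rewrite powR_gt0.
rewrite powRM ?(ltW l0)// !mulrA -powRD ?pnatr_eq0 ?implybT// addNr powRr0 mul1r.
have [az|an] := eqVneq a 0.
  rewrite (aa az) az !mulr0 powR0 ?mulr0 ?mul0r ?addr0//.
  by rewrite mulf_neq0 ?invr_eq0 ?gt_eqF.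
have ap : 0 < a by rewrite lt_neqAle eq_sym an.
pose t := (K * a * 2 `^ (q + 2)) `^ (2 / n).
have kap : 0 < K * a * 2 `^ (q + 2) by rewrite !mulr_gt0.
have t0 : 0 < t by rewrite powR_gt0.
have et : K * t `^ (- (n / 2)) = 2 `^ (- (q + 2)) / a.
  rewrite /t -powRrM (_ : 2 / n * _ = -1); last by field; rewrite gt_eqF.
  rewrite powR_inv1 ?(ltW kap)// powRN; field; rewrite !gt_eqF//.
have := nash f0 t0; rewrite et => h3.
have h4 : l ^+ 2 * a' <= t * energy f + 2 `^ (- (q + 2)) * (l ^+ 2 * a).
  apply: le_trans h1 (le_trans h3 _); rewrite lerD2l.
  apply: le_trans (_ : 2 `^ (- (q + 2)) / a * (l * a) ^+ 2 <= _).
    rewrite ler_wpM2l ?divr_ge0 ?powR_ge0//.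
    by rewrite lerXn2r ?nnegrE// ?mulr_ge0 ?(ltW l0)// sumr_ge0// => x _; rewrite mulr_ge0// ltW.
  by rewrite le_eqVlt; apply/orP; left; apply/eqP; field; rewrite gt_eqF.
have lE : l `^ q = l `^ (q - 2) * l ^+ 2.
  by rewrite -powR_mulrn ?(ltW l0)// -powRD ?subrK// (gt_eqF l0) implybT.
have tE : (K * 2 `^ (q + 2)) `^ (2 / n) * (l `^ q * a) `^ (2 / n) = l `^ (q - 2) * t.
  rewrite /t -powRM ?mulr_ge0 ?(ltW K0) ?(ltW th0) ?(ltW lq)//.
  have -> : l `^ (q - 2) = (l `^ q) `^ (2 / n).
    rewrite -powRrM; congr (_ `^ _); rewrite /q; field; rewrite subr_eq0 !gt_eqF//.
  by rewrite -powRM ?(ltW lq) ?(ltW kap)//; congr (_ `^ _); ring.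
rewrite tE lE; have := ler_wpM2l (powR_ge0 l (q - 2)) h4; rewrite mulrDr; move=> h.
apply: le_trans (le_trans h _); rewrite le_eqVlt; apply/orP; left; apply/eqP; ring.
Qed.

(** The factor two makes the level sets at [e] and [2 e] coincide, whence [c_0 <= c_1] in the dyadic
    sum below. *)
Lemma pos_lower_bound (f : X -> R) : exists2 e : R, 0 < e & forall x, x \in D -> 0 < f x -> 2 * e <= f x.
Proof.
elim: D => [|x s [e e0 He]]; first by exists 1.
have [fx|fx] := ltP 0 (f x); last first.
  exists e => // z; rewrite inE => /orP[/eqP->|]; last exact: He.
  by rewrite ltNge fx.
exists (Num.min e (f x / 2)); first by rewrite lt_min e0 divr_gt0.
move=> z; rewrite inE => /orP[/eqP-> _|zs fz].
  by rewrite mulrC -ler_pdivlMr// ge_min lexx orbT.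
by apply: le_trans (He _ zs fz); rewrite ler_pM2l// ge_min lexx.
Qed.

(* Cut [f] at the levels [l_k = e 2^k].  The slices have total energy at most that of [f], and
   with [c_k = l_k^q m(f >= l_k)] the Nash inequality bounds [c_(k+1)] by a multiple of
   [c_k^(2/n)] times the energy of the [k]-th slice plus a small multiple of [c_k], which the
   left-hand side absorbs after summation. *)
Lemma nash_sobolev (f : X -> R) : (forall x, 0 <= f x) ->
  (\sum_(x <- D) m x * f x `^ q) `^ (1 - 2 / n) <= nashC * K `^ (2 / n) * energy f.
Proof.
move=> f0; have n0 : 0 < n by apply: lt_trans hn.
have n2 : 0 < n - 2 by rewrite subr_gt0.
have q0 : 0 < q by rewrite divr_gt0 ?mulr_gt0.
have th1 : 0 < 1 - 2 / n by rewrite subr_gt0 ltr_pdivrMr// mul1r.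
have [e e0 He] := pos_lower_bound f.
have [N HN] : exists N : nat, forall x, x \in D -> f x < e * 2 ^+ N.+1.
  pose M := \sum_(x <- D) f x; exists (Num.Def.archi_bound (M / e)) => x xD.
  have M0 : 0 <= M / e by rewrite divr_ge0 ?(ltW e0)// sumr_ge0.
  rewrite mulrC -ltr_pdivrMr//; apply: le_lt_trans (_ : M / e < _).
    by rewrite ler_wpM2r ?invr_ge0 ?(ltW e0)// /M (big_rem x)//= lerDl sumr_ge0.
  apply: lt_trans (archi_boundP M0) _.
  by rewrite -natrX ltr_nat (ltn_trans (ltnSn _))// ltn_expl.
pose l k : R := e * 2 ^+ k.
have lS k : l k.+1 = 2 * l k by rewrite /l exprS; ring.
have lp k : 0 < l k by rewrite mulr_gt0 ?exprn_gt0.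
have lmono k : l k <= l k.+1 by rewrite lS; have := lp k; lra.
pose a k := \sum_(x <- D | l k <= f x) m x.
have a0 k : 0 <= a k by apply: sumr_ge0 => x _; exact: ltW.
have aS k : a k.+1 <= a k.
  rewrite /a big_mkcond [leRHS]big_mkcond /=; apply: ler_sum => x _.
  case: ifP => h1; case: ifP => h2 //; last exact: ltW.
  by move/negP: h2; case; apply: le_trans h1.
pose c k := l k `^ q * a k.
have c0 k : 0 <= c k by rewrite mulr_ge0 ?powR_ge0.
have level k : 2 `^ (- q) * c k.+1 <=
   (K * 2 `^ (q + 2)) `^ (2 / n) * c k `^ (2 / n) * energy (fun x => slice l k (f x)) + 2 `^ (- (q + 2)) * c k.
  rewrite /c lS; apply: nash_level => //.
  - by move=> x; rewrite /slice; have := lmono k; case: (lerP (f x) (l k.+1)) => ?; case: (lerP (f x) (l k)) => ?; lra.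
  - by move=> ak; apply/le_anti; rewrite a0 -ak aS.
  - rewrite /a /ip mulr_sumr big_mkcond /=; apply: ler_sum => x _; case: ifP => h.
      rewrite mulrC ler_wpM2l ?(ltW (m_gt0 x))// /slice min_r// min_r; last by apply: le_trans h.
      by rewrite lS expr2; have -> : 2 * l k - l k = l k by ring.
    by rewrite mulr_ge0 ?(ltW (m_gt0 x))// -expr2 sqr_ge0.
  - rewrite /a mulr_sumr [leRHS]big_mkcond /=; apply: ler_sum => x _; case: ifP => h.
      rewrite mulrC ler_wpM2r ?(ltW (m_gt0 x))// /slice (@min_r _ _ (f x) (l k))// lS lerBlDr.
      by apply: le_trans (_ : 2 * l k <= _); [rewrite ge_min lexx orbT|lra].
    move/negbT: h; rewrite -ltNge => h; rewrite /slice !min_l ?subrr ?mulr0//; first exact: ltW.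
    by apply: le_trans (ltW h) (lmono k).
pose Cs := \sum_(0 <= k < N.+2) c k.
have Cs0 : 0 <= Cs by apply: sumr_ge0.
have cCs k : (k < N.+2)%N -> c k <= Cs.
  move=> hk; rewrite /Cs (big_rem k) /=; last by rewrite mem_index_iota leq0n.
  by rewrite lerDl sumr_ge0.
have c01 : c 0%N <= c 1%N.
  rewrite /c; have -> : a 0%N = a 1%N :> R.
    rewrite /a [LHS]big_mkcond [RHS]big_mkcond /= !big_seq; apply: eq_bigr => x xD.
    congr (if _ then _ else _); apply/idP/idP => h; last by apply: le_trans h.
    by rewrite /l expr1 mulrC; apply: He => //; apply: lt_le_trans h.
  rewrite ler_wpM2r//.
  by apply: ge0_ler_powR; rewrite ?nnegrE ?(ltW q0) ?(ltW (lp _)).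
pose S1 := \sum_(0 <= k < N.+1) c k.+1.
have CsE : Cs = c 0%N + S1 by rewrite /Cs big_nat_recl.
have Cs2 : Cs <= 2 * S1.
  have : c 1%N <= S1 by rewrite /S1 big_nat_recl//= lerDl sumr_ge0.
  rewrite CsE; lra.
set Kc := (K * 2 `^ (q + 2)) `^ (2 / n) in level *.
have Kc0 : 0 <= Kc by apply: powR_ge0.
have p2 : 0 < 2 `^ (- q) :> R by rewrite powR_gt0.
have p4 : 2 `^ (- (q + 2)) = 2 `^ (- q) / 4 :> R.
  rewrite opprD powRD ?pnatr_eq0 ?implybT//; congr (_ * _).
  by rewrite powRN powR_mulrn// -natrX.
have sumlev : 2 `^ (- q) * S1 <= Kc * Cs `^ (2 / n) * energy f + 2 `^ (- (q + 2)) * Cs.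
  rewrite /S1 mulr_sumr.
  apply: le_trans (_ : \sum_(0 <= k < N.+1) (Kc * Cs `^ (2 / n) * energy (fun x => slice l k (f x))
     + 2 `^ (- (q + 2)) * c k) <= _).
    rewrite !big_nat; apply: ler_sum => k hk; apply: le_trans (level k) _.
    rewrite lerD2r ler_wpM2r ?energy_ge0// ler_wpM2l//.
    apply: ge0_ler_powR; rewrite ?nnegrE ?divr_ge0 ?(ltW n0)//.
    by apply: cCs; apply: ltnW; rewrite !ltnS in hk *; exact: hk.
  rewrite big_split /= -!mulr_sumr; apply: lerD.
    by rewrite ler_wpM2l ?mulr_ge0 ?powR_ge0// energy_slices// => k; exact: ltW.
  by rewrite ler_wpM2l ?powR_ge0// /Cs [leRHS]big_nat_recr//= lerDl.
(* Here the extra factor [1/4] in [2^(-(q+2))] pays off: [2^(-q) S1 >= 2^(-q) Cs / 2], and half of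
   this absorbs the last term of [sumlev]. *)
have CsK : Cs <= 2 `^ (q + 2) * (Kc * Cs `^ (2 / n) * energy f).
  have : 2 `^ (- (q + 2)) * Cs <= Kc * Cs `^ (2 / n) * energy f.
    have := ler_wpM2l (ltW p2) Cs2; move: sumlev; rewrite p4; lra.
  by rewrite powRN ler_pdivrMl// powR_gt0.
have LS : \sum_(x <- D) m x * f x `^ q <= 2 `^ q * Cs.
  rewrite /Cs mulr_sumr.
  have -> : \sum_(0 <= k < N.+2) 2 `^ q * c k =
     \sum_(x <- D) \sum_(0 <= k < N.+2) (if l k <= f x then m x * (2 * l k) `^ q else 0).
    rewrite exchange_big /=; apply: eq_bigr => k _.
    rewrite /c /a [in LHS]big_mkcond !mulr_sumr /=; apply: eq_bigr => x _; case: ifP => _; last by rewrite !mulr0.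
    by rewrite powRM ?(ltW (lp k))//; ring.
  rewrite !big_seq; apply: ler_sum => x xD.
  have t0 k : 0 <= if l k <= f x then m x * (2 * l k) `^ q else 0.
    by case: ifP => // _; rewrite mulr_ge0 ?powR_ge0// ltW.
  have [->|fn] := eqVneq (f x) 0.
    rewrite powR0 ?gt_eqF// mulr0; apply: sumr_ge0 => k _.
    by case: ifP => // _; rewrite mulr_ge0 ?powR_ge0// ltW.
  have fx : 0 < f x by rewrite lt_neqAle eq_sym fn f0.
  have fl0 : l 0%N <= f x.
    by have := He _ xD fx; rewrite /l expr0 mulr1; lra.
  have [k /andP[k1 k2] kN] : exists2 k, l k <= f x < l k.+1 & (k < N.+2)%N.
    have := HN _ xD; rewrite -/(l N.+1); elim: N.+1 => [|j IH] h; first by move: h; rewrite ltNge fl0.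
    by have [/IH[k ? ?]|h2] := ltP (f x) (l j); [exists k => //; apply: ltnW|exists j; rewrite ?h2].
  rewrite (big_rem k) /=; last by rewrite mem_index_iota.
  rewrite k1; apply: ler_wpDr; first exact: sumr_ge0.
  rewrite ler_wpM2l ?(ltW (m_gt0 x))//; apply: ge0_ler_powR; rewrite ?nnegrE ?(ltW q0)//.
    by rewrite mulr_ge0// ltW.
  by rewrite -lS ltW.
have LS0 : 0 <= \sum_(x <- D) m x * f x `^ q.
  by apply: sumr_ge0 => x _; rewrite mulr_ge0 ?powR_ge0// ltW.
apply: le_trans (_ : (2 `^ q * Cs) `^ (1 - 2 / n) <= _).
  by apply: ge0_ler_powR; rewrite ?nnegrE ?mulr_ge0 ?powR_ge0 ?(ltW th1).
rewrite powRM ?powR_ge0// -powRrM.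
have -> : q * (1 - 2 / n) = 2 by rewrite /q; field; rewrite !gt_eqF.
rewrite powR_mulrn// -natrX [X in X%:R]/=.
have [->|Csn] := eqVneq Cs 0.
  by rewrite powR0 ?(gt_eqF th1)// mulr0 !mulr_ge0 ?powR_ge0 ?energy_ge0.
have Csp : 0 < Cs by rewrite lt_neqAle eq_sym Csn.
rewrite /nashC -!mulrA ler_wpM2l//.
rewrite -(@ler_pM2r _ (Cs `^ (2 / n))) ?powR_gt0// -powRD; last by rewrite Csn implybT.
rewrite subrK powRr1//; apply: le_trans CsK _.
rewrite /Kc powRM ?(ltW K0) ?powR_ge0//.
by rewrite le_eqVlt; apply/orP; left; apply/eqP; ring.
Qed.

End NashSobolev.

(** * Graphs with the normalizing measure *)

Section FiniteSums.
Variables (R : realType) (X : countType).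
Implicit Types (s : seq X) (f g : X -> R).

Lemma esum_seq s g : uniq s -> (forall x, 0 <= g x) -> (forall x, x \notin s -> g x = 0) ->
  \esum_(x in [set: X]) (g x)%:E = (\sum_(x <- s) g x)%:E.
Proof.
move=> us g0 gs.
have -> : \esum_(x in [set: X]) (g x)%:E = \esum_(x in [set` s]) (g x)%:E.
  rewrite [RHS]esum_mkcond; apply: eq_esum => x _; case: ifPn => //.
  by move=> /negP h; rewrite gs//; apply/negP => xs; apply: h; rewrite inE.
rewrite esum_fset//; first by rewrite -fsbig_seq// sumEFin.
exact: finite_seq.
by move=> x _; rewrite lee_fin.
Qed.

Lemma rsum_seq s f : uniq s -> (forall x, x \notin s -> f x = 0) ->
  rsum f = \sum_(x <- s) f x.
Proof.
move=> us fs; rewrite /rsum.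
have e1 : esum [set: X] ((EFin \o f)^\+)%E = (\sum_(x <- s) Num.max (f x) 0)%:E.
  rewrite -esum_seq//.
  - by apply: eq_esum => x _; rewrite funeposE /= EFin_max.
  - by move=> x; rewrite le_max lexx orbT.
  - by move=> x /fs ->; rewrite maxxx.
have e2 : esum [set: X] ((EFin \o f)^\-)%E = (\sum_(x <- s) Num.max (- f x) 0)%:E.
  rewrite -esum_seq//.
  - by apply: eq_esum => x _; rewrite funenegE /= EFin_max.
  - by move=> x; rewrite le_max lexx orbT.
  - by move=> x /fs ->; rewrite oppr0 maxxx.
rewrite e1 e2 -EFinB /= -sumrB; apply: eq_bigr => x _.
by case: (lerP (f x) 0) => h; case: (lerP (- f x) 0) => h'; lra.
Qed.

Lemma sum_supp_eq s s' f : uniq s -> uniq s' -> (forall x, f x != 0 -> x \in s) ->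
  (forall x, f x != 0 -> x \in s') -> \sum_(x <- s) f x = \sum_(x <- s') f x.
Proof.
move=> us us' h h'.
by rewrite -!rsum_seq// => x; apply: contraNeq; [exact: h'|exact: h].
Qed.

Lemma lpnorm_seq (m : X -> R) (p : R) s f : uniq s -> 0 < p -> (forall x, 0 < m x) ->
  (forall x, f x != 0 -> x \in s) ->
  lpnorm m p f = ((\sum_(x <- s) `|f x| `^ p * m x) `^ p^-1)%:E.
Proof.
move=> us p0 m0 fs; rewrite /lpnorm (esum_seq us).
- by rewrite poweR_EFin.
- by move=> x; rewrite mulr_ge0 ?powR_ge0// ltW.
- move=> x /negP xs; have -> : f x = 0 by apply/eqP/negP => /negP /fs.
  by rewrite normr0 powR0 ?mul0r// gt_eqF.
Qed.

Lemma lpnorm2_seq (m : X -> R) s f : uniq s -> (forall x, 0 < m x) ->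
  (forall x, f x != 0 -> x \in s) ->
  (lpnorm m 2 f ^+ 2 = (\sum_(x <- s) m x * f x ^+ 2)%:E)%E.
Proof.
move=> us m0 fs; rewrite (lpnorm_seq us)// -EFin_expe; congr EFin.
have -> : \sum_(x <- s) `|f x| `^ 2 * m x = \sum_(x <- s) m x * f x ^+ 2.
  by apply: eq_bigr => x _; rewrite powR_mulrn// real_normK ?num_real// mulrC.
have h : 0 <= \sum_(x <- s) m x * f x ^+ 2.
  by apply: sumr_ge0 => x _; rewrite mulr_ge0 ?sqr_ge0// ltW.
by rewrite powR12_sqrt// sqr_sqrtr.
Qed.

End FiniteSums.

(** * The combinatorial distance *)

Section Distance.
Variables (R : realType) (X : countType) (b : X -> X -> R).
Hypothesis b_graph : is_graph b.
Hypothesis b_conn : graph_connected b.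

Lemma gdist_le_walk x y p : is_walk b x y p -> (gdist b x y <= size p)%N.
Proof.
move=> hp; rewrite /gdist; case: pselect => [ex|//].
by case: ex_minnP => k _; apply; apply/asboolP; exists p.
Qed.

Lemma gdist_walk x y : exists2 p, is_walk b x y p & size p = gdist b x y.
Proof.
have [p hp] := b_conn x y.
rewrite /gdist; case: pselect => [ex|[]]; last by exists (size p); apply/asboolP; exists p.
by case: ex_minnP => k /asboolP[p' [h1 h2]] _; exists p'.
Qed.

Lemma gdist_tri x y z : (gdist b x z <= gdist b x y + gdist b y z)%N.
Proof.
have [p [p1 p2] <-] := gdist_walk x y; have [q [q1 q2] <-] := gdist_walk y z.
rewrite -size_cat; apply: gdist_le_walk; split; first by rewrite cat_path p1 p2.
by rewrite last_cat p2.
Qed.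

Lemma gdistC x y : gdist b x y = gdist b y x.
Proof.
have le u v : (gdist b u v <= gdist b v u)%N.
  have [p [p1 p2] <-] := gdist_walk v u; rewrite -(size_belast v p) -size_rev.
  apply: gdist_le_walk; split.
    rewrite -p2 rev_path (eq_path (e' := adj b))// => c d.
    by rewrite /adj (graph_sym b_graph).
  by rewrite -p2; case: p {p1 p2} => //= c p; rewrite rev_cons last_rcons.
by apply/eqP; rewrite eqn_leq !le.
Qed.

Lemma gdistxx x : gdist b x x = 0%N.
Proof. by apply/eqP; rewrite -leqn0; apply: (@gdist_le_walk x x [::]). Qed.

Lemma gdist_adj x y : 0 < b x y -> (gdist b x y <= 1)%N.
Proof. by move=> h; apply: (@gdist_le_walk x y [:: y]); split=> //=; rewrite andbT. Qed.

Lemma gdist_lip o x y : 0 < b x y -> `|(gdist b o x)%:R - (gdist b o y)%:R : R| <= 1.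
Proof.
move=> h; have h1 := gdist_adj h.
have h2 : (gdist b o x <= gdist b o y + 1)%N.
  by apply: leq_trans (gdist_tri o y x) _; rewrite leq_add2l gdistC.
have h3 : (gdist b o y <= gdist b o x + 1)%N.
  by apply: leq_trans (gdist_tri o x y) _; rewrite leq_add2l.
move: h2 h3; rewrite -2!(ler_nat R) !natrD ler_norml => h2 h3.
apply/andP; split; lra.
Qed.

(** A shortest walk is cut after half of its steps. The point serves as an intermediate centre when
    volumes of distant balls are compared. *)
Lemma gdist_midpoint x y : exists z,
  (gdist b x z <= (gdist b x y)./2)%N /\ (gdist b z y <= uphalf (gdist b x y))%N.
Proof.
have [p [p1 p2] <-] := gdist_walk x y.
exists (last x (take (size p)./2 p)).
move: p1 p2; rewrite -{1 2}(cat_take_drop (size p)./2 p) cat_path last_cat => /andP[h1 h2] h3.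
split.
  apply: leq_trans (gdist_le_walk (conj h1 erefl)) _.
  by rewrite size_take; case: ltnP.
apply: leq_trans (gdist_le_walk (conj h2 h3)) _.
by rewrite size_drop -{1}(odd_double_half (size p)) uphalf_half -addnn; lia.
Qed.

End Distance.

(** * Balls, volumes and gradients as finite sums *)

Section NormalizedGraph.
Variables (R : realType) (X : countType) (b : X -> X -> R) (m : X -> R).
Hypothesis G : normalized_graph b m.
Let bg := ngraph_graph G.
Let b_ge0 : forall x y, 0 <= b x y := graph_ge0 bg.
Let b_sym : forall x y, b x y = b y x := graph_sym bg.
Let m_gt0 : forall x, 0 < m x := ngraph_gt0 G.
Let b_conn := ngraph_connected G.

Definition ballseq (x : X) (r : R) : seq X := finmap.enum_fset (fset_set (gball b x r)).

Lemma ballseq_uniq x r : uniq (ballseq x r).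
Proof. exact: finmap.fset_uniq. Qed.

Lemma mem_ballseq x r y : (y \in ballseq x r) = ((gdist b x y)%:R <= r).
Proof.
etransitivity; first exact: (in_fset_set (ngraph_ball G x r) y).
by apply/idP/idP => h; [move: h; rewrite inE|rewrite inE].
Qed.

Definition nbs (x : X) : seq X := ballseq x 1.

Lemma mem_nbs x y : b x y != 0 -> y \in nbs x.
Proof.
move=> h; rewrite /nbs mem_ballseq; have bp : 0 < b x y by rewrite lt_neqAle eq_sym h b_ge0.
by rewrite lern1; apply: gdist_adj.
Qed.

Lemma sum_nbs x (g : X -> R) s : uniq s -> (forall y, b x y != 0 -> g y != 0 -> y \in s) ->
  \sum_(y <- nbs x) b x y * g y = \sum_(y <- s) b x y * g y.
Proof.
move=> us h; apply: sum_supp_eq => //; first exact: ballseq_uniq.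
  by move=> y; rewrite mulf_eq0 negb_or => /andP[/mem_nbs].
by move=> y; rewrite mulf_eq0 negb_or => /andP[/h].
Qed.

Lemma rsum_nbs x (g : X -> R) : rsum (fun y => b x y * g y) = \sum_(y <- nbs x) b x y * g y.
Proof.
apply: rsum_seq; first exact: ballseq_uniq.
by move=> y; apply: contraNeq; rewrite mulf_eq0 negb_or => /andP[/mem_nbs].
Qed.

Lemma m_nbs x : m x = \sum_(y <- nbs x) b x y.
Proof.
rewrite (ngraph_deg G) /deg /edeg (esum_seq (ballseq_uniq x 1))//.
by move=> y; apply: contraNeq => /mem_nbs.
Qed.

Lemma b_le_nbs x : \sum_(y <- nbs x) b x y <= m x.
Proof. by rewrite -m_nbs. Qed.

Lemma b_le_seq s x : uniq s -> \sum_(y <- s) b x y <= m x.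
Proof.
move=> us; rewrite m_nbs.
have -> : \sum_(y <- nbs x) b x y = \sum_(y <- undup (s ++ nbs x)) b x y.
  apply: sum_supp_eq; rewrite ?undup_uniq ?ballseq_uniq//.
    exact: mem_nbs.
  by move=> y /mem_nbs h; rewrite mem_undup mem_cat h orbT.
have -> : \sum_(y <- s) b x y = \sum_(y <- undup (s ++ nbs x)) (if y \in s then b x y else 0).
  rewrite big_seq big_mkcond /=; apply: sum_supp_eq; rewrite ?undup_uniq//.
    by move=> y; case: ifP => //; rewrite eqxx.
  by move=> y; case: ifP => [h _|]; rewrite ?eqxx// mem_undup mem_cat h.
by apply: ler_sum => y _; case: ifP.
Qed.

Lemma lapE f x : lap b m f x = f x - Pop b m nbs f x.
Proof.
rewrite /lap rsum_nbs /Pop; under eq_bigr do rewrite mulrBr.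
by rewrite sumrB -mulr_suml -m_nbs mulrBr mulKf// gt_eqF.
Qed.

Lemma volE x r : vol b m x r = \sum_(y <- ballseq x r) m y.
Proof.
rewrite /vol /mass esum_mkcond.
transitivity (fine (\esum_(y in [set: X]) (if y \in ballseq x r then m y else 0)%:E)).
  congr fine; apply: eq_esum => y _.
  have -> : (y \in gball b x r) = (y \in ballseq x r).
    by rewrite mem_ballseq; apply/idP/idP => h; [move: h; rewrite inE|rewrite inE].
  by case: ifP.
rewrite (esum_seq (ballseq_uniq x r)) /=.
- by rewrite big_seq [RHS]big_seq; apply: eq_bigr => y ->.
- by move=> y; case: ifP => // _; exact: ltW.
- by move=> y /negPf ->.
Qed.

Lemma vol_le x r y r' : (forall z, (gdist b x z)%:R <= r -> (gdist b y z)%:R <= r') ->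
  vol b m x r <= vol b m y r'.
Proof.
move=> h; rewrite !volE.
have -> : \sum_(z <- ballseq x r) m z = \sum_(z <- ballseq y r') (if z \in ballseq x r then m z else 0).
  rewrite big_seq big_mkcond /=; apply: sum_supp_eq; rewrite ?ballseq_uniq//.
    by move=> z; case: ifP => //; rewrite eqxx.
  by move=> z; case: ifP => [+ _|]; rewrite ?eqxx// !mem_ballseq; exact: h.
by apply: ler_sum => z _; case: ifP => // _; exact: ltW.
Qed.

Lemma m_le_vol x r : 0 <= r -> m x <= vol b m x r.
Proof.
move=> r0; rewrite volE (big_rem x) ?mem_ballseq ?gdistxx//= lerDl sumr_ge0// => y _; exact: ltW.
Qed.

Lemma vol_gt0 x r : 0 <= r -> 0 < vol b m x r.
Proof. by move=> /(m_le_vol x); apply: lt_le_trans. Qed.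

(** Expand the square and sum over [x]: as [sum_x b x y = m y] includes the edges leaving the
    support, the total is [ip - 2 bf + ip], with no boundary term. *)
Lemma grad_norm (u : X -> R) D : uniq D -> (forall x, u x != 0 -> x \in D) ->
  (lpnorm m 2 (grad b m u) ^+ 2 = (2 * Qf b m D u)%:E)%E.
Proof.
move=> uD hu.
pose g x := m x * (u x ^+ 2) - 2 * (u x * \sum_(y <- D) b x y * u y) + \sum_(y <- D) b x y * u y ^+ 2.
have gE x : rsum (fun y => b x y * (u x - u y) ^+ 2) = g x.
  rewrite rsum_nbs.
  have -> : \sum_(y <- nbs x) b x y * (u x - u y) ^+ 2 =
     \sum_(y <- nbs x) b x y * u x ^+ 2 - 2 * (u x * \sum_(y <- nbs x) b x y * u y) +
     \sum_(y <- nbs x) b x y * u y ^+ 2.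
    rewrite !mulr_sumr -sumrB -big_split /=; apply: eq_bigr => y _; ring.
  rewrite -mulr_suml -m_nbs (sum_nbs uD); last by move=> y _; exact: hu.
  by rewrite (sum_nbs uD)// => y _; rewrite expf_eq0; exact: hu.
have g0 x : 0 <= g x.
  by rewrite -gE rsum_nbs; apply: sumr_ge0 => y _; rewrite mulr_ge0 ?sqr_ge0.
(* The gradient reaches one step beyond the support, so its norm is summed over [D] and its
   neighbours. *)
pose D' := undup (D ++ flatten [seq nbs x | x <- D]).
have DD' x : x \in D -> x \in D' by move=> h; rewrite mem_undup mem_cat h.
have gs x : g x != 0 -> x \in D'.
  apply: contraNT => xD'.
  have ux : u x = 0 by apply/eqP; apply: contraNT xD' => /hu /DD'.
  rewrite /g ux expr0n mulr0 mul0r mulr0 subr0 add0r big1_seq// => y /= yD.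
  apply/eqP; rewrite mulf_eq0; apply/orP; left; apply: contraNT xD' => bxy.
  rewrite mem_undup mem_cat; apply/orP; right; apply/flattenP; exists (nbs y).
    exact: map_f.
  by apply: mem_nbs; rewrite b_sym.
rewrite (lpnorm2_seq (s := D'))//; first last.
- move=> x; rewrite /grad gE => h; apply: gs; apply: contraNneq h => ->.
  by rewrite mulr0 sqrtr0.
- by rewrite undup_uniq.
congr EFin.
have -> : \sum_(x <- D') m x * grad b m u x ^+ 2 = \sum_(x <- D') g x.
  apply: eq_bigr => x _; rewrite /grad gE sqr_sqrtr ?mulr_ge0 ?invr_ge0 ?(ltW (m_gt0 x))//.
  by rewrite mulVKf// gt_eqF.
rewrite /g big_split sumrB /=.
have uD' : uniq D' by rewrite undup_uniq.
have -> : \sum_(x <- D') m x * u x ^+ 2 = ip m D u u.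
  rewrite /ip; under eq_bigr do rewrite expr2.
  apply: sum_supp_eq => // x; rewrite !mulf_eq0 !negb_or => /andP[_ /andP[/hu h _]] //.
  exact: DD'.
have -> : \sum_(x <- D') 2 * (u x * \sum_(y <- D) b x y * u y) = 2 * bf b D u u.
  rewrite -mulr_sumr /bf; congr (_ * _).
  have -> : \sum_(x <- D') u x * \sum_(y <- D) b x y * u y = \sum_(x <- D) u x * \sum_(y <- D) b x y * u y.
    by apply: sum_supp_eq => // x; rewrite mulf_eq0 negb_or => /andP[/hu h _] //; exact: DD'.
  by apply: eq_bigr => x _; rewrite mulr_sumr; apply: eq_bigr => y _; rewrite mulrCA.
have -> : \sum_(x <- D') \sum_(y <- D) b x y * u y ^+ 2 = ip m D u u.
  rewrite exchange_big /= /ip !big_seq; apply: eq_bigr => y yD.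
  rewrite -mulr_suml -expr2; congr (_ * _); rewrite m_nbs.
  under eq_bigr do rewrite b_sym.
  apply: sum_supp_eq => //; first exact: ballseq_uniq; last by move=> x; exact: mem_nbs.
  move=> x /mem_nbs h; rewrite mem_undup mem_cat; apply/orP; right; apply/flattenP.
  by exists (nbs y) => //; exact: map_f.
rewrite /Qf; ring.
Qed.

Lemma sobolev_on_of_sobolev phi n R1 R2 (B : set X) x r D : sobolev b m phi n R1 R2 B ->
  0 < phi -> 2 < n -> 0 < R1 -> B x -> R1 <= r -> r <= R2 -> uniq D ->
  sobolev_on b m D (fun z => (gdist b x z)%:R) (phi * r ^+ 2 / vol b m x r `^ (2 / n)) r n.
Proof.
move=> hS phi0 hn R10 xB r1 r2 uD w w0 hw.
have r0 : 0 < r by apply: lt_le_trans r1.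
have V0 := vol_gt0 x (ltW r0).
pose u z := if z \in D then w z else 0.
have hu z : u z != 0 -> z \in D by rewrite /u; case: ifP => //; rewrite eqxx.
have us : supported_in (gball b x r) u.
  by move=> z; rewrite /u; case: ifP => [_ /hw//|]; rewrite eqxx.
have := hS x xB r r1 r2 u us.
have q0 : 0 < 2 * n / (n - 2) by rewrite divr_gt0 ?mulr_gt0 ?subr_gt0//; lra.
rewrite (grad_norm uD hu) (lpnorm2_seq uD m_gt0 hu) (lpnorm_seq uD q0 m_gt0 hu).
rewrite -EFin_expe -!EFinM -EFinD lee_fin.
have e1 : \sum_(z <- D) m z * u z ^+ 2 = ip m D w w.
  by rewrite /ip !big_seq; apply: eq_bigr => z zD; rewrite /u zD expr2.
have e2 : Qf b m D u = Qf b m D w.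
  rewrite /Qf /ip /bf; congr (_ - _); rewrite !big_seq; apply: eq_bigr => z zD; rewrite /u zD//.
  by rewrite !big_seq; apply: eq_bigr => y yD; rewrite yD.
have e3 : \sum_(z <- D) `|u z| `^ (2 * n / (n - 2)) * m z = \sum_(z <- D) m z * w z `^ (2 * n / (n - 2)).
  by rewrite !big_seq; apply: eq_bigr => z zD; rewrite /u zD ger0_norm// mulrC.
rewrite e1 e2 e3; set S := \sum_(z <- D) _.
have -> : (S `^ (2 * n / (n - 2))^-1) ^+ 2 = S `^ (1 - 2 / n).
  rewrite -powR_mulrn ?powR_ge0// -powRrM; congr (_ `^ _); field.
  by rewrite subr_eq0 !gt_eqF//; lra.
set Vn := vol b m x r `^ (2 / n); have Vn0 : 0 < Vn by rewrite powR_gt0.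
have pr : 0 < phi * r ^+ 2 by rewrite mulr_gt0 ?exprn_gt0.
rewrite -(@ler_pM2l _ (phi * r ^+ 2 / Vn)) ?divr_gt0//.
rewrite mulrA [_ / Vn * _]mulrA divfK ?gt_eqF// mulfV ?gt_eqF// mul1r.
by rewrite [ip m D w w / _]mulrC.
Qed.

(** * The Friedrichs extension and the bottom of the spectrum *)

Definition nclosure (s : seq X) : seq X := undup (s ++ flatten [seq nbs x | x <- s]).

Lemma nclosure_uniq s : uniq (nclosure s). Proof. exact: undup_uniq. Qed.

Lemma sub_nclosure s x : x \in s -> x \in nclosure s.
Proof. by move=> h; rewrite mem_undup mem_cat h. Qed.

Lemma Pop_seq D u x : uniq D -> (forall x, u x != 0 -> x \in D) ->
  Pop b m nbs u x = Pop b m (fun _ => D) u x.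
Proof. by move=> uD hu; rewrite /Pop (sum_nbs uD)// => y _; exact: hu. Qed.

Lemma lap_supp u s x : (forall x, u x != 0 -> x \in s) -> lap b m u x != 0 -> x \in nclosure s.
Proof.
move=> hu; apply: contraNT => xs.
have ux : u x = 0 by apply/eqP; apply: contraNT xs => /hu /sub_nclosure.
rewrite lapE ux /Pop big1_seq ?mulr0 ?subrr// => y /= _.
apply/eqP; rewrite mulf_eq0 -[_ || _]negbK negb_or; apply/negP => /andP[bxy uy].
move/negP: xs; apply; rewrite mem_undup mem_cat; apply/orP; right.
by apply/flattenP; exists (nbs y); [apply: map_f; exact: hu|apply: mem_nbs; rewrite b_sym].
Qed.

Lemma l2dot_seq D f g : uniq D -> (forall x, f x != 0 -> g x != 0 -> x \in D) -> l2dot m f g = ip m D f g.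
Proof.
move=> uD h; rewrite /l2dot (rsum_seq uD).
  by apply: eq_bigr => x _; rewrite mulrC.
move=> x xD; apply/eqP; apply: contraNT xD; rewrite !mulf_eq0 !negb_or => /andP[/andP[h1 h2] _].
exact: h.
Qed.

Lemma lap_sym u v s t : uniq s -> uniq t -> (forall x, u x != 0 -> x \in s) ->
  (forall x, v x != 0 -> x \in t) -> l2dot m (lap b m v) u = l2dot m v (lap b m u).
Proof.
move=> us ut hu hv; pose D := undup (s ++ t).
have uD : uniq D by rewrite undup_uniq.
have hu' x : u x != 0 -> x \in D by move=> /hu h; rewrite mem_undup mem_cat h.
have hv' x : v x != 0 -> x \in D by move=> /hv h; rewrite mem_undup mem_cat h orbT.
rewrite !(l2dot_seq (D := D))//; [|by move=> x /hv'|by move=> x _ /hu'].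
have e w : (forall x, w x != 0 -> x \in D) -> lap b m w = fun x => w x - Pop b m (fun _ => D) w x.
  by move=> hw; apply/funext => x; rewrite lapE (Pop_seq x uD hw).
rewrite (e _ hu') (e _ hv') ipBl [RHS]ipC ipBl [ip m D (Pop _ _ _ _) v]ipC [ip m D (Pop _ _ _ _) u]ipC.
by rewrite !ip_P// [ip m D v u]ipC; congr (_ - _); rewrite bfC.
Qed.

Lemma fin_supp_seq (u : X -> R) : finitely_supported u -> exists2 s, uniq s & forall x, u x != 0 -> x \in s.
Proof.
move=> h; exists (finmap.enum_fset (fset_set [set x | u x != 0])); first exact: finmap.fset_uniq.
move=> x ux; have := in_fset_set h x; rewrite [X in _ = X -> _](_ : _ = true); first by [].
by apply/idP; rewrite inE.
Qed.

Lemma seq_fin_supp (u : X -> R) (s : seq X) : (forall x, u x != 0 -> x \in s) -> finitely_supported u.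
Proof. by move=> hu; apply: (sub_finite_set _ (finite_seq s)) => x /= /hu. Qed.

(** The constant sequence approximates [u], and the adjoint condition is the symmetry of [lap]. This
    supplies the test vectors for the resolvent bound. *)
Lemma friedrichs_lap u s : uniq s -> (forall x, u x != 0 -> x \in s) -> friedrichs b m u (lap b m u).
Proof.
move=> us hu; split.
- split; first by rewrite /l2 (lpnorm_seq us _ m_gt0 hu)// ltry.
  have zero x : (u \- u) x != 0 -> x \in ([::] : seq X) by rewrite /= subrr eqxx.
  exists (fun=> u); split.
  + by move=> _; exact: (seq_fin_supp hu).
  + have -> : lpnorm m 2 (u \- u) = 0%E.
      by rewrite (lpnorm_seq (s := [::]) _ _ m_gt0 zero)// big_nil powR0// invr_eq0.
    exact: cvg_cst.
  + move=> e e0; exists 0%N => k l _ _.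
    rewrite (l2dot_seq (D := [::]))//; first by rewrite /ip big_nil.
    by move=> x _ /zero.
- by rewrite /l2 (lpnorm_seq (nclosure_uniq s) _ m_gt0 (lap_supp (s := s) ^~ hu))// ltry.
- by move=> v /fin_supp_seq[t ut ht]; apply: (lap_sym us ut).
Qed.

(** The bound from above applied to [|f|]. It says [1 - P <= 2], the boundedness used in
    [Lambda_le_rayleigh]. *)
Lemma bf_ge_ip D f : uniq D -> - bf b D f f <= ip m D f f.
Proof.
move=> uD; have := bf_le_ip b_ge0 b_sym (fun x => b_le_seq x uD) (fun x => `|f x|).
have -> : ip m D (fun x => `|f x|) (fun x => `|f x|) = ip m D f f.
  by apply: eq_bigr => x _; rewrite -!expr2 real_normK ?num_real.
apply: le_trans; rewrite /bf -sumrN; apply: ler_sum => x _; rewrite -sumrN; apply: ler_sum => y _.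
by rewrite -mulrN ler_wpM2l// -normrM -normrN ler_norm.
Qed.

(* If the infimum [l0] of the Rayleigh quotients were in the resolvent set, the bound
   [|Au|^2 <= 2 <Au, u>] for the nonnegative operator [A = lap - l0] would push the infimum up. *)
Lemma Lambda_le_rayleigh D w : uniq D -> Lambda b m * ip m D w w <= Qf b m D w.
Proof.
move=> uD; rewrite leNgt; apply/negP => hw.
have Qge0 s f : uniq s -> 0 <= Qf b m s f.
  by move=> us; apply: Qf_ge0 => // x; apply: b_le_seq.
pose E : set R := [set q | exists s u, [/\ uniq s, 0 < ip m s u u & q = Qf b m s u / ip m s u u]].
have ipw : 0 < ip m D w w.
  rewrite lt_neqAle ip_ge0// andbT eq_sym; apply/eqP => e; move: hw.
  by rewrite e mulr0 ltNge Qge0.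
have E0 : E !=set0 by exists (Qf b m D w / ip m D w w); exists D, w.
have Elb : lbound E 0 by move=> q [s [u [us up ->]]]; rewrite divr_ge0 ?Qge0// ltW.
set l0 := inf E.
have l00 : 0 <= l0 by apply: lb_le_inf.
have infE s u : uniq s -> l0 * ip m s u u <= Qf b m s u.
  move=> us; have := ip_ge0 s m_gt0 u; rewrite le_eqVlt => /orP[/eqP <-|up].
    by rewrite mulr0 Qge0.
  rewrite -ler_pdivlMr//; apply: ge_inf; first by exists 0.
  by exists s, u.
have l0L : l0 < Lambda b m.
  apply: le_lt_trans (_ : Qf b m D w / ip m D w w < _); last by rewrite ltr_pdivrMr.
  by apply: ge_inf; [exists 0|exists D, w].
have [[C hC] _] : resolvent_set b m l0.
  apply: contrapT => ns.
  (* Without an infimum [inf] is [0] by default, which contradicts [0 <= l0 < Lambda]. *)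
  have hi : has_inf (spectrum b m).
    apply: contrapT => hn; have := le_lt_trans l00 l0L; rewrite /Lambda inf_out ?ltxx//.
  have : Lambda b m <= l0 by apply: ge_inf => //; case: hi.
  by rewrite leNgt l0L.
pose kap := 2 * C ^+ 2 + 1.
have kap0 : 0 < kap by rewrite ltr_wpDl// mulr_ge0// sqr_ge0.
have key s u : uniq s -> ip m s u u <= kap * (Qf b m s u - l0 * ip m s u u).
  move=> us; pose u' x := if x \in s then u x else 0.
  have hu' x : u' x != 0 -> x \in s by rewrite /u'; case: ifP => //; rewrite eqxx.
  have -> : ip m s u u = ip m s u' u' by rewrite /ip !big_seq; apply: eq_bigr => x xs; rewrite /u' xs.
  have -> : Qf b m s u = Qf b m s u'.
    rewrite /Qf /ip /bf; congr (_ - _); rewrite !big_seq; apply: eq_bigr => x xs; rewrite /u' xs//.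
    by rewrite !big_seq; apply: eq_bigr => y ys; rewrite ys.
  move: u' hu' => {}u hu; set T := nclosure s; have uT := nclosure_uniq s.
  have huT x : u x != 0 -> x \in T by move=> /hu /sub_nclosure.
  have eip : ip m s u u = ip m T u u.
    by apply: sum_supp_eq => // x; rewrite !mulf_eq0 !negb_or => /andP[_ /andP[h _]]; [exact: hu|exact: huT].
  have ebf : bf b s u u = bf b T u u.
    rewrite /bf; transitivity (\sum_(x <- T) \sum_(y <- s) b x y * (u x * u y)).
      have ux x : \sum_(y <- s) b x y * (u x * u y) != 0 -> u x != 0.
        by apply: contraNneq => ->; apply/eqP; apply: big1 => y _; rewrite mul0r mulr0.
      by apply: sum_supp_eq => // x /ux; [exact: hu|exact: huT].
    apply: eq_bigr => x _; apply: sum_supp_eq => // y; rewrite !mulf_eq0 !negb_or => /andP[_ /andP[_ h]]; [exact: hu|exact: huT].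
  have eQ : Qf b m s u = Qf b m T u by rewrite /Qf eip ebf.
  pose v x := lap b m u x - l0 * u x.
  have hv x : v x != 0 -> x \in T.
    apply: contraNT => xT; rewrite /v.
    have -> : lap b m u x = 0 by apply/eqP; apply: contraNT xT; exact: lap_supp.
    have -> : u x = 0 by apply/eqP; apply: contraNT xT; exact: huT.
    by rewrite mulr0 subrr.
  have := hC _ _ (friedrichs_lap us hu).
  rewrite (lpnorm_seq uT _ m_gt0 huT)// (lpnorm_seq uT _ m_gt0 hv)// -EFinM lee_fin => h1.
  have nE f : \sum_(x <- T) `|f x| `^ 2 * m x = ip m T f f.
    by apply: eq_bigr => x _; rewrite powR_mulrn// real_normK ?num_real// mulrC expr2.
  rewrite !nE !powR12_sqrt ?ip_ge0// in h1.
  have h2 : ip m T u u <= C ^+ 2 * ip m T v v.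
    have := lerXn2r 2 _ _ h1; rewrite !nnegrE sqrtr_ge0 => h3.
    have {}h3 := h3 isT (le_trans (sqrtr_ge0 _) h1).
    by rewrite exprMn !sqr_sqrtr ?ip_ge0 in h3.
  have quv g : ip m T v g = ip m T u g - bf b T u g - l0 * ip m T u g.
    have -> : ip m T v g = ip m T (fun x => lap b m u x) g - ip m T (fun x => l0 * u x) g.
      by rewrite -ipBl.
    congr (_ - _); last by rewrite /ip mulr_sumr; apply: eq_bigr => x _; ring.
    have -> : (fun x => lap b m u x) = fun x => u x - Pop b m (fun _ => T) u x.
      by apply/funext => x; rewrite lapE (Pop_seq x uT huT).
    by rewrite ipBl [ip m T (Pop _ _ _ _) _]ipC ip_P// bfC.
  (* For the form [a] of [A = lap - l0] and [v = A u], expand [0 <= a(u - v/2, u - v/2) = a(u,u) -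
     |v|^2 + a(v,v)/4] and use [a(v,v) <= 2 |v|^2]. *)
  have h3 : ip m T v v <= 2 * (Qf b m T u - l0 * ip m T u u).
    have := infE T (fun x => u x - 2^-1 * v x) uT.
    have -> : ip m T (fun x => u x - 2^-1 * v x) (fun x => u x - 2^-1 * v x) =
        ip m T u u - ip m T u v + 4^-1 * ip m T v v.
      rewrite /ip mulr_sumr -sumrB -big_split /=; apply: eq_bigr => x _; by field.
    have -> : Qf b m T (fun x => u x - 2^-1 * v x) =
        Qf b m T u - (ip m T u v - bf b T u v) + 4^-1 * Qf b m T v.
      have -> : Qf b m T (fun x => u x - 2^-1 * v x) =
          ip m T u u - ip m T u v + 4^-1 * ip m T v v -
          (bf b T u u - 2^-1 * (bf b T u v + bf b T v u) + 4^-1 * bf b T v v).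
        rewrite /Qf; congr (_ - _).
          rewrite /ip mulr_sumr -sumrB -big_split /=; apply: eq_bigr => x _; by field.
        rewrite /bf -big_split /= !mulr_sumr -sumrB -big_split /=; apply: eq_bigr => x _.
        rewrite -big_split /= !mulr_sumr -sumrB -big_split /=; apply: eq_bigr => y _; by field.
      by rewrite (bfC T b_sym v u) /Qf; field.
    have := quv v; have := bf_ge_ip v uT; have := ip_ge0 T m_gt0 v.
    have : 0 <= l0 * ip m T v v by rewrite mulr_ge0// ip_ge0.
    rewrite /Qf; lra.
  rewrite eip eQ; apply: le_trans h2 _.
  have h4 : 0 <= Qf b m T u - l0 * ip m T u u by rewrite subr_ge0 infE.
  apply: le_trans (ler_wpM2l (sqr_ge0 C) h3) _; rewrite /kap.
  move: h4; set z := _ - _; lra.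
have : l0 + kap^-1 <= l0.
  apply: lb_le_inf => // q [s [u [us up ->]]].
  rewrite ler_pdivlMr// mulrDl -lerBrDl ler_pdivrMl//.
  exact: key.
by rewrite gerDl leNgt invr_gt0 kap0.
Qed.

(** * The minimal heat kernel and its approximation by killed kernels *)

Definition hk (t : R) (x y : X) : R := heat b m nbs (dirac_at m y) t x.

Let db y := dirac_bounded m_gt0 y.
Let dge0 y := dirac_ge0 m_gt0 y.

Lemma hk_fundamental : fundamental_solution b m hk.
Proof.
split.
- by move=> t x y t0; apply: (heat_ge0 b_ge0 m_gt0 b_le_nbs x (db y) (dge0 y) (ltW t0)).
- move=> t x y t0; rewrite lapE opprB.
  exact: (is_derive_heat b_ge0 m_gt0 b_le_nbs (db y)).
- move=> x y; have := is_derive_heat b_ge0 m_gt0 b_le_nbs (db y) 0 x.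
  case=> /derivable1_diffP/differentiable_continuous c _.
  have -> : (x == y)%:R / m y = heat b m nbs (dirac_at m y) 0 x by rewrite heat0.
  by apply: cvg_at_right_filter; exact: c.
Qed.

Lemma is_derive_mono (c : R) (k : nat) (t : R) :
  is_derive t 1 (fun s : R => c * s ^+ k) (c * (k%:R * t ^+ k.-1)).
Proof.
apply: is_deriveMl; have H := is_deriveX k (is_derive_id t (1 : R)).
rewrite /GRing.scale /= mulr1 in H.
by apply: is_derive_ext H => s; rewrite exprfctE.
Qed.

(* [e^t q] has derivative [e^t P q >= 0], so by induction it dominates the partial sums of
   [e^t hk]. *)
Lemma hk_minimal q : fundamental_solution b m q -> forall (t : R) x y, 0 < t -> hk t x y <= q t x y.
Proof.
move=> [q0 dq lq] t x y t0.
pose a k z := iter k (Pop b m nbs) (dirac_at m y) z.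
pose S N z (s : R) := \sum_(0 <= k < N) a k z / k`!%:R * s ^+ k.
have key N z (s : R) : 0 < s -> S N z s <= expR (1 * s) * q s z y.
  elim: N z s => [|N IH] z s s0; first by rewrite /S big_nil mulr_ge0 ?expR_ge0// q0.
  pose f r := expR (1 * r) * q r z y - S N.+1 z r.
  pose df r := expR (1 * r) * (Pop b m nbs (fun w => q r w y) z - q r z y) + 1 * expR (1 * r) * q r z y
     - Pop b m nbs (fun w => S N w r) z.
  have dfE (r : R) : 0 < r -> is_derive r 1 f (df r).
    move=> r0; apply: is_deriveB.
      apply: is_deriveMr; first exact: is_derive_expRl.
      by have := dq r z y r0; rewrite lapE opprB.
    have -> : Pop b m nbs (fun w => S N w r) z =
       \sum_(k <- index_iota 0 N.+1) a k z / k`!%:R * (k%:R * r ^+ k.-1).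
      rewrite -/(index_iota 0 N.+1) big_nat_recl//= mul0r mulr0 add0r /Pop mulr_sumr.
      have e w : (m z)^-1 * (b z w * S N w r) = \sum_(0 <= k < N) (m z)^-1 * (b z w * (a k w / k`!%:R * r ^+ k)).
        by rewrite /S !mulr_sumr.
      rewrite (eq_bigr _ (fun w _ => e w)) exchange_big /=; apply: eq_bigr => k _.
      rewrite /a /= /Pop !mulr_sumr !mulr_suml factS natrM; apply: eq_bigr => w _.
      have h1 : k.+1%:R != 0 :> R by rewrite pnatr_eq0.
      have h2 : k`!%:R != 0 :> R by rewrite pnatr_eq0 -lt0n fact_gt0.
      have h3 : m z != 0 by rewrite gt_eqF.
      move: (k.+1%:R) (k`!%:R) (m z) (iter _ _ _ _) h1 h2 h3 => A1 A2 A3 A4 h1 h2 h3.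
      by field; rewrite h1 h2 h3.
    by apply: is_derive_sumr => k; exact: is_derive_mono.
  have df0 (r : R) : 0 < r -> 0 <= df r.
    move=> r0; rewrite /df.
    have -> : expR (1 * r) * (Pop b m nbs (fun w => q r w y) z - q r z y) + 1 * expR (1 * r) * q r z y =
       Pop b m nbs (fun w => expR (1 * r) * q r w y) z.
      have -> : Pop b m nbs (fun w => expR (1 * r) * q r w y) z = expR (1 * r) * Pop b m nbs (fun w => q r w y) z.
        by rewrite /Pop !mulr_sumr; apply: eq_bigr => w _; ring.
      ring.
    rewrite subr_ge0 /Pop ler_wpM2l ?invr_ge0 ?(ltW (m_gt0 z))//; apply: ler_sum => w _.
    by rewrite ler_wpM2l// IH.
  rewrite -subr_ge0 -/(f s).
  have e0 : expR (1 * 0) * ((z == y)%:R / m y) - S N.+1 z 0 = 0 :> R.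
    rewrite mulr0 expR0 mul1r /S big_nat_recl//= expr0 divr1 mulr1 big1 ?addr0 ?subrr//.
    by move=> k _; rewrite expr0n mulr0.
  (* A fundamental solution is known at time [0] only through its limit, so monotonicity is used on
     [[r, s]] and then [r] tends to [0]. *)
  have lim : f r @[r --> 0^'+] --> (0 : R).
    rewrite -[X in _ --> X]e0.
    apply: cvgB; first apply: cvgM; last 2 first.
    - exact: lq.
    - have : is_derive (0:R) 1 (S N.+1 z) (\sum_(k <- index_iota 0 N.+1) a k z / k`!%:R * (k%:R * 0 ^+ k.-1)).
        by apply: is_derive_sumr => k; exact: is_derive_mono.
      case=> /derivable1_diffP/differentiable_continuous c _.
      by apply: cvg_at_right_filter; exact: c.
    - have := is_derive_expRl 1 (0 : R).
      case=> /derivable1_diffP/differentiable_continuous c _.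
      by apply: cvg_at_right_filter; exact: c.
  apply: (cvgr_to_le lim); near=> r.
  have r0 : 0 < r by near: r; exact: nbhs_right_gt.
  have rs : r <= s by near: r; apply: nbhs_right_le.
  apply: (nondecr_of_derive (df := df)) => // u /andP[u1 _]; first by apply: dfE; apply: lt_le_trans u1.
  by apply: df0; apply: lt_le_trans u1.
apply: (heat_le_partial b_ge0 m_gt0 b_le_nbs (db y)) => N.
by rewrite expRN ler_pdivrMl ?expR_gt0//; have := key N x t t0; rewrite mul1r.
Unshelve. all: by end_near. Qed.

Lemma heat_kernelE (t : R) x y : 0 < t -> heat_kernel b m t x y = hk t x y.
Proof.
move=> t0; have hm : minimal_fundamental_solution b m hk.
  by split; [exact: hk_fundamental|exact: hk_minimal].
have [h1 h2] : minimal_fundamental_solution b m (heat_kernel b m).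
  by rewrite /heat_kernel; apply: xgetPex; exists hk.
by apply/le_anti; rewrite h2 ?hk_minimal//; exact: hk_fundamental.
Qed.

(** Walks of at most [N] steps from [x] stay in the ball of radius [N], so for [D] containing it the
    first terms of both series agree. Positivity of the other terms bounds each partial sum by a
    killed kernel. *)
Lemma hk_le_heat (t C : R) x y : 0 <= t ->
  (forall D, uniq D -> x \in D -> y \in D -> heat b m (fun _ => D) (dirac_at m y) t x <= C) ->
  hk t x y <= C.
Proof.
move=> t0 H; apply: (heat_le_partial b_ge0 m_gt0 b_le_nbs (db y)) => N.
pose D := undup (y :: ballseq x N%:R); have uD : uniq D by rewrite undup_uniq.
have bD z : (gdist b x z <= N)%N -> z \in D.
  by move=> h; rewrite mem_undup inE mem_ballseq ler_nat h orbT.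
have e k z : (gdist b x z + k <= N)%N ->
   iter k (Pop b m nbs) (dirac_at m y) z = iter k (Pop b m (fun _ => D)) (dirac_at m y) z.
  elim: k z => [//|k IH] z hz /=; rewrite /Pop; congr (_ * _).
  have -> : \sum_(w <- nbs z) b z w * iter k (fun f x => (m x)^-1 * \sum_(y <- nbs x) b x y * f y) (dirac_at m y) w =
     \sum_(w <- D) b z w * iter k (fun f x => (m x)^-1 * \sum_(y <- nbs x) b x y * f y) (dirac_at m y) w.
    apply: sum_nbs => // w bw _; apply: bD; apply: leq_trans (gdist_tri b_conn x z w) _.
    have bp : 0 < b z w by rewrite lt_neqAle eq_sym bw b_ge0.
    by have := gdist_adj bp; lia.
  apply: eq_bigr => w _; have [->|bw] := eqVneq (b z w) 0; first by rewrite !mul0r.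
  have bp : 0 < b z w by rewrite lt_neqAle eq_sym bw b_ge0.
  congr (_ * _); apply: IH; have := gdist_adj bp; have := gdist_tri b_conn x z w; lia.
apply: le_trans (H D uD _ _); last 2 first.
- by apply: bD; rewrite gdistxx.
- by rewrite mem_undup inE eqxx.
apply: le_trans (heat_ge_partial b_ge0 m_gt0 (fun z => b_le_seq z uD) x N.+1 (db y) (dge0 y) t0).
rewrite ler_pM2l ?expR_gt0//.
rewrite [leRHS]big_nat_recr//= ler_wpDr//.
  by rewrite mulr_ge0 ?exprn_ge0// divr_ge0// iter_Pop_ge0.
rewrite le_eqVlt; apply/orP; left; apply/eqP; rewrite !big_nat; apply: eq_bigr => k /andP[_ kN].
by rewrite e// gdistxx add0n ltnW.
Qed.

(** Killing only removes walks, so the comparison holds term by term in the series. *)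
Lemma heat_le_hk (t : R) x y D : uniq D -> 0 <= t -> heat b m (fun _ => D) (dirac_at m y) t x <= hk t x y.
Proof.
move=> uD t0; apply: (heat_le_partial b_ge0 m_gt0 (fun z => b_le_seq z uD) (db y)) => N.
apply: le_trans (heat_ge_partial b_ge0 m_gt0 b_le_nbs x N (db y) (dge0 y) t0).
rewrite ler_pM2l ?expR_gt0//; apply: ler_sum => k _.
rewrite ler_wpM2r ?exprn_ge0// ler_wpM2r//.
elim: k x => //= k IH x; rewrite /Pop ler_wpM2l ?invr_ge0 ?(ltW (m_gt0 x))//.
set f := iter k (Pop b m nbs) (dirac_at m y).
have f0 z : 0 <= f z by apply: iter_Pop_ge0.
apply: le_trans (_ : \sum_(z <- D) b x z * f z <= _).
  by apply: ler_sum => z _; rewrite ler_wpM2l.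
pose T := undup (D ++ nbs x); have uT : uniq T by rewrite undup_uniq.
rewrite (@sum_nbs x f T)//; last first.
  by move=> z /mem_nbs h _; rewrite mem_undup mem_cat h orbT.
have -> : \sum_(z <- D) b x z * f z = \sum_(z <- T) (if z \in D then b x z * f z else 0).
  rewrite big_seq big_mkcond /=; apply: sum_supp_eq => //.
    by move=> z; case: ifP => //; rewrite eqxx.
  by move=> z; case: ifP => [h _|]; rewrite ?eqxx// mem_undup mem_cat h.
by apply: ler_sum => z _; case: ifP => // _; rewrite mulr_ge0.
Qed.

(** * Volume lower bounds from the Sobolev inequality *)

Definition lowc (phi n : R) : R := (3 * phi) `^ (- (n / 2)).
(** The first entry settles radii below [4] through [low_volume]. The second is the largest [c] with
    [c^(2/n) <= 2^(2-n) / (17 phi)], the condition under which the bound [c (s/r)^n V] passes from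
    [s/2] to [s] by [volume_step]. *)
Definition dblc (phi n : R) : R := Num.min (lowc phi n * 4 `^ (- n)) ((2 `^ (2 - n) / (17 * phi)) `^ (n / 2)).

Lemma lowc_gt0 phi n : 0 < phi -> 0 < lowc phi n.
Proof. by move=> p0; rewrite powR_gt0// mulr_gt0. Qed.

Lemma dblc_gt0 phi n : 0 < phi -> 0 < dblc phi n.
Proof.
move=> p0; rewrite lt_min mulr_gt0 ?lowc_gt0 ?powR_gt0//=.
by rewrite divr_gt0 ?powR_gt0// mulr_gt0.
Qed.

Lemma vol_seq x s D : uniq D -> (forall z, (gdist b x z)%:R <= s -> z \in D) ->
  vol b m x s = \sum_(z <- D | (gdist b x z)%:R <= s) m z.
Proof.
move=> uD hD; rewrite volE big_seq big_mkcond [RHS]big_mkcond /=.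
rewrite (eq_bigr (fun z => if (gdist b x z)%:R <= s then m z else 0)); last first.
  by move=> z _; rewrite mem_ballseq.
apply: sum_supp_eq => //; first exact: ballseq_uniq.
  by move=> z; rewrite mem_ballseq; case: ifP => //; rewrite eqxx.
by move=> z; case: ifP => [/hD//|]; rewrite eqxx.
Qed.

Section SobolevAtPoint.
Variables (phi n r : R) (x : X).
Hypothesis phi0 : 0 < phi.
Hypothesis hn : 2 < n.
Hypothesis r1 : 1 <= r.
Hypothesis hS : forall D, uniq D ->
  sobolev_on b m D (fun z => (gdist b x z)%:R) (phi * r ^+ 2 / vol b m x r `^ (2 / n)) r n.

Let V := vol b m x r.
Let A := phi * r ^+ 2 / V `^ (2 / n).

Lemma sobolev_V_gt0 : 0 < V.
Proof. by apply: vol_gt0; apply: le_trans r1. Qed.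

Lemma sobolev_A_gt0 : 0 < A.
Proof.
by rewrite divr_gt0 ?powR_gt0 ?sobolev_V_gt0// mulr_gt0// exprn_gt0// (lt_le_trans ltr01).
Qed.

Lemma pow_conj (a : R) : 0 < a -> a `^ (1 - 2 / n) * a `^ (2 / n) = a.
Proof.
by move=> a0; rewrite -powRD ?subrK ?powRr1 ?(ltW a0)//; apply/implyP => _; rewrite gt_eqF.
Qed.

(** Test with the indicator of [x]: its gradient term is [2 m x] and its [l2] term at most [m x],
    whence the [3] in [lowc]. *)
Lemma low_volume : lowc phi n * V <= m x * r `^ n.
Proof.
have n0 : 0 < n by apply: lt_trans hn.
have r0 : 0 < r by apply: lt_le_trans r1.
have V0 := sobolev_V_gt0.
pose w z : R := (z == x)%:R.
have hw z : w z != 0 -> (gdist b x z)%:R <= r.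
  rewrite /w; have [->|] := eqVneq z x; last by rewrite eqxx.
  by rewrite gdistxx (le_trans ler01).
have w0 z : 0 <= w z by rewrite ler0n.
have := hS (D := [:: x]) isT w0 hw.
have q0 : 0 < 2 * n / (n - 2) by rewrite divr_gt0 ?mulr_gt0// subr_gt0.
rewrite !big_seq1 /w eqxx powR1 mulr1 -/V -/A.
have -> : ip m [:: x] (fun z => (z == x)%:R) (fun z => (z == x)%:R) = m x.
  by rewrite /ip big_seq1 eqxx !mulr1.
have -> : Qf b m [:: x] (fun z => (z == x)%:R) = m x.
  rewrite /Qf /ip /bf !big_seq1 eqxx !mulr1.
  by rewrite (graph_irr bg) subr0.
move=> h; have mx := m_gt0 x.
have h2 : m x / r ^+ 2 <= m x.
  by rewrite ler_pdivrMr ?exprn_gt0// ler_peMr ?(ltW mx)// exprn_ege1.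
have {}h : m x `^ (1 - 2 / n) <= A * (3 * m x).
  by apply: le_trans h _; rewrite ler_wpM2l ?(ltW sobolev_A_gt0)//; lra.
have h3 : V `^ (2 / n) <= 3 * phi * r ^+ 2 * m x `^ (2 / n).
  have V2 : 0 < V `^ (2 / n) by rewrite powR_gt0.
  have := ler_wpM2r (powR_ge0 (m x) (2 / n)) h; rewrite pow_conj// => h4.
  rewrite -(@ler_pM2l _ (m x))//.
  have -> : m x * (3 * phi * r ^+ 2 * m x `^ (2 / n)) = V `^ (2 / n) * (A * (3 * m x) * m x `^ (2 / n)).
    by rewrite /A; field; rewrite gt_eqF.
  by rewrite mulrC ler_wpM2l ?(ltW V2).
have p3 : 0 < 3 * phi by rewrite mulr_gt0.
rewrite /lowc powRN mulrC ler_pdivrMr ?powR_gt0//.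
have n20 : 0 <= n / 2 by rewrite divr_ge0 ?(ltW n0).
have e1 : 2 / n * (n / 2) = 1 by field; rewrite gt_eqF.
have rhs0 : 0 <= 3 * phi * r ^+ 2 * m x `^ (2 / n).
  by rewrite !mulr_ge0 ?powR_ge0 ?exprn_ge0 ?(ltW phi0) ?(ltW r0).
have h5 : (V `^ (2 / n)) `^ (n / 2) <= (3 * phi * r ^+ 2 * m x `^ (2 / n)) `^ (n / 2).
  by apply: ge0_ler_powR => //; rewrite nnegrE ?powR_ge0.
rewrite -powRrM e1 powRr1 ?(ltW V0)// in h5.
apply: le_trans h5 _.
rewrite powRM ?mulr_ge0 ?powR_ge0 ?exprn_ge0 ?(ltW phi0) ?(ltW r0)// -powRrM e1 powRr1 ?(ltW mx)//.
rewrite (powRM _ (ltW p3)) ?exprn_ge0 ?(ltW r0)//.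
rewrite -(powR_mulrn 2 (ltW r0)) -powRrM.
have -> : 2 * (n / 2) = n by field.
by rewrite le_eqVlt; apply/orP; left; apply/eqP; ring.
Qed.

(** Test with the cutoff between [s/2] and [s]. For [s >= 4] its slope is at most [4/s], which gives
    [16/s^2]; the [l2] term adds [1/s^2], as [s <= r]. *)
Lemma volume_step s : 4 <= s -> s <= r ->
  vol b m x (s / 2) `^ (1 - 2 / n) <= A * (17 / s ^+ 2 * vol b m x s).
Proof.
move=> s4 sr; have n0 : 0 < n by apply: lt_trans hn.
have s0 : 0 < s by lra.
have r0 : 0 < r by apply: lt_le_trans r1.
(* [D] contains all neighbours of the ball, so no mass is lost there and [kill] reduces to
   [m / r^2]. *)
pose D := nclosure (ballseq x r); have uD : uniq D by apply: nclosure_uniq.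
have inD z : (gdist b x z)%:R <= r -> z \in D by move=> h; apply: sub_nclosure; rewrite mem_ballseq.
pose eta z := cutoff s (s / 2) (gdist b x z)%:R.
have hg : 1 < s - s / 2 by lra.
have e0 z : 0 <= eta z by apply: cutoff_ge0.
have hs z : eta z != 0 -> (gdist b x z)%:R <= s by move=> /(cutoff_neq0 hg); lra.
have hw z : eta z != 0 -> (gdist b x z)%:R <= r by move=> /hs; lra.
have th : 0 < 1 - 2 / n by rewrite subr_gt0 ltr_pdivrMr// mul1r.
have vs0 : 0 <= vol b m x (s / 2) by apply: ltW; apply: vol_gt0; lra.
apply: le_trans (le_trans (hS uD e0 hw) _); last first.
  rewrite -/V -/A ler_wpM2l ?(ltW sobolev_A_gt0)//.
  rewrite -/(energy b m D r eta) (energyE m D b_sym r eta).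
  have Lip : forall z z', 0 < b z z' -> `|(gdist b x z)%:R - (gdist b x z')%:R : R| <= 1.
    by move=> z z'; apply: gdist_lip.
  have e1 := cutoff_energy b_ge0 b_sym (fun z => b_le_seq z uD) (v := fun=> 1) Lip hg (fun=> ler01).
  have vE : \sum_(z <- D | (gdist b x z)%:R <= s) m z * 1 ^+ 2 = vol b m x s.
    rewrite (vol_seq uD); first by apply: eq_bigr => z _; rewrite expr1n mulr1.
    by move=> z h; apply: inD; lra.
  rewrite vE in e1.
  have e2 : \sum_(z <- D) \sum_(y <- D) b z y * (eta z - eta y) ^+ 2 <= 16 / s ^+ 2 * vol b m x s.
    apply: le_trans (le_trans e1 _).
      rewrite le_eqVlt; apply/orP; left; apply/eqP.
      by apply: eq_bigr => z _; apply: eq_bigr => y _; rewrite !mulr1.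
    rewrite ler_wpM2r//; first by apply: ltW; apply: vol_gt0; lra.
    have -> : 16 / s ^+ 2 = ((s / 4)^-1) ^+ 2 by field; rewrite gt_eqF.
    rewrite lerXn2r ?nnegrE ?invr_ge0//; try lra.
    by rewrite lef_pV2 ?posrE; lra.
  have e3 : \sum_(z <- D) kill b m D r z * eta z ^+ 2 <= s ^- 2 * vol b m x s.
    rewrite (vol_seq uD); last by move=> z h; apply: inD; lra.
    rewrite mulr_sumr [leRHS]big_mkcond /=; apply: ler_sum => z _.
    case: ifP => hz; last first.
      have -> : eta z = 0 by apply/eqP; apply/negP => /negP /hs; rewrite hz.
      by rewrite expr0n mulr0.
    rewrite /kill.
    have -> : \sum_(y <- D) b z y = m z.
      rewrite m_nbs; apply: sum_supp_eq => //; first exact: ballseq_uniq; last by move=> y; exact: mem_nbs.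
      move=> y bzy; rewrite mem_undup mem_cat; apply/orP; right; apply/flattenP.
      exists (nbs z); last exact: mem_nbs.
      by apply: map_f; rewrite mem_ballseq; lra.
    have -> : (2 * (m z - m z) + m z / r ^+ 2) * eta z ^+ 2 = r ^- 2 * eta z ^+ 2 * m z by ring.
    rewrite ler_wpM2r ?(ltW (m_gt0 z))//.
    apply: le_trans (_ : r ^- 2 <= _).
      by rewrite ler_piMr ?invr_ge0 ?sqr_ge0// expr_le1 ?cutoff_le1 ?cutoff_ge0.
    by rewrite lef_pV2 ?posrE ?exprn_gt0// lerXn2r ?nnegrE ?(ltW s0) ?(ltW r0).
  apply: le_trans (lerD e2 e3) _.
  by rewrite le_eqVlt; apply/orP; left; apply/eqP; field; rewrite gt_eqF.
apply: ge0_ler_powR; rewrite ?nnegrE ?(ltW th)//.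
  by apply: sumr_ge0 => z _; rewrite mulr_ge0 ?powR_ge0// ltW.
rewrite (vol_seq uD); last by move=> z h; apply: inD; lra.
rewrite big_mkcond /=; apply: ler_sum => z _; case: ifP => h.
  by rewrite /eta cutoff1// powR1 mulr1.
by rewrite mulr_ge0 ?powR_ge0// ltW.
Qed.

(** Induction on the number of halvings that bring [s] below [4], where the vertex [x] alone has
    enough volume. *)
Lemma volume_lower s : 0 < s -> s <= r -> dblc phi n * (s / r) `^ n * V <= vol b m x s.
Proof.
have n0 : 0 < n by apply: lt_trans hn.
have r0 : 0 < r by apply: lt_le_trans r1.
have V0 := sobolev_V_gt0.
have c0 := dblc_gt0 n phi0.
have base s' : 0 < s' -> s' < 4 -> dblc phi n * (s' / r) `^ n * V <= vol b m x s'.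
  move=> s0 s4; apply: le_trans (m_le_vol x (ltW s0)).
  have rn : 0 < r `^ n by rewrite powR_gt0.
  rewrite powRM ?invr_ge0 ?(ltW s0) ?(ltW r0)// -powR_inv1 ?(ltW r0)// -powRrM mulN1r powRN.
  have -> : dblc phi n * (s' `^ n / r `^ n) * V = dblc phi n * s' `^ n * V / r `^ n by ring.
  rewrite ler_pdivrMr//; apply: le_trans low_volume; rewrite ler_wpM2r ?(ltW V0)//.
  apply: le_trans (_ : lowc phi n * 4 `^ (- n) * s' `^ n <= _).
    by rewrite ler_wpM2r ?powR_ge0// ge_min lexx.
  rewrite -mulrA ler_piMr ?(ltW (lowc_gt0 _ phi0))// powRN mulrC ler_pdivrMr ?powR_gt0// mul1r.
  by apply: ge0_ler_powR; rewrite ?nnegrE ?(ltW n0) ?(ltW s0)// ltW.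
have key k : forall s', 0 < s' -> s' <= r -> s' < 4 * 2 ^+ k ->
    dblc phi n * (s' / r) `^ n * V <= vol b m x s'.
  elim: k => [|k IH] s' s0 sr sk; first by apply: base => //; move: sk; rewrite expr0 mulr1.
  have [s4|s4] := ltP s' 4; first exact: base.
  have s20 : 0 < s' / 2 by rewrite divr_gt0.
  have s2r : s' / 2 <= r by lra.
  have s2k : s' / 2 < 4 * 2 ^+ k by move: sk; rewrite exprS; lra.
  have h1 := IH _ s20 s2r s2k.
  have h2 := volume_step s4 sr.
  have A0 := sobolev_A_gt0.
  have th : 0 < 1 - 2 / n by rewrite subr_gt0 ltr_pdivrMr// mul1r.
  have sr0 : 0 < s' / r by rewrite divr_gt0.
  have p2 : 0 < (s' / 2 / r) `^ n by rewrite powR_gt0// divr_gt0.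
  have h3 : (dblc phi n * (s' / 2 / r) `^ n * V) `^ (1 - 2 / n) <= A * (17 / s' ^+ 2 * vol b m x s').
    apply: le_trans h2; apply: ge0_ler_powR; rewrite ?nnegrE ?(ltW th)//.
      by rewrite !mulr_ge0 ?(ltW c0) ?(ltW V0) ?(ltW p2).
    by apply: ltW; apply: vol_gt0; exact: ltW.
  have h4 : s' ^+ 2 / (17 * A) * (dblc phi n * (s' / 2 / r) `^ n * V) `^ (1 - 2 / n) <= vol b m x s'.
    have q0 : 0 < s' ^+ 2 / (17 * A) by apply: divr_gt0; [exact: exprn_gt0|exact: mulr_gt0].
    have := ler_wpM2l (ltW q0) h3; move=> h; apply: le_trans h _.
    by rewrite le_eqVlt; apply/orP; left; apply/eqP; field; rewrite !gt_eqF.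
  apply: le_trans h4.
  set c := dblc phi n in c0 *.
  have hc : c `^ (2 / n) <= 2 `^ (2 - n) / (17 * phi).
    have d0 : 0 <= 2 `^ (2 - n) / (17 * phi) by rewrite divr_ge0 ?powR_ge0 ?mulr_ge0 ?(ltW phi0).
    have : c <= (2 `^ (2 - n) / (17 * phi)) `^ (n / 2) by rewrite /c /dblc ge_min lexx orbT.
    move=> /(@ge0_ler_powR R (2 / n) _) h; apply: le_trans (h _ _ _) _.
    - by rewrite divr_ge0 ?(ltW n0).
    - by rewrite nnegrE ltW.
    - by rewrite nnegrE powR_ge0.
    rewrite -powRrM (_ : n / 2 * (2 / n) = 1) ?powRr1//.
    by field; rewrite gt_eqF.
  have z0 : 0 < s' / r by rewrite divr_gt0.
  have -> : (c * (s' / 2 / r) `^ n * V) `^ (1 - 2 / n) =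
     c `^ (1 - 2 / n) * ((s' / r) `^ n / (s' / r) ^+ 2 * 2 `^ (2 - n)) * (V / V `^ (2 / n)).
    have cp0 : 0 <= c * (s' / 2 / r) `^ n by apply: mulr_ge0; exact: ltW.
    rewrite (powRM _ cp0 (ltW V0)) (powRM _ (ltW c0) (ltW p2)); congr (_ * _ * _); last first.
      by rewrite -{2}(pow_conj V0) mulfK// gt_eqF// powR_gt0.
    rewrite -powRrM (_ : n * (1 - 2 / n) = n - 2); last by field; rewrite gt_eqF.
    have -> : s' / 2 / r = s' / r * 2^-1 by field; rewrite gt_eqF.
    rewrite powRM ?invr_ge0 ?(ltW z0)//; congr (_ * _).
      rewrite powRD; last by rewrite (gt_eqF z0) implybT.
      by rewrite powRN powR_mulrn// ltW.
    by rewrite -powR_inv1// -powRrM; congr (_ `^ _); ring.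
  have -> : s' ^+ 2 / (17 * A) * (c `^ (1 - 2 / n) * ((s' / r) `^ n / (s' / r) ^+ 2 * 2 `^ (2 - n)) * (V / V `^ (2 / n))) =
     (2 `^ (2 - n) / (17 * phi)) * (c `^ (1 - 2 / n) * (s' / r) `^ n * V).
    by rewrite /A; field; rewrite !gt_eqF// powR_gt0.
  have -> : c * (s' / r) `^ n * V = c `^ (2 / n) * (c `^ (1 - 2 / n) * (s' / r) `^ n * V).
    by rewrite -{1}(pow_conj c0); ring.
  apply: ler_wpM2r => //; apply: mulr_ge0; last exact: ltW.
  by apply: mulr_ge0; exact: powR_ge0.
move=> s0 sr; apply: (key (Num.Def.archi_bound s)) => //.
apply: lt_trans (archi_boundP (ltW s0)) _.
apply: lt_le_trans (_ : 2 ^+ Num.Def.archi_bound s <= _); first by rewrite -natrX ltr_nat ltn_expl.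
by rewrite ler_peMl ?exprn_ge0// ler1n.
Qed.

End SobolevAtPoint.

End NormalizedGraph.

(** * Gaussian bounds *)

Section Arsinh.
Variables (R : realType) (t rho : R).
Hypothesis t0 : 0 < t.
Hypothesis rho0 : 0 <= rho.
Let lam := arsinh (rho / t).
Let s := Num.sqrt ((rho / t) ^+ 2 + 1).

Lemma arsinh_sqrt_gt0 : 0 < s.
Proof. by rewrite sqrtr_gt0 ltr_wpDl// sqr_ge0. Qed.

Lemma arsinh_ge0 : 0 <= lam.
Proof.
rewrite /lam /arsinh; apply: ln_ge0; apply: ler_wpDl; first by rewrite divr_ge0// ltW.
by rewrite -[leLHS]sqrtr1; apply: ler_wsqrtr; rewrite lerDr sqr_ge0.
Qed.

Lemma expR_arsinh : expR lam = rho / t + s.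
Proof.
have s0 := arsinh_sqrt_gt0; have z0 : 0 <= rho / t by rewrite divr_ge0// ltW.
by rewrite /lam /arsinh lnK// posrE ltr_wpDl.
Qed.

Lemma expRN_arsinh : expR (- lam) = s - rho / t.
Proof.
have s0 := arsinh_sqrt_gt0; have z0 : 0 <= rho / t by rewrite divr_ge0// ltW.
have p : 0 < rho / t + s by rewrite ltr_wpDl.
rewrite expRN expR_arsinh; apply: (mulfI (lt0r_neq0 p)); rewrite mulfV ?gt_eqF//.
have : s ^+ 2 = (rho / t) ^+ 2 + 1 by rewrite sqr_sqrtr// addr_ge0// sqr_ge0.
move: (rho / t) => z hs; have -> : (z + s) * (s - z) = s ^+ 2 - z ^+ 2 by ring.
by rewrite hs; ring.
Qed.

Lemma cosh1_arsinh : cosh1 lam = s.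
Proof. by rewrite /cosh1 expR_arsinh expRN_arsinh; field; rewrite gt_eqF. Qed.

Lemma cosh1_arsinh_scaled : t * (cosh1 lam - 1) = Num.sqrt (t ^+ 2 + rho ^+ 2) - t.
Proof.
rewrite cosh1_arsinh mulrBr mulr1; congr (_ - _).
rewrite -{1}[t]ger0_norm ?(ltW t0)// -sqrtr_sqr -sqrtrM ?sqr_ge0//; congr Num.sqrt.
by field; rewrite gt_eqF.
Qed.

(** [lam] solves [sinh lam = rho / t], hence maximizes [rho lam - t (cosh lam - 1)]: [zeta] is the
    Legendre transform of the growth rate in Davies' estimate. *)
Lemma zeta_arsinh : zeta 1 rho t = rho * lam - t * (cosh1 lam - 1).
Proof. by rewrite cosh1_arsinh_scaled /zeta !expr1n invr1 !mulr1 mul1r -/lam; ring. Qed.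

End Arsinh.

(** The right-hand side is the square of [2 (e^(l/2) - e^(-l/2))], which is at least [l]. *)
Lemma cosh1_ge (R : realType) (l : R) : 0 <= l -> l ^+ 2 <= 8 * (cosh1 l - 1).
Proof.
move=> l0; pose a := expR (l / 2); pose c := expR (- (l / 2)).
have h1 : 1 + l / 2 <= a by apply: expR_ge1Dx.
have h2 : c <= 1 by rewrite -[X in _ <= X]expR0 ler_expR; lra.
have -> : 8 * (cosh1 l - 1) = (2 * (a - c)) ^+ 2.
  have ea : expR l = a ^+ 2 by rewrite -expRM_natl; congr expR; field.
  have ec : expR (- l) = c ^+ 2 by rewrite -expRM_natl; congr expR; field.
  have ac : a * c = 1 by rewrite -expRD subrr expR0.
  rewrite /cosh1 ea ec; transitivity (4 * (a ^+ 2 + c ^+ 2 - 2)); first by field.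
  transitivity (4 * (a ^+ 2 + c ^+ 2) - 8 * (a * c)); last by ring.
  by rewrite ac; ring.
rewrite lerXn2r ?nnegrE//; lra.
Qed.

(** The radius is [tau / sqrt (2 s2)]: as [lam^2 <= 8 c <= 8 s2/t] and [r^2 <= t / (2 s2)], the
    product [lam r] is at most [2]. The last hypothesis says [r >= R1]; it also gives [s2 <= t] and
    so [c <= 1]. *)
Lemma scale_choice (R : realType) (R1 t tau c s0 s2 lam : R) : 64 <= R1 -> 0 < t -> 0 < tau ->
  tau ^+ 2 <= t -> t * c = s0 -> 1 <= s2 -> s0 <= s2 -> 0 <= lam -> lam ^+ 2 <= 8 * c ->
  2 * s2 * R1 ^+ 2 <= tau ^+ 2 ->
  exists r, [/\ R1 <= r, r <= tau, 2 * r ^+ 2 <= tau ^+ 2, lam * r <= 2 &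
    c <= 1 /\ r / tau = (2 * s2) `^ (- 2^-1)].
Proof.
move=> R64 t0 tau0 tau2t cl s21 s0s2 lam0 hlam hr.
have R10 : 0 < R1 by lra.
have s20 : 0 < s2 by lra.
have ss0 : 0 < 2 * s2 by lra.
pose r := tau / Num.sqrt (2 * s2).
have r0 : 0 < r by rewrite divr_gt0 ?sqrtr_gt0.
have rsq : r ^+ 2 = tau ^+ 2 / (2 * s2).
  by rewrite /r exprMn exprVn sqr_sqrtr ?(ltW ss0).
have s2t : s2 <= t.
  have h1 : 1 <= R1 ^+ 2 by rewrite exprn_ege1//; lra.
  have : s2 * 1 <= s2 * (2 * R1 ^+ 2) by rewrite ler_wpM2l ?(ltW s20)//; lra.
  move: hr tau2t; lra.
exists r; split.
- rewrite -(@ler_pXn2r _ 2) ?nnegrE ?(ltW R10) ?(ltW r0)//.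
  by rewrite rsq ler_pdivlMr// mulrC.
- rewrite -(@ler_pXn2r _ 2) ?nnegrE ?(ltW tau0) ?(ltW r0)//.
  by rewrite rsq ler_pdivrMr// ler_peMr ?sqr_ge0//; lra.
- rewrite rsq mulrA ler_pdivrMr// mulrC ler_wpM2l ?sqr_ge0//; lra.
- have lr0 : 0 <= lam * r by apply: mulr_ge0 => //; exact: ltW.
  rewrite -(@ler_pXn2r _ 2) ?nnegrE// exprMn.
  apply: le_trans (_ : 8 * c * r ^+ 2 <= _); first by rewrite ler_wpM2r ?sqr_ge0.
  have e1 : c <= s2 / t by rewrite ler_pdivlMr// mulrC cl.
  apply: le_trans (_ : 8 * (s2 / t) * (t / (2 * s2)) <= _).
    apply: ler_pM; rewrite ?sqr_ge0//.
    + by apply: le_trans hlam; rewrite sqr_ge0.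
    + by rewrite ler_wpM2l.
    + by rewrite rsq ler_wpM2r ?invr_ge0 ?(ltW ss0).
  by rewrite le_eqVlt; apply/orP; left; apply/eqP; field; rewrite !gt_eqF.
- split; first by rewrite -(@ler_pM2l _ t)// cl mulr1; lra.
  rewrite /r powRN powR12_sqrt ?(ltW ss0)//; field.
  by rewrite !gt_eqF// sqrtr_gt0.
Qed.

Lemma ratio_bound (R : realType) (C V V' d p s : R) : 0 <= C -> 0 < V' -> 0 < d -> 0 < p -> 0 < s ->
  d * (p / s) * V <= V' -> C / V' * V <= C / (d * p) * s.
Proof.
move=> C0 V0 d0 p0 s0 h; rewrite mulrAC ler_pdivrMr//.
have -> : C / (d * p) * s * V' = C * (s / (d * p) * V') by ring.
rewrite ler_wpM2l// -(@ler_pM2l _ (d * p / s)) ?divr_gt0 ?mulr_gt0//.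
have -> : d * p / s * (s / (d * p) * V') = V' by field; rewrite !gt_eqF.
by rewrite -[d * p / s]mulrA.
Qed.

(** * The Gaussian upper bound *)

Section Gaussian.
Variables (R : realType) (X : countType) (b : X -> X -> R) (m : X -> R).
Hypothesis G : normalized_graph b m.
Let bg := ngraph_graph G.
Let b_ge0 : forall x y, 0 <= b x y := graph_ge0 bg.
Let b_sym : forall x y, b x y = b y x := graph_sym bg.
Let m_gt0 : forall x, 0 < m x := ngraph_gt0 G.
Let b_conn := ngraph_connected G.

Definition sobolev_at (phi n R1 R2 : R) (x : X) : Prop := forall r D, R1 <= r -> r <= R2 -> uniq D ->
  sobolev_on b m D (fun z => (gdist b x z)%:R) (phi * r ^+ 2 / vol b m x r `^ (2 / n)) r n.

Ltac goal_lra := clear -b_ge0 b_sym m_gt0 b_conn; lra.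

(** [psiA] serves radii at least [R1], [psiB] the opposite case. The [6] is the sum of
    [2 lam r <= 4] and [2 (cosh lam - 1) <= 2], the latter from using time [t/2 + 1] instead of
    [t/2]; the power of [2] comes from [r / tau = (2 s2)^(-1/2)]. *)
Definition psiA (phi n : R) : R :=
  mvC n phi (lowc phi n) * expR 6 / (dblc phi n * 2 `^ (- (n / 2))).
Definition psiB (phi n R1 : R) : R := (2 * R1 ^+ 2) `^ (n / 2) / lowc phi n.

(** With the positive part of [Lambda] as rate, the decay factor is monotone in the elapsed time. *)
Lemma l0_rayleigh D w : uniq D -> Num.max (Lambda b m) 0 * ip m D w w <= Qf b m D w.
Proof.
move=> uD; case: (leP (Lambda b m) 0) => _; last exact: Lambda_le_rayleigh.
by rewrite mul0r; apply: Qf_ge0 => // x; apply: b_le_seq.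
Qed.

Lemma sqrt_scale (k1 k2 v1 v2 : R) : 0 <= k1 -> 0 <= k2 -> 0 < v1 -> 0 < v2 ->
  forall c, 0 <= c -> k1 * v1 <= c -> k2 * v2 <= c -> Num.sqrt (k1 * k2) <= c / Num.sqrt (v1 * v2).
Proof.
move=> k10 k20 v10 v20 c c0 h1 h2.
have vv : 0 < v1 * v2 by rewrite mulr_gt0.
rewrite ler_pdivlMr ?sqrtr_gt0// -sqrtrM ?mulr_ge0//.
rewrite -[leRHS]ger0_norm// -sqrtr_sqr; apply: ler_wsqrtr.
rewrite expr2 mulrACA; apply: ler_pM => //; rewrite mulr_ge0// ltW//.
Qed.

(* Let [s2 = max 1 (sqrt (t^2 + rho^2) - t)].  If [r = tau / sqrt (2 s2)] is at least [R1], the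
   mean value inequality in balls of radius [r] applies and [V(tau) / V(r)] is of order
   [s2^(n/2)].  Otherwise [V(tau) / m] itself is of that order and the weighted [l2] bound
   suffices. *)
Lemma gaussian_bound (phi n R1 R2 : R) (x y : X) (t : R) :
  0 < phi -> 2 < n -> 64 <= R1 -> 8 * R1 <= R2 ->
  sobolev_at phi n R1 R2 x -> sobolev_at phi n R1 R2 y -> (4 * R1) ^+ 2 <= t ->
  let rho : R := (gdist b x y)%:R in
  let tau := Num.min (Num.sqrt t) R2 in
  heat_kernel b m t x y <= (psiA phi n + psiB phi n R1) *
    (Num.max 1 (Num.sqrt (t ^+ 2 + rho ^+ 2) - t) `^ (n / 2) / Num.sqrt (vol b m x tau * vol b m y tau)) *
    expR (- Lambda b m * (t - Num.min t (R2 ^+ 2)) - zeta 1 rho t).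
Proof.
move=> phi0 hn R64 R12 hx hy ht; cbv zeta.
set rho : R := (gdist b x y)%:R; set tau := Num.min (Num.sqrt t) R2.
have n0 : 0 < n by lra.
have R10 : 0 < R1 by lra.
have R20 : 0 < R2 by lra.
have R1sq : 64 * 64 <= R1 ^+ 2 by rewrite expr2; apply: ler_pM.
have t16 : 16 * R1 ^+ 2 <= t.
  by apply: le_trans ht; rewrite exprMn -natrX.
have t0 : 0 < t by lra.
have rho0 : 0 <= rho by rewrite ler0n.
set s0 := Num.sqrt (t ^+ 2 + rho ^+ 2) - t.
set s2 := Num.max 1 s0.
have s21 : 1 <= s2 by rewrite le_max lexx.
have s20 : 0 < s2 by lra.
pose lam := arsinh (rho / t).
have lam0 : 0 <= lam by apply: arsinh_ge0.
have cl : t * (cosh1 lam - 1) = s0 by apply: cosh1_arsinh_scaled.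
have zE : zeta 1 rho t = rho * lam - s0 by rewrite zeta_arsinh// -/lam cl.
have tau0 : 0 < tau by rewrite lt_min sqrtr_gt0 t0.
have tau2 : tau ^+ 2 = Num.min t (R2 ^+ 2).
  rewrite /tau; case: (leP (Num.sqrt t) R2) => h.
    rewrite sqr_sqrtr ?(ltW t0)// min_l//.
    by rewrite -(sqr_sqrtr (ltW t0)) lerXn2r ?nnegrE ?sqrtr_ge0 ?(ltW R20).
  rewrite min_r// -(sqr_sqrtr (ltW t0)) lerXn2r ?nnegrE ?sqrtr_ge0 ?(ltW R20)//; exact: ltW.
have tauR1 : R1 <= tau.
  rewrite le_min; apply/andP; split; last by lra.
  rewrite -[leLHS]ger0_norm ?(ltW R10)// -sqrtr_sqr; apply: ler_wsqrtr; lra.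
have tauR2 : tau <= R2 by rewrite ge_min lexx orbT.
have tau2t : tau ^+ 2 <= t by rewrite tau2 ge_min lexx.
set l0 := Num.max (Lambda b m) 0.
have l00 : 0 <= l0 by rewrite le_max lexx orbT.
have l0L : Lambda b m <= l0 by rewrite le_max lexx.
have lexp (a : R) : t - tau ^+ 2 <= a -> - (l0 * a) <= - Lambda b m * (t - tau ^+ 2).
  move=> ha; have h1 : 0 <= t - tau ^+ 2 by rewrite subr_ge0.
  have h2 := ler_wpM2l l00 ha; have h3 := ler_wpM2r h1 l0L; lra.
have Vx0 : 0 < vol b m x tau by apply: (vol_gt0 G); exact: ltW.
have Vy0 : 0 < vol b m y tau by apply: (vol_gt0 G); exact: ltW.
have sV : 0 < Num.sqrt (vol b m x tau * vol b m y tau) by rewrite sqrtr_gt0 mulr_gt0.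
have sp0 : 0 < s2 `^ (n / 2) by rewrite powR_gt0.
have c0 := lowc_gt0 n phi0.
have d0 := dblc_gt0 n phi0.
have A0 : 0 <= psiA phi n by apply: divr_ge0; apply: mulr_ge0; rewrite ?mvC_ge0 ?expR_ge0 ?powR_ge0 ?(ltW d0).
have B0 : 0 <= psiB phi n R1 by rewrite divr_ge0 ?powR_ge0 ?(ltW c0).
rewrite -tau2 zE heat_kernelE//.
apply: (hk_le_heat G (ltW t0)) => D uD xD yD.
have bD z := b_le_seq G z uD.
(* The weight is [0] at [y] and [lam rho] at [x]. The factor [e^(om y - om x) = e^(-lam rho)] and
   the growth [e^(s0)] of the two half-time norms combine to [e^(-zeta)]. *)
pose om z : R := lam * (gdist b y z)%:R.
have omlip z w : 0 < b z w -> `|om z - om w| <= lam.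
  move=> bzw; rewrite /om -mulrBr normrM ger0_norm// ler_piMr//.
  exact: (gdist_lip bg b_conn y bzw).
have omlipN z w : 0 < b z w -> `|- om z - - om w| <= lam.
  by move=> bzw; rewrite -opprD normrN; apply: omlip.
have omy : om y = 0 by rewrite /om gdistxx mulr0.
have omx : om x = lam * rho by rewrite /om /rho (gdistC bg b_conn).
have hQ w : l0 * ip m D w w <= Qf b m D w by apply: l0_rayleigh.
have t20 : 0 <= t / 2 by rewrite divr_ge0// ltW.
have concl (K e : R) (k1 k2 : R) : 0 <= K -> 0 <= k1 -> 0 <= k2 ->
   wnorm b m D om y (t / 2) <= k1 * expR e * expR (2 * om y) ->
   wnorm b m D (fun z => - om z) x (t / 2) <= k2 * expR e * expR (2 * - om x) ->
   k1 * vol b m y tau <= K * s2 `^ (n / 2) -> k2 * vol b m x tau <= K * s2 `^ (n / 2) ->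
   forall K', 0 <= K' -> e <= K' + (s0 - Lambda b m * (t - tau ^+ 2)) ->
   heat b m (fun _ => D) (dirac_at m y) t x <=
   (K * expR K') * (s2 `^ (n / 2) / Num.sqrt (vol b m x tau * vol b m y tau)) *
     expR (- Lambda b m * (t - tau ^+ 2) - (rho * lam - s0)).
  move=> K0 k10 k20 w1 w2 v1 v2 K' K'0 he.
  have := heat_dirac_le b_ge0 b_sym m_gt0 bD uD (ltW t0) yD xD
    (mulr_ge0 k10 (expR_ge0 e)) (mulr_ge0 k20 (expR_ge0 e)) w1 w2.
  move=> h; apply: le_trans h _.
  have -> : Num.sqrt (k1 * expR e * (k2 * expR e)) = Num.sqrt (k1 * k2) * expR e.
    rewrite mulrACA sqrtrM ?mulr_ge0//; congr (_ * _).
    by rewrite -expr2 sqrtr_sqr ger0_norm ?expR_ge0.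
  have := sqrt_scale k10 k20 Vy0 Vx0 (mulr_ge0 K0 (ltW sp0)) v1 v2.
  rewrite [vol b m y tau * _]mulrC => hs.
  rewrite omy omx sub0r -mulrA -expRD.
  apply: le_trans (_ : K * s2 `^ (n / 2) / Num.sqrt (vol b m x tau * vol b m y tau) *
     expR (K' + (- Lambda b m * (t - tau ^+ 2) - (rho * lam - s0))) <= _).
    apply: ler_pM => //; rewrite ?sqrtr_ge0 ?expR_ge0// ler_expR.
    move: he; rewrite [lam * rho]mulrC; goal_lra.
  by rewrite expRD le_eqVlt; apply/orP; left; apply/eqP; ring.
have factor (K C : R) : K <= C -> 
   K * (s2 `^ (n / 2) / Num.sqrt (vol b m x tau * vol b m y tau)) *
     expR (- Lambda b m * (t - tau ^+ 2) - (rho * lam - s0)) <=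
   C * (s2 `^ (n / 2) / Num.sqrt (vol b m x tau * vol b m y tau)) *
     expR (- Lambda b m * (t - tau ^+ 2) - (rho * lam - s0)).
  by move=> KC; rewrite ler_wpM2r ?expR_ge0// ler_wpM2r// divr_ge0 ?ltW.
have R11 : 1 <= R1 by move: R64; goal_lra.
have tau1 : 1 <= tau by apply: le_trans tauR1.
have [hr|hr] := leP (2 * s2 * R1 ^+ 2) (tau ^+ 2).
- have s2lt : s0 <= s2 by rewrite le_max lexx orbT.
  have [r [rR1 rtau r2tau lamr [coshle rE]]] := scale_choice R64 t0 tau0 tau2t cl s21 s2lt lam0 (cosh1_ge lam0) hr.
  have r0 : 0 < r by apply: lt_le_trans rR1.
  have rR2 : r <= R2 by apply: le_trans tauR2.
  have r8 : 8 <= r by move: rR1 R64; goal_lra.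
  have r1 : 1 <= r by move: r8; goal_lra.
  have hm z : sobolev_at phi n R1 R2 z -> lowc phi n * vol b m z r <= m z * r `^ n.
    by move=> hz; apply: (low_volume G phi0 hn r1) => D' uD'; apply: hz.
  have rt : r ^+ 2 < t / 2 + 1 by move: r2tau tau2t; goal_lra.
  set C1 := mvC n phi (lowc phi n).
  have C10 : 0 <= C1 by apply: mvC_ge0.
  have lipd o z w : 0 < b z w -> `|(gdist b o z)%:R - (gdist b o w)%:R : R| <= 1.
    exact: gdist_lip.
  have Vr z : 0 < vol b m z r by apply: (vol_gt0 G); exact: ltW.
  pose e := 2 * (lam * r) + 2 * ((cosh1 lam - 1) * (t / 2 + 1)) - 2 * (l0 * (t / 2 + 1 - r ^+ 2)).
  have vk z : sobolev_at phi n R1 R2 z ->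
     C1 / vol b m z r * vol b m z tau <= C1 / (dblc phi n * 2 `^ (- (n / 2))) * s2 `^ (n / 2).
    move=> hz; have := @volume_lower R X b m G phi n tau z phi0 hn tau1 (fun D' uD' => hz tau D' tauR1 tauR2 uD') r r0 rtau.
    have -> : (r / tau) `^ n = 2 `^ (- (n / 2)) / s2 `^ (n / 2).
      rewrite rE.
      rewrite -powRrM powRM ?(ltW s20)//.
      have -> : - 2^-1 * n = - (n / 2) by ring.
      by rewrite [s2 `^ (- _)]powRN.
    by apply: ratio_bound => //; rewrite powR_gt0.
  apply: le_trans (concl (C1 / (dblc phi n * 2 `^ (- (n / 2)))) e (C1 / vol b m y r) (C1 / vol b m x r) _ _ _ _ _ _ _ 6 _ _) _.
  + by rewrite divr_ge0// mulr_ge0 ?(ltW d0) ?powR_ge0.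
  + by rewrite divr_ge0// ltW.
  + by rewrite divr_ge0// ltW.
  + apply: (wnorm_moser b_ge0 b_sym m_gt0 bD uD lam0 omlip hQ hn phi0 c0 r8 (Vr y) l00 (lipd y)) => //.
    * exact: hy.
    * by rewrite gdistxx.
    * exact: hm.
    * by move=> z; rewrite omy add0r.
  + apply: (wnorm_moser b_ge0 b_sym m_gt0 bD uD lam0 omlipN hQ hn phi0 c0 r8 (Vr x) l00 (lipd x)) => //.
    * exact: hx.
    * by rewrite gdistxx.
    * exact: hm.
    * move=> z; have h : (gdist b y x)%:R <= (gdist b x z)%:R + (gdist b y z)%:R :> R.
        rewrite -natrD ler_nat addnC; have := gdist_tri b_conn y z x.
        by rewrite [gdist b z x]gdistC.
      by have := ler_wpM2l lam0 h; rewrite /om mulrDr; goal_lra.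
  + exact: vk.
  + exact: vk.
  + by [].
  + have h := lexp (t + 2 - 2 * r ^+ 2); have {}h : - (l0 * (t + 2 - 2 * r ^+ 2)) <= - Lambda b m * (t - tau ^+ 2) by apply: h; move: r2tau; goal_lra.
    rewrite /e; move: h lamr coshle; rewrite -cl; goal_lra.
  + apply: factor; apply: le_trans (_ : psiA phi n <= _); last by rewrite lerDl.
    by rewrite /psiA -/C1 mulrAC.
- pose e := 2 * (cosh1 lam - 1 - l0) * (t / 2).
  have vk z : sobolev_at phi n R1 R2 z -> (m z)^-1 * vol b m z tau <= psiB phi n R1 * s2 `^ (n / 2).
    move=> hz; have := @low_volume R X b m G phi n tau z phi0 hn tau1 (fun D' uD' => hz tau D' tauR1 tauR2 uD').
    move=> h; rewrite mulrC ler_pdivrMr// -(ler_pM2l c0); apply: le_trans h _.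
    have -> : lowc phi n * (psiB phi n R1 * s2 `^ (n / 2) * m z) = m z * ((2 * R1 ^+ 2) `^ (n / 2) * s2 `^ (n / 2)).
      by rewrite /psiB; field; rewrite gt_eqF.
    have R1q : 0 <= 2 * R1 ^+ 2 by apply: mulr_ge0 => //; exact: sqr_ge0.
    rewrite ler_wpM2l ?(ltW (m_gt0 z))// -(powRM _ R1q (ltW s20)).
    have -> : tau `^ n = (tau ^+ 2) `^ (n / 2).
      by rewrite -(powR_mulrn 2 (ltW tau0)) -powRrM; congr (_ `^ _); field.
    apply: ge0_ler_powR; rewrite ?nnegrE ?divr_ge0 ?sqr_ge0 ?(ltW n0)//.
      by apply: mulr_ge0 => //; exact: ltW.
    by rewrite mulrAC ltW.
  apply: le_trans (concl (psiB phi n R1) e (m y)^-1 (m x)^-1 B0 _ _ _ _ _ _ 0 (lexx 0) _) _.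
  + by rewrite invr_ge0 ltW.
  + by rewrite invr_ge0 ltW.
  + exact: (wnorm_le b_ge0 b_sym m_gt0 bD uD lam0 omlip hQ t20 yD).
  + exact: (wnorm_le b_ge0 b_sym m_gt0 bD uD lam0 omlipN hQ t20 xD).
  + exact: vk.
  + exact: vk.
  + have h := lexp t; have {}h : - (l0 * t) <= - Lambda b m * (t - tau ^+ 2).
      by apply: h; rewrite gerBl sqr_ge0.
    rewrite /e -cl; move: h; goal_lra.
  + by apply: factor; rewrite expR0 mulr1 lerDr.
Qed.

End Gaussian.

(** * From Gaussian bounds to Sobolev inequalities *)

(** This is [tanh x <= x]: the auxiliary [g] has derivative [y (e^y - e^(-y)) >= 0]. *)
Lemma sinh_le_mul_cosh (R : realType) (x : R) : 0 <= x ->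
  expR x - expR (- x) <= x * (expR x + expR (- x)).
Proof.
move=> x0.
pose g (y : R) := expR (-1 * y) * (1 + y) - expR (1 * y) * (1 - y).
pose dg (y : R) := (expR (-1 * y) * (0 + 1) + (-1 * expR (-1 * y)) * (1 + y)) -
  (expR (1 * y) * (0 - 1) + (1 * expR (1 * y)) * (1 - y)).
have dgE (y : R) : is_derive y 1 g (dg y).
  have h1 : is_derive y 1 (fun y : R => 1 + y) (0 + 1) by apply: is_deriveD.
  have h2 : is_derive y 1 (fun y : R => 1 - y) (0 - 1) by apply: is_deriveB.
  by apply: is_deriveB; apply: is_deriveMr => //; exact: is_derive_expRl.
have : g 0 <= g x.
  apply: (nondecr_of_derive (df := dg)) => // y /andP[y0 _].
  have : expR (- y) <= expR y by rewrite ler_expR; lra.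
  rewrite /dg mulN1r mul1r => h.
  have : 0 <= y * (expR y - expR (- y)) by rewrite mulr_ge0// subr_ge0.
  lra.
by rewrite /g !mulN1r !mul1r oppr0 expR0; lra.
Qed.

(** With [rho / t = sinh l] the claim is [2 (cosh l - 1) <= l sinh l], which in half angles is
    [tanh (l/2) <= l/2]. *)
Lemma zeta_ge (R : realType) (t rho : R) : 0 < t -> 0 <= rho ->
  Num.sqrt (t ^+ 2 + rho ^+ 2) - t <= zeta 1 rho t.
Proof.
move=> t0 rho0; rewrite zeta_arsinh// -cosh1_arsinh_scaled//.
set l := arsinh (rho / t); have l0 : 0 <= l by apply: arsinh_ge0.
pose a := expR (l / 2); pose c := expR (- (l / 2)).
have ac : a * c = 1 by rewrite -expRD subrr expR0.
have ea : expR l = a ^+ 2 by rewrite -expRM_natl; congr expR; field.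
have ec : expR (- l) = c ^+ 2 by rewrite -expRM_natl; congr expR; field.
have ch : cosh1 l - 1 = (a - c) ^+ 2 / 2.
  transitivity ((a ^+ 2 + c ^+ 2) / 2 - a * c); first by rewrite /cosh1 ea ec ac.
  by field.
have sh : rho / t = (a ^+ 2 - c ^+ 2) / 2.
  by rewrite -ea -ec expR_arsinh// expRN_arsinh//; field; rewrite gt_eqF.
have -> : rho * l - t * (cosh1 l - 1) = t * (rho / t * l - (cosh1 l - 1)).
  by field; rewrite gt_eqF.
rewrite ler_pM2l// ch sh.
have l20 : 0 <= l / 2 by rewrite divr_ge0.
have h1 := sinh_le_mul_cosh l20; rewrite -/a -/c in h1.
have h2 : 0 <= a - c by rewrite subr_ge0 ler_expR; lra.
have := ler_wpM2r h2 h1; rewrite -subr_ge0 => h.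
by rewrite -subr_ge0; apply: le_trans h _; rewrite le_eqVlt; apply/orP; left; apply/eqP; field.
Qed.

(** * Nash's inequality from a bound on the kernel *)

Section HeatNash.
Variables (R : realType) (X : eqType) (b : X -> X -> R) (m : X -> R) (D : seq X).
Hypothesis b_ge0 : forall x y, 0 <= b x y.
Hypothesis b_sym : forall x y, b x y = b y x.
Hypothesis m_gt0 : forall x, 0 < m x.
Hypothesis b_le : forall x, \sum_(y <- D) b x y <= m x.
Hypothesis D_uniq : uniq D.
Let U := heat b m (fun _ => D).

(* The form decreases along the flow: its derivative is [-2 ||v||^2] with [v = u'].
   Hence [||f||^2 - ||U_s f||^2 <= 2 s Q(f)]. *)
Lemma Qf_heat_le (M : R) h (t : R) : (forall x, `|h x| <= M) -> 0 <= t -> 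
  Qf b m D (U h t) <= Qf b m D h.
Proof.
move=> hM t0.
pose v (s : R) x := Pop b m (fun _ => D) (U h s) x - U h s x.
have du (s : R) x : is_derive s 1 (fun s : R => U h s x) (v s x) := is_derive_heat b_ge0 m_gt0 b_le hM s x.
have dP (s : R) x : is_derive s 1 (fun s : R => Pop b m (fun _ => D) (U h s) x) (Pop b m (fun _ => D) (v s) x).
  by apply: is_deriveMl; apply: is_derive_sumr => y; apply: is_deriveMl.
have QE w : Qf b m D w = ip m D w w - ip m D w (Pop b m (fun _ => D) w) by rewrite ip_P.
have dQ (s : R) : is_derive s 1 (fun s : R => Qf b m D (U h s)) (- (2 * ip m D (v s) (v s))).
  apply: is_derive_ext (fun s : R => esym (QE (U h s))) _.
  have := is_deriveB (is_derive_ip m D (du s) (du s)) (is_derive_ip m D (du s) (dP s)).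
  set d := (X in is_derive _ _ _ X -> _) => H.
  have -> : - (2 * ip m D (v s) (v s)) = d; last exact: H.
  have e : ip m D (U h s) (Pop b m (fun _ => D) (v s)) = ip m D (v s) (Pop b m (fun _ => D) (U h s)).
    by rewrite !ip_P// bfC.
  rewrite /d e [ip m D (U h s) (v s)]ipC.
  have -> : ip m D (v s) (v s) = ip m D (v s) (Pop b m (fun _ => D) (U h s)) - ip m D (v s) (U h s).
    by rewrite [LHS](ipBl m D (Pop b m (fun _ => D) (U h s)) (U h s) (v s)) ![ip m D _ (v s)]ipC.
  ring.
have <- : Qf b m D (U h 0) = Qf b m D h.
  by congr Qf; apply/funext => x; rewrite /U heat0.
apply: (@nonincr_of_derive R (fun s : R => Qf b m D (U h s)) _ 0 t t0 (fun s _ => dQ s)) => s _.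
by rewrite oppr_le0 mulr_ge0// ip_ge0.
Qed.

Lemma ip_le_heat (M : R) h (t : R) : (forall x, `|h x| <= M) -> 0 <= t -> 
  ip m D h h <= t * Qf b m D h + ip m D (U h t) h.
Proof.
move=> hM t0; have t20 : 0 <= t / 2 by rewrite divr_ge0.
have := ip_heat b_ge0 b_sym m_gt0 b_le (t / 2) hM hM t20.
have -> : t / 2 + t / 2 = t by field.
rewrite -/U => <-.
pose v (s : R) x := Pop b m (fun _ => D) (U h s) x - U h s x.
have du (s : R) x : is_derive s 1 (fun s : R => U h s x) (v s x) := is_derive_heat b_ge0 m_gt0 b_le hM s x.
pose F (s : R) := 2 * Qf b m D h * s + ip m D (U h s) (U h s).
have dF (s : R) : is_derive s 1 F (2 * Qf b m D h * 1 + (ip m D (U h s) (v s) + ip m D (v s) (U h s))).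
  have h1 := is_derive_ip m D (du s) (du s); exact: is_deriveD.
have := @nondecr_of_derive R F _ 0 (t / 2) t20 (fun s _ => dF s).
have -> : F 0 = ip m D h h.
  by rewrite /F mulr0 add0r; congr ip; apply/funext => x; rewrite /U heat0.
have -> : F (t / 2) = t * Qf b m D h + ip m D (U h (t / 2)) (U h (t / 2)) by rewrite /F; field.
apply=> s /andP[s0 _].
have := Qf_heat_le hM s0.
rewrite [ip m D (U h s) (v s)]ipC.
have -> : ip m D (v s) (U h s) = - Qf b m D (U h s).
  by rewrite [LHS]ipBl ipC ip_P// /Qf opprB.
lra.
Qed.

(** A kernel bounded by [K] gives [<U_t h, h> <= K ||h||_1^2]. The result is Nash's inequality
    before optimization in [t]. *)
Lemma ip_le_of_kernel (M K : R) h (t : R) : (forall x, `|h x| <= M) -> (forall x, 0 <= h x) -> 0 <= t ->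
  (forall x y, x \in D -> y \in D -> U (dirac_at m y) t x <= K) ->
  ip m D h h <= t * Qf b m D h + K * (\sum_(x <- D) m x * h x) ^+ 2.
Proof.
move=> hM h0 t0 hK; apply: le_trans (ip_le_heat hM t0) _; rewrite lerD2l.
have -> : K * (\sum_(x <- D) m x * h x) ^+ 2 = \sum_(y <- D) m y * ((\sum_(x <- D) m x * (K * h x)) * h y).
  rewrite expr2 mulrA mulr_sumr; apply: eq_bigr => y _.
  rewrite mulrCA; congr (_ * (_ * _)).
  by rewrite mulr_sumr; apply: eq_bigr => x _; rewrite mulrCA.
rewrite /ip !big_seq; apply: ler_sum => y yD.
rewrite ler_wpM2l ?(ltW (m_gt0 y))// ler_wpM2r//.
rewrite /U (heat_dirac b_ge0 b_sym m_gt0 b_le D_uniq hM t0 yD) [leLHS]big_seq; apply: ler_sum => x xD.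
by rewrite ler_wpM2l ?(ltW (m_gt0 x))// ler_wpM2r// hK.
Qed.

End HeatNash.

(** * Kernel bounds on a ball from Gaussian bounds and doubling *)

Section SobolevFromGaussian.
Variables (R : realType) (X : countType) (b : X -> X -> R) (m : X -> R).
Hypothesis G : normalized_graph b m.
Let bg := ngraph_graph G.
Let b_ge0 : forall x y, 0 <= b x y := graph_ge0 bg.
Let b_sym : forall x y, b x y = b y x := graph_sym bg.
Let m_gt0 : forall x, 0 < m x := ngraph_gt0 G.
Let b_conn := ngraph_connected G.

(** Including [B_o(r)] in [B_x(2r)] is no help when [2r > R2], so the comparison passes through a
    midpoint [z]: [B_o(r/2)] lies in [B_z(r)] and [B_z(r/4)] in [B_x(r)]. Doubling at [o] and at [z]
    yields [2^n] and [4^n]. *)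
Lemma vol_near_center (Phi n R1 R2 r : R) (o x : X) : 0 < Phi -> 0 < n -> 64 <= R1 ->
  doubling b m Phi n R1 R2 (gball b o R2) -> 4 * R1 <= r -> r <= R2 ->
  (gdist b o x)%:R <= r -> vol b m o r <= Phi ^+ 2 * 8 `^ n * vol b m x r.
Proof.
move=> P0 n0 R64 hV r4 rR hx.
have r0 : 0 < r by lra.
have p2 : (r / (r / 2)) `^ n = 2 `^ n by congr (_ `^ _); field; rewrite gt_eqF.
have p4 : (r / (r / 4)) `^ n = 4 `^ n by congr (_ `^ _); field; rewrite gt_eqF.
have [z [z1 z2]] := gdist_midpoint b_conn o x.
set k := gdist b o x in hx z1 z2.
have kh : (k./2)%:R + (uphalf k)%:R = k%:R :> R.
  by rewrite -natrD uphalf_half addnCA addnn odd_double_half.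
have ku : (uphalf k)%:R <= (k./2)%:R + 1 :> R.
  by rewrite natr1 ler_nat uphalf_half; case: (odd k).
have kl : (k./2)%:R <= (uphalf k)%:R :> R by rewrite ler_nat uphalf_half leq_addl.
rewrite -(ler_nat R) in z1; rewrite -(ler_nat R) in z2.
have oB : gball b o R2 o by rewrite /gball /= gdistxx; lra.
have zB : gball b o R2 z by rewrite /gball /=; lra.
have h1 := hV o oB (r / 2) r; rewrite p2 in h1.
have h2 := hV z zB (r / 4) r; rewrite p4 in h2.
have h3 : vol b m o (r / 2) <= vol b m z r.
  apply: (vol_le G) => w hw; apply: le_trans (_ : (gdist b z o)%:R + (gdist b o w)%:R <= _).
    by rewrite -natrD ler_nat; apply: gdist_tri.
  by rewrite (gdistC bg b_conn z o); lra.
have h4 : vol b m z (r / 4) <= vol b m x r.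
  apply: (vol_le G) => w hw; apply: le_trans (_ : (gdist b x z)%:R + (gdist b z w)%:R <= _).
    by rewrite -natrD ler_nat; apply: gdist_tri.
  by rewrite (gdistC bg b_conn x z); lra.
have c0 (a : R) : 0 < a -> 0 <= Phi * a `^ n by move=> a0; rewrite mulr_ge0 ?powR_ge0 ?(ltW P0).
have -> : Phi ^+ 2 * 8 `^ n * vol b m x r = Phi * 2 `^ n * (Phi * 4 `^ n * vol b m x r).
  have -> : 8 = 2 * 4 :> R by rewrite -natrM.
  by rewrite powRM//; ring.
apply: le_trans (h1 _ _ rR) _; try lra.
rewrite ler_wpM2l ?c0//; apply: le_trans h3 _.
apply: le_trans (h2 _ _ rR) _; try lra.
by rewrite ler_wpM2l ?c0.
Qed.

Lemma sqrt_inv_le (a c d : R) : 0 < a -> 0 < c -> a^-1 <= d -> c^-1 <= d -> (Num.sqrt (a * c))^-1 <= d.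
Proof.
move=> a0 c0 h1 h2; have d0 : 0 <= d by apply: le_trans h1; rewrite invr_ge0 ltW.
rewrite -[leRHS]ger0_norm// -sqrtr_sqr -sqrtrV ?mulr_ge0 ?(ltW a0) ?(ltW c0)//.
by apply: ler_wsqrtr; rewrite invfM expr2; apply: ler_pM; rewrite ?invr_ge0 ?(ltW a0) ?(ltW c0).
Qed.

(** [1 + a <= e^a] at [a = 2s/n] gives [max 1 s <= (n/2) e^(2s/n)]; the power [n/2] then costs just
    [e^s <= e^z]. *)
Lemma poly_exp_bound (n s z : R) : 2 < n -> 0 <= s -> s <= z ->
  Num.max 1 s `^ (n / 2) * expR (- z) <= (n / 2) `^ (n / 2).
Proof.
move=> hn s0 sz; have n0 : 0 < n by lra.
have n2 : 0 < n / 2 by rewrite divr_gt0.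
have h : Num.max 1 s <= n / 2 * expR (2 / n * s).
  have e1 := expR_ge1Dx (2 / n * s).
  have e2 : 0 <= 2 / n * s by rewrite mulr_ge0 ?divr_ge0 ?(ltW n0).
  have h1 : n / 2 * (1 + 2 / n * s) <= n / 2 * expR (2 / n * s) by rewrite ler_wpM2l ?(ltW n2).
  have h2 : n / 2 * (1 + 2 / n * s) = n / 2 + s by field; rewrite gt_eqF.
  rewrite h2 in h1; rewrite ge_max; apply/andP; split; lra.
rewrite expRN ler_pdivrMr ?expR_gt0//.
apply: le_trans (_ : (n / 2 * expR (2 / n * s)) `^ (n / 2) <= _).
  apply: ge0_ler_powR; rewrite ?nnegrE ?(ltW n2)//; first by rewrite le_max ler01.
  by rewrite mulr_ge0 ?expR_ge0 ?(ltW n2).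
rewrite powRM ?expR_ge0 ?(ltW n2)// ler_wpM2l ?powR_ge0// -expRM ler_expR.
by have -> : 2 / n * s * (n / 2) = s by field; rewrite gt_eqF.
Qed.

Section Kernel.
Variables (Phi Psi mu n R1 R2 r : R) (o : X).
Hypothesis Phi0 : 0 < Phi.
Hypothesis hn : 2 < n.
Hypothesis R64 : 64 <= R1.
Hypothesis r4 : 4 * R1 <= r.
Hypothesis rR : r <= R2.
Hypothesis hmu : volume_ratio b m R1 = mu%:E.
Hypothesis hG : gaussian b m 1 Psi n R1 R2 (gball b o R2).
Hypothesis hV : doubling b m Phi n R1 R2 (gball b o R2).

(** [Phi^3 8^n] compares volumes within the ball, [|mu|] serves times below [R1^2], and the other
    summand later times. The absolute value makes positivity immediate for every real [mu]. *)
Definition kerC : R := Phi ^+ 3 * 8 `^ n * (`|mu| + Psi ^+ 2 * (n / 2) `^ (n / 2)).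

Let Vo := vol b m o r.

Lemma inv_vol_le (x : X) (s : R) : (gdist b o x)%:R <= r -> R1 <= s -> s <= r ->
  (vol b m x s)^-1 <= Phi ^+ 3 * 8 `^ n * (r / s) `^ n / Vo.
Proof.
move=> hx s1 sr; have s0 : 0 < s by apply: lt_le_trans s1; apply: lt_le_trans R64.
have r0 : 0 < r by apply: lt_le_trans sr.
have n0 : 0 < n by apply: lt_trans hn.
have Vs : 0 < vol b m x s by apply: (vol_gt0 G); exact: ltW.
have V0 : 0 < Vo by apply: (vol_gt0 G); exact: ltW.
have h1 := vol_near_center Phi0 n0 R64 hV r4 rR hx.
have xB : gball b o R2 x by rewrite /gball /=; apply: le_trans rR.
have h2 := hV xB s1 sr rR.
rewrite ler_pdivlMr// mulrC ler_pdivrMr//; apply: le_trans h1 _.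
have c0 : 0 <= Phi ^+ 2 * 8 `^ n by rewrite mulr_ge0 ?powR_ge0 ?sqr_ge0.
apply: le_trans (ler_wpM2l c0 h2) _.
by rewrite le_eqVlt; apply/orP; left; apply/eqP; ring.
Qed.

(* For [t < R1^2] the Gaussian bound is not available; there [p <= (m m)^(-1/2)] and
   [m >= V(R1) / mu]. *)
Lemma heat_ball_le (D : seq X) (x y : X) (t : R) : uniq D -> x \in D -> y \in D ->
  (gdist b o x)%:R <= r -> (gdist b o y)%:R <= r -> 0 < t -> t <= r ^+ 2 ->
  heat b m (fun _ => D) (dirac_at m y) t x <= kerC * r `^ n / Vo * t `^ (- (n / 2)).
Proof.
move=> uD xD yD hx hy t0 tr.
have n0 : 0 < n by apply: lt_trans hn.
have R10 : 0 < R1 by apply: lt_le_trans R64.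
have r0 : 0 < r by apply: lt_le_trans r4; rewrite mulr_gt0.
have V0 : 0 < Vo by apply: (vol_gt0 G); exact: ltW.
have bD z := b_le_seq G z uD.
pose c := Phi ^+ 3 * 8 `^ n; have c0 : 0 <= c by rewrite mulr_ge0 ?powR_ge0 ?exprn_ge0 ?(ltW Phi0).
have N0 : 0 <= (n / 2) `^ (n / 2) by apply: powR_ge0.
have rn (s : R) : 0 < s -> (r / s) `^ n = r `^ n * (s ^+ 2) `^ (- (n / 2)).
  move=> s0; rewrite powRM ?invr_ge0 ?(ltW r0) ?(ltW s0)//; congr (_ * _).
  rewrite -powR_inv1 ?(ltW s0)// -(powR_mulrn 2 (ltW s0)) -!powRrM; congr (_ `^ _).
  by field.
have [tR|tR] := ltP t (R1 ^+ 2).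
- pose d := c * `|mu| * r `^ n / Vo * t `^ (- (n / 2)).
  have d1 z : (gdist b o z)%:R <= r -> (m z)^-1 <= d.
    move=> hz; have Vz : 0 < vol b m z R1 by apply: (vol_gt0 G); exact: ltW.
    have h1 : vol b m z R1 / m z <= `|mu|.
      apply: le_trans (ler_norm mu); rewrite -lee_fin -hmu; apply: ereal_sup_ubound.
      by exists z => //; rewrite -(ngraph_deg G).
    rewrite -ler_pdivlMl// mulrC in h1; have h2 := inv_vol_le hz (lexx R1).
    have {}h2 : (vol b m z R1)^-1 <= c * (r / R1) `^ n / Vo by apply: h2; apply: le_trans r4; lra.
    have h3 : `|mu| / vol b m z R1 <= `|mu| * (c * (r / R1) `^ n / Vo) by rewrite ler_wpM2l.
    apply: le_trans (le_trans h1 h3) _.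
    have -> : d = `|mu| * (c * (r `^ n * t `^ (- (n / 2))) / Vo) by rewrite /d; ring.
    rewrite ler_wpM2l// ler_wpM2r ?invr_ge0 ?(ltW V0)// ler_wpM2l// rn// ler_wpM2l ?powR_ge0//.
    rewrite !powRN lef_pV2 ?posrE ?powR_gt0 ?exprn_gt0//.
    by apply: ge0_ler_powR; rewrite ?nnegrE ?sqr_ge0 ?(ltW t0) ?divr_ge0 ?(ltW n0) ?(ltW tR).
  (* Davies' estimate with zero weight and zero rate: the semigroup contracts [l2], so squared
     half-time norms are at most [1 / m z]. *)
  have Q0 w : 0 * ip m D w w <= Qf b m D w by rewrite mul0r; apply: Qf_ge0.
  have t20 : 0 <= t / 2 by rewrite divr_ge0// ltW.
  have lip0 z w : 0 < b z w -> `|(0:R) - 0| <= 0 by rewrite subrr normr0.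
  have c1 : cosh1 (0 : R) = 1 by rewrite /cosh1 oppr0 expR0; field.
  have wn z : z \in D -> wnorm b m D (fun=> 0) z (t / 2) <= (m z)^-1 * expR (2 * 0).
    move=> zD; have := wnorm_le b_ge0 b_sym m_gt0 bD uD (lexx 0) lip0 Q0 t20 zD.
    by rewrite c1 subrr subr0 mulr0 mul0r expR0 mulr1.
  have i0 z : 0 <= (m z)^-1 by rewrite invr_ge0 ltW.
  have wn' z : z \in D -> wnorm b m D (fun=> - 0) z (t / 2) <= (m z)^-1 * expR (2 * - 0).
    by rewrite oppr0; exact: wn.
  have := heat_dirac_le b_ge0 b_sym m_gt0 bD uD (ltW t0) yD xD (i0 y) (i0 x) (wn y yD) (wn' x xD).
  rewrite subrr expR0 mulr1 => h; apply: le_trans h _.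
  apply: le_trans (_ : d <= _).
    have -> : Num.sqrt ((m y)^-1 * (m x)^-1) = (Num.sqrt (m y * m x))^-1.
      by rewrite -invfM sqrtrV// mulr_ge0 ?(ltW (m_gt0 _)).
    by apply: sqrt_inv_le => //; apply: d1.
  rewrite /d /kerC -/c; rewrite ler_wpM2r ?powR_ge0// ler_wpM2r ?invr_ge0 ?(ltW V0)//.
  by rewrite ler_wpM2r ?powR_ge0// ler_wpM2l// lerDl mulr_ge0// sqr_ge0.
- apply: le_trans (heat_le_hk G x y uD (ltW t0)) _; rewrite -(heat_kernelE G)//.
  have xB : gball b o R2 x by rewrite /gball /=; apply: le_trans rR.
  have yB : gball b o R2 y by rewrite /gball /=; apply: le_trans rR.
  have := hG tR xB yB; cbv zeta.
  have st : Num.sqrt t <= r.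
    by rewrite -[leRHS]ger0_norm ?(ltW r0)// -sqrtr_sqr; apply: ler_wsqrtr.
  have s1 : R1 <= Num.sqrt t.
    by rewrite -[leLHS]ger0_norm ?(ltW R10)// -sqrtr_sqr; apply: ler_wsqrtr.
  (* Since [sqrt t <= r <= R2], [tau] is [sqrt t] and the exponent with [Lambda] vanishes. *)
  rewrite min_l; last exact: le_trans rR.
  have R20 : 0 < R2 by apply: lt_le_trans rR.
  rewrite [Num.min t _]min_l; last first.
    by apply: le_trans tr _; rewrite lerXn2r ?nnegrE ?(ltW r0) ?(ltW R20).
  rewrite subrr mulr0 sub0r !expr1n invr1 mul1r mulr1 => h; apply: le_trans h _.
  set rho : R := (gdist b x y)%:R; set s := Num.sqrt (t ^+ 2 + rho ^+ 2) - t.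
  have s0 : 0 <= s.
    rewrite subr_ge0 -[leLHS]ger0_norm ?(ltW t0)// -sqrtr_sqr; apply: ler_wsqrtr.
    by rewrite lerDl sqr_ge0.
  have h1 := poly_exp_bound hn s0 (zeta_ge t0 (ler0n R (gdist b x y))).
  have q0 : 0 < Num.sqrt t by rewrite sqrtr_gt0.
  have vz z : 0 < vol b m z (Num.sqrt t) by apply: (vol_gt0 G); exact: ltW.
  have h2 := sqrt_inv_le (vz x) (vz y) (inv_vol_le hx s1 st) (inv_vol_le hy s1 st).
  rewrite (rn _ q0) sqr_sqrtr ?(ltW t0)// -/c in h2.
  set W := Num.sqrt _ in h2 *.
  have -> : Psi ^+ 2 * (Num.max 1 s `^ (n / 2) / W) * expR (- zeta 1 rho t) =
    Psi ^+ 2 * (Num.max 1 s `^ (n / 2) * expR (- zeta 1 rho t)) * W^-1 by ring.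
  apply: le_trans (_ : Psi ^+ 2 * (n / 2) `^ (n / 2) * (c * (r `^ n * t `^ (- (n / 2))) / Vo) <= _).
    apply: ler_pM => //.
    + by apply: mulr_ge0; [exact: sqr_ge0|rewrite mulr_ge0 ?powR_ge0 ?expR_ge0].
    + by rewrite invr_ge0 sqrtr_ge0.
    + by rewrite ler_wpM2l ?sqr_ge0.
  have -> : kerC * r `^ n / Vo * t `^ (- (n / 2)) =
     (`|mu| + Psi ^+ 2 * (n / 2) `^ (n / 2)) * (c * (r `^ n * t `^ (- (n / 2))) / Vo).
    by rewrite /kerC -/c; ring.
  rewrite ler_wpM2r ?lerDr// mulr_ge0 ?invr_ge0 ?(ltW V0)//.
  by rewrite mulr_ge0// mulr_ge0 ?powR_ge0.
Qed.

End Kernel.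
End SobolevFromGaussian.

Lemma Qf_abs (R : realType) (X : countType) (b : X -> X -> R) (m : X -> R) D (u : X -> R) :
  (forall x y, 0 <= b x y) -> Qf b m D (fun x => `|u x|) <= Qf b m D u.
Proof.
move=> b0; rewrite /Qf; have -> : ip m D (fun x => `|u x|) (fun x => `|u x|) = ip m D u u.
  by apply: eq_bigr => x _; rewrite -normrM -expr2 ger0_norm ?sqr_ge0// expr2.
rewrite lerD2l lerN2; apply: ler_sum => x _; apply: ler_sum => y _.
by rewrite ler_wpM2l// -normrM ler_norm.
Qed.

Lemma psi_gt0 (R : realType) (phi n R1 : R) : 0 < phi -> 0 < R1 -> 0 < psiA phi n + psiB phi n R1.
Proof.
move=> phi0 R10; apply: ltr_wpDl.
  apply: divr_ge0; first by rewrite mulr_ge0 ?expR_ge0 ?mvC_ge0 ?lowc_gt0.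
  by rewrite mulr_ge0 ?powR_ge0 ?(ltW (dblc_gt0 n phi0)).
rewrite divr_gt0 ?lowc_gt0 ?powR_gt0//.
by apply: mulr_gt0 => //; exact: exprn_gt0.
Qed.

Lemma kerC_gt0 (R : realType) (Phi Psi mu n : R) : 0 < Phi -> 0 < Psi -> 2 < n -> 0 < kerC Phi Psi mu n.
Proof.
move=> Phi0 Psi0 hn; apply: mulr_gt0; first by rewrite mulr_gt0 ?exprn_gt0 ?powR_gt0.
apply: ltr_wpDl => //; apply: mulr_gt0; first exact: exprn_gt0.
by rewrite powR_gt0// divr_gt0// (lt_trans _ hn).
Qed.

Lemma nashC_gt0 (R : realType) (n : R) : 0 < nashC n.
Proof. by rewrite /nashC !mulr_gt0 ?powR_gt0. Qed.

Section SobolevOfGaussian.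
Variables (R : realType) (X : countType) (b : X -> X -> R) (m : X -> R).
Hypothesis G : normalized_graph b m.

(* Nash's inequality is trivial for [t > r^2], since the energy contains [||f||^2 / r^2]. *)
Lemma sobolev_of_gaussian (Phi Psi mu n R1 R2 : R) (o : X) : 0 < Phi -> 0 < Psi -> 2 < n -> 64 <= R1 ->
  volume_ratio b m R1 = mu%:E ->
  gaussian b m 1 Psi n R1 R2 (gball b o R2) -> doubling b m Phi n R1 R2 (gball b o R2) ->
  sobolev b m (nashC n * kerC Phi Psi mu n `^ (2 / n)) n (4 * R1) R2 [set o].
Proof.
move=> Phi0 Psi0 hn R64 hmu hG hV _ -> r r4 rR u us.
have b0 := graph_ge0 (ngraph_graph G); have bs := graph_sym (ngraph_graph G).
have m0 := ngraph_gt0 G.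
have n0 : 0 < n by lra.
have r0 : 0 < r by lra.
pose D := ballseq b o r; have uD : uniq D := ballseq_uniq b o r.
have hD x : x \in D -> (gdist b o x)%:R <= r by rewrite (mem_ballseq G).
have hu x : u x != 0 -> x \in D by move=> /us; rewrite (mem_ballseq G).
set V := vol b m o r; have V0 : 0 < V by apply: (vol_gt0 G); exact: ltW.
have C0 : 0 < kerC Phi Psi mu n by apply: kerC_gt0.
set C := kerC Phi Psi mu n in C0 *.
have K0 : 0 < C * r `^ n / V by rewrite divr_gt0// mulr_gt0 ?powR_gt0.
have bD z := b_le_seq G z uD.
have nash (f : X -> R) (t : R) : (forall x, 0 <= f x) -> 0 < t ->
    ip m D f f <= t * energy b m D r f + C * r `^ n / V * t `^ (- (n / 2)) * (\sum_(x <- D) m x * f x) ^+ 2.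
  move=> f0 t0; have Q0 := Qf_ge0 b0 bs bD f; have I0 := ip_ge0 D m0 f.
  have [tr|tr] := leP t (r ^+ 2); last first.
    apply: ler_wpDr; first by rewrite mulr_ge0 ?sqr_ge0// mulr_ge0 ?powR_ge0 ?(ltW K0).
    rewrite /energy mulrDr ler_wpDl//; first by rewrite !mulr_ge0 ?(ltW t0).
    by rewrite mulrCA ler_peMr// ler_pdivlMr ?exprn_gt0// mul1r ltW.
  (* The heat estimates ask for a globally bounded function; only the values on [D] enter the
     inequality. *)
  pose g x := if x \in D then f x else 0.
  have gE (F : X -> R -> R) : \sum_(x <- D) F x (g x) = \sum_(x <- D) F x (f x).
    by rewrite !big_seq; apply: eq_bigr => x xD; rewrite /g xD.
  have eI : ip m D g g = ip m D f f := gE (fun x s => m x * (s * s)).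
  have eQ : Qf b m D g = Qf b m D f.
    rewrite /Qf eI; congr (_ - _); rewrite /bf (gE (fun x s => \sum_(y <- D) b x y * (s * g y))).
    by apply: eq_bigr => x _; exact: (gE (fun y s => b x y * (f x * s))).
  have g0 x : 0 <= g x by rewrite /g; case: ifP.
  have gM x : `|g x| <= \sum_(x <- D) g x.
    rewrite ger0_norm// {1}/g; case: ifP => xD; last exact: sumr_ge0.
    by rewrite (bigD1_seq x)//= {1}/g xD lerDl sumr_ge0.
  have := ip_le_of_kernel b0 bs m0 bD uD gM g0 (ltW t0)
    (fun x y xD yD => heat_ball_le G Phi0 hn R64 r4 rR hmu hG hV uD xD yD (hD _ xD) (hD _ yD) t0 tr).
  rewrite eI eQ (gE (fun x s => m x * s)) => h; apply: le_trans h _.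
  rewrite lerD2r ler_wpM2l ?(ltW t0)// /energy.
  have : 0 <= ip m D f f / r ^+ 2 by rewrite divr_ge0// sqr_ge0.
  lra.
have := nash_sobolev b0 bs m0 bD hn K0 nash (fun x => normr_ge0 (u x)).
rewrite (lpnorm_seq uD _ m0 hu) ?divr_gt0 ?mulr_gt0 ?subr_gt0//.
rewrite (grad_norm G uD hu) (lpnorm2_seq uD m0 hu) -EFin_expe -!EFinM -EFinD lee_fin.
have -> : \sum_(x <- D) m x * `|u x| `^ (2 * n / (n - 2)) = \sum_(x <- D) `|u x| `^ (2 * n / (n - 2)) * m x.
  by apply: eq_bigr => x _; rewrite mulrC.
set S := \sum_(x <- D) _ * m x.
have -> : (S `^ (2 * n / (n - 2))^-1) ^+ 2 = S `^ (1 - 2 / n).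
  rewrite -powR_mulrn ?powR_ge0// -powRrM; congr (_ `^ _); field.
  by rewrite subr_eq0 !gt_eqF//; lra.
have -> : (C * r `^ n / V) `^ (2 / n) = C `^ (2 / n) * r ^+ 2 / V `^ (2 / n).
  have rn0 : 0 <= r `^ n by apply: powR_ge0.
  rewrite powRM ?invr_ge0 ?(ltW V0) ?(mulr_ge0 (ltW C0) rn0)//; congr (_ * _).
    rewrite (powRM _ (ltW C0) rn0) -powRrM -(powR_mulrn 2 (ltW r0)).
    by congr (_ * _ `^ _); field; rewrite gt_eqF.
  by rewrite -powR_inv1 ?(ltW V0)// -powRrM mulN1r powRN.
have en : energy b m D r (fun x => `|u x|) <= 2 * Qf b m D u + r ^- 2 * \sum_(x <- D) m x * u x ^+ 2.
  rewrite /energy; apply: lerD; first by rewrite ler_wpM2l// Qf_abs.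
  rewrite mulrC ler_wpM2l ?invr_ge0 ?sqr_ge0// le_eqVlt; apply/orP; left; apply/eqP.
  by apply: eq_bigr => x _; rewrite -normrM -expr2 ger0_norm ?sqr_ge0.
set E := 2 * _ + _ in en *; set A := nashC n * C `^ (2 / n).
have N0 := nashC_gt0 n.
have A0 : 0 < A * r ^+ 2 by rewrite mulr_gt0 ?exprn_gt0// mulr_gt0 ?powR_gt0.
set W := V `^ (2 / n); have W0 : 0 < W by rewrite powR_gt0.
move=> h; rewrite mulrAC ler_pdivrMr// mulrC -ler_pdivlMr//.
apply: le_trans h _; have -> : nashC n * (C `^ (2 / n) * r ^+ 2 / W) = A * r ^+ 2 / W.
  by rewrite /A; ring.
have aw : 0 <= A * r ^+ 2 / W by rewrite divr_ge0 ?ltW.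
apply: le_trans (ler_wpM2l aw en) _.
by rewrite le_eqVlt; apply/orP; left; apply/eqP; ring.
Qed.

Lemma doubling_of_sobolev (phi n R1 R2 : R) (B : set X) : 0 < phi -> 2 < n -> 1 <= R1 ->
  sobolev b m phi n R1 R2 B -> doubling b m (dblc phi n)^-1 n R1 R2 B.
Proof.
move=> phi0 hn R11 hS x xB s r s1 sr rR.
have R10 : 0 < R1 by lra.
have s0 : 0 < s by lra.
have r0 : 0 < r by lra.
have r1 : 1 <= r by lra.
have Rr : R1 <= r by lra.
have h := volume_lower G phi0 hn r1
  (fun D uD => sobolev_on_of_sobolev G hS phi0 hn R10 xB Rr rR uD) s0 sr.
have d0 := dblc_gt0 n phi0.
have p0 : 0 < (s / r) `^ n by rewrite powR_gt0// divr_gt0.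
have -> : (r / s) `^ n = ((s / r) `^ n)^-1.
  by rewrite -powRN -invf_div -powR_inv1 ?divr_ge0 ?ltW// -powRrM mulN1r.
by rewrite -invfM mulrC ler_pdivlMr ?mulr_gt0// mulrC.
Qed.

Lemma gaussian_of_sobolev (phi n R1 R2 : R) (B : set X) : 0 < phi -> 2 < n -> 64 <= R1 -> 8 * R1 <= R2 ->
  sobolev b m phi n R1 R2 B ->
  gaussian b m 1 (Num.sqrt (psiA phi n + psiB phi n R1)) n (4 * R1) R2 B.
Proof.
move=> phi0 hn R64 R12 hS t ht x y xB yB; cbv zeta.
have R10 : 0 < R1 by lra.
have hSz z : B z -> sobolev_at b m phi n R1 R2 z.
  by move=> zB r D r1 r2 uD; exact: (sobolev_on_of_sobolev G hS phi0 hn R10 zB r1 r2 uD).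
have := gaussian_bound G phi0 hn R64 R12 (hSz x xB) (hSz y yB) ht; cbv zeta.
by rewrite !expr1n invr1 mul1r mulr1 sqr_sqrtr// ltW// psi_gt0.
Qed.

End SobolevOfGaussian.

(** * The two implications *)

Theorem theorem1p3 (R : realType) (n R1 : R) (hn : 2 < n)
    (hR1 : 512 <= 8 * R1) :
  (forall phi : R, 0 < phi ->
     exists Phi Psi : R, 0 < Phi /\ 0 < Psi /\
       forall (X : countType) (b : X -> X -> R) (m : X -> R) (R2 : R),
         normalized_graph b m ->
         8 * R1 <= R2 -> (R2%:E <= gdiam b * (2^-1)%:E)%E ->
         (volume_ratio b m R1 < +oo)%E ->
         forall B : set X,
           sobolev b m phi n R1 R2 B ->
           gaussian b m 1 Psi n (4 * R1) R2 B /\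
           doubling b m Phi n R1 R2 B) /\
  (forall Phi Psi mu : R, 0 < Phi -> 0 < Psi ->
     exists phi : R, 0 < phi /\
       forall (X : countType) (b : X -> X -> R) (m : X -> R) (R2 : R),
         normalized_graph b m ->
         8 * R1 <= R2 -> (R2%:E <= gdiam b * (2^-1)%:E)%E ->
         volume_ratio b m R1 = mu%:E ->
         forall o : X,
           gaussian b m 1 Psi n R1 R2 (gball b o R2) ->
           doubling b m Phi n R1 R2 (gball b o R2) ->
           sobolev b m phi n (4 * R1) R2 [set o]).
Proof.
have R64 : 64 <= R1 by lra.
split.
- move=> phi phi0; have p0 := psi_gt0 n phi0 (lt_le_trans (ltr0n R 64) R64).
  exists (dblc phi n)^-1, (Num.sqrt (psiA phi n + psiB phi n R1)).
  split; first by rewrite invr_gt0 dblc_gt0.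
  split; first by rewrite sqrtr_gt0.
  move=> X b m R2 G R12 _ _ B hS; split; first exact: gaussian_of_sobolev.
  by apply: doubling_of_sobolev hS => //; apply: le_trans R64; rewrite ler1n.
- move=> Phi Psi mu Phi0 Psi0; exists (nashC n * kerC Phi Psi mu n `^ (2 / n)).
  split; first by rewrite mulr_gt0 ?nashC_gt0 ?powR_gt0 ?kerC_gt0.
  move=> X b m R2 G R12 _ hmu o; exact: sobolev_of_gaussian.
Qed.
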